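(* For every fixed $b \in (0,1]$, $$\chi(n,b) \le \left(\sqrt{\frac{1}{b^2}+\frac{1}{2}}+o(1)\right)^n \quad (n\to\infty).$$ That is, there is a function $\epsilon_b:\mathbb{N}\to\mathbb{R}$ with $\epsilon_b(n)\to 0$ as $n\to\infty$ such that for every $n\in\mathbb{N}$, $\chi(n,b) \le \left(\sqrt{\frac{1}{b^2}+\frac{1}{2}}+\epsilon_b(n)\right)^n$.
   Context: For $n\in\mathbb{N}$ and $b\in(0,1]$, $\chi(n,b)$ denotes the smallest integer $k$ such that every set $F\subset\mathbb{R}^n$ of diameter $1$ (Euclidean metric) can be written as $F = F_1\cup\dots\cup F_k$ with $\operatorname{diam} F_i < b$ for every $i$ (diameters strictly less than $b$). In particular $\chi(n,1)$ is the Borsuk number of $\mathbb{R}^n$. *)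

(* Defs.v *)
From HB Require Import structures.
From mathcomp Require Import all_boot all_order all_algebra.
From mathcomp Require Import lra.
From mathcomp Require Import all_classical all_reals all_analysis.

Set Implicit Arguments.
Unset Strict Implicit.
Unset Printing Implicit Defensive.

Import Order.TTheory GRing.Theory Num.Theory.
Import numFieldNormedType.Exports.

Local Open Scope classical_set_scope.
Local Open Scope ring_scope.

(* The library's norm `|x - y| on 'rV[R]_n is the sup norm, hence this one. *)
Definition edist (R : realType) (n : nat) (x y : 'rV[R]_n) : R :=
  Num.sqrt (\sum_(i < n) (x ord0 i - y ord0 i) ^+ 2).

(* With this convention diam set0 = -oo, so empty parts are always allowed in
   the decompositions below, and a set of diameter 1 is nonempty. *)
Definition diam (R : realType) (n : nat) (A : set 'rV[R]_n) : \bar R :=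
  ereal_sup [set (edist p.1 p.2)%:E | p in A `*` A].

Definition partitionable (R : realType) (n : nat) (b : R) (k : nat) : Prop :=
  forall F : set 'rV[R]_n, diam F = 1%E ->
    exists2 G : 'I_k -> set 'rV[R]_n,
      F = \bigcup_i G i & forall i, (diam (G i) < b%:E)%E.

(* The default value 0 of xget is never used when 0 < b, see chiP. *)
Definition chi (R : realType) (n : nat) (b : R) : nat :=
  xget 0%N [set k | partitionable n b k /\
                    forall j, partitionable n b j -> (k <= j)%N].

Lemma edist_coord (R : realType) (n : nat) (x y : 'rV[R]_n) (i : 'I_n) :
  `|x ord0 i - y ord0 i| <= edist x y.
Proof.
rewrite /edist -sqrtr_sqr ler_wsqrtr// (bigD1 i)//= lerDl.
by apply: sumr_ge0 => j _; exact: sqr_ge0.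
Qed.

Lemma edist_le (R : realType) (n : nat) (x y : 'rV[R]_n) (c : R) : 0 <= c ->
  (forall i, `|x ord0 i - y ord0 i| <= c) -> edist x y <= n%:R * c.
Proof.
move=> c0 h; have nc0 : 0 <= n%:R * c by rewrite mulr_ge0.
rewrite /edist -[leRHS]ger0_norm// -sqrtr_sqr ler_wsqrtr//.
apply: (@le_trans _ _ (\sum_(i < n) c ^+ 2)).
  by apply: ler_sum => i _; rewrite -real_normK ?num_real// lerXn2r ?nnegrE.
rewrite sumr_const card_ord -[leLHS]mulr_natl exprMn ler_wpM2r ?sqr_ge0//.
by rewrite -natrX ler_nat; case: (n) => // m; rewrite expnS leq_pmulr// expn1.
Qed.

Lemma partitionable_ex (R : realType) (n : nat) (b : R) : 0 < b ->
  exists k, partitionable n b k.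
Proof.
move=> b0; pose M := (Num.truncn (n%:R / b)).+1.
have M0 : 0 < M%:R :> R by rewrite ltr0n.
have nMb : n%:R * M%:R^-1 < b.
  have : n%:R / b < M%:R by rewrite /M truncnS_gt.
  by rewrite !ltr_pdivrMr// mulrC.
exists #|{: {ffun 'I_n -> 'I_(M.*2.+1)}}| => F dF.
have F1 x y : F x -> F y -> edist x y <= 1.
  move=> Fx Fy; rewrite -lee_fin -dF; apply: ereal_sup_ubound.
  by exists (x, y).
have [x0 Fx0] : F !=set0.
  apply/set0P/eqP => F0; move: dF.
  by rewrite /diam F0 set0X image_set0 ereal_sup0.
pose t (x : 'rV[R]_n) (i : 'I_n) := (x ord0 i - x0 ord0 i + 1) * M%:R.
have t0 x i : F x -> 0 <= t x i <= M.*2%:R.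
  move=> Fx; have := le_trans (edist_coord x x0 i) (F1 _ _ Fx Fx0).
  rewrite ler_norml => /andP[h1 h2]; rewrite /t -muln2 natrM mulrC.
  by rewrite mulr_ge0 ?ler_pM2l//; lra.
pose c x := [ffun i => inord (Num.truncn (t x i)) : 'I_(M.*2.+1)].
exists (fun j => F `&` [set x | c x = enum_val j]).
  apply/seteqP; split => [x Fx|x [j _ []]//].
  by exists (enum_rank (c x)) => //; split => //=; rewrite enum_rankK.
move=> j; apply: (@le_lt_trans _ _ (n%:R * M%:R^-1)%:E); last by rewrite lte_fin.
apply: ge_ereal_sup => _ [[x y] /= [[Fx cx] [Fy cy]] <-].
rewrite lee_fin; apply: edist_le => [|i]; first by rewrite invr_ge0 ltW.
have cE z : F z -> c z i = Num.truncn (t z i) :> nat.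
  move=> Fz; have /andP[z0 z1] := t0 z i Fz.
  rewrite ffunE inordK// ltnS truncn_le_nat (le_lt_trans z1)//.
  by rewrite ltr_nat.
have e : Num.truncn (t x i) = Num.truncn (t y i).
  by rewrite -!cE// cx cy.
have /andP[x1 _] := t0 x i Fx; have /andP[y1 _] := t0 y i Fy.
have /andP[] := truncn_itv x1; have /andP[] := truncn_itv y1.
rewrite e -natr1 => h1 h2 h3 h4.
rewrite -[leRHS]mul1r ler_pdivlMr// -[X in _ * X](ger0_norm (ltW M0)) -normrM.
have -> : (x ord0 i - y ord0 i) * M%:R = t x i - t y i.
  by rewrite /t -mulrBl; congr (_ * _); lra.
by rewrite ler_norml; lra.
Qed.

Lemma chiP (R : realType) (n : nat) (b : R) : 0 < b ->
  partitionable n b (chi n b) /\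
  forall j, partitionable n b j -> (chi n b <= j)%N.
Proof.
move=> b0; have [k0 hk0] := partitionable_ex n b0.
have exP : exists k, `[< partitionable n b k >] by exists k0; apply/asboolP.
have [k /asboolP hk kmin] := ex_minnP exP.
rewrite /chi; case: xgetP => [m _ //|/(_ k)[]]; split => // j hj.
by apply: kmin; apply/asboolP.
Qed.

(* Main.v *)
From HB Require Import structures.
From mathcomp Require Import all_boot all_order all_algebra.
From mathcomp Require Import ring lra.
From mathcomp Require Import all_classical all_reals all_analysis.
(* Imported last because MathComp-Analysis also has an [edist]. *)
Require Import Defs.

Set Implicit Arguments.
Unset Strict Implicit.
Unset Printing Implicit Defensive.

Import Order.TTheory GRing.Theory Num.Theory.
Import numFieldNormedType.Exports.

Local Open Scope classical_set_scope.
Local Open Scope ring_scope.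

(** By a greedy argument it is enough to find, for every finite set [S] of
diameter at most 1 in dimension [n], a ball of radius [r = b/2] that contains
the fraction [(r/s)^n] of [S], where [s^2] is slightly above [1/4 + r^2/2].
Assume that there is none. Tilt the uniform measure on [S] by [exp (n <v, x>)],
where [v] is the position at time [t] of a random walk with infinitesimal steps;
let [L] be the mean free energy, and let [m_v] and [V] be the mean and the mean
variance of the tilted measure.  Gaussian integration by parts gives [L' = V/2]
and [E <v, m_v> = t V], hence the mean relative entropy, divided by [n], is
[t V - L]. As [S] has few points in each small ball, the entropy cannot be small
when the variance is, which is a differential inequality for [L]; the uniform
measure on the sphere of radius [s] is its equality case, so Gronwall's lemma
bounds [L] and [V] from below by the values for that sphere. On the other hand,
comparing the tilts by [v] and [-v], the diameter bound yields
[4 t V^2 + 2 V <= 1], which is violated at the time where [V] equals [r^2] for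
the sphere. *)

(** The main obstacle: the assumption on balls is silent below the scale [r], so the Gaussian weight
    in the entropy inequality must be truncated at [r], and the inequality is useful only while the
    tilted measure has little mass within [r] of its mean. That mass is controlled by a Renyi
    divergence of order [1 + d], which concentrates because the free energy has bounded gradient.
    Its mean involves the energy of the tilt by [(1 + d) v], at time [(1 + d)^2 t], and the diameter
    bound keeps this energy subcritical as long as [L] does not fall much below its value for the
    sphere. This bootstrap therefore runs inside the Gronwall induction. The constant [1/4 + r^2/2]:
    when [V = r^2] on the sphere, [t r^4 = s^2 - r^2], hence [4 t V^2 + 2 V = 4 s^2 - 2 r^2], which
    exceeds 1 exactly when [s^2 > 1/4 + r^2/2]. A discrete walk keeps every mean a finite sum. Its
    step [h] may depend on [n]; errors are of third order in [h] per step, against about [h^-2]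
    steps. *)

(** * Exponential moments of small random variables on a finite probability space *)

Section FiniteExpectation.
Variable R : realType.

Lemma ln_le_subr1 (x : R) : 0 < x -> ln x <= x - 1.
Proof.
move=> x0; have xE : x = 1 + (x - 1) by ring.
by rewrite {1}xE; apply: le_ln1Dx; lra.
Qed.

Lemma ln_ge_1subV (x : R) : 0 < x -> 1 - x^-1 <= ln x.
Proof.
move=> x0; have : 0 < x^-1 by rewrite invr_gt0.
by move/ln_le_subr1; rewrite lnV ?posrE//; lra.
Qed.

Lemma expR_taylor1 (x : R) : `|x| <= 1 / 2 -> expR x <= 1 + x + 2 * x ^+ 2.
Proof.
rewrite ler_norml => /andP[h1 h2].
have x1 : 0 < 1 - x by lra.
have : expR x <= (1 - x)^-1.
  have := expR_ge1Dx (- x); rewrite expRN => h.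
  by rewrite -[expR x]invrK lef_pV2 ?posrE ?invr_gt0 ?expR_gt0.
move=> /le_trans; apply; rewrite -[leLHS]mul1r ler_pdivrMr//.
by rewrite expr2; nra.
Qed.

Lemma expR_taylor2 (x : R) : `|x| <= 1 / 2 ->
  `|expR x - (1 + x + x ^+ 2 / 2)| <= 2 * `|x| ^+ 3.
Proof.
move=> xh.
pose f (y : R) := expR y - (1 + y + y ^+ 2 / 2).
pose df (y : R) := expR y - (1 + y).
have fd (y : R) : is_derive y 1 f (df y).
  rewrite /f /df; apply: is_derive_eq.
  by rewrite /GRing.scale /=; field.
have fc (y z : R) : {within `[y, z], continuous f}.
  by apply: continuous_subspaceT => u; apply/differentiable_continuous/derivable1_diffP; case: (fd u).
have f0 : f 0 = 0 by rewrite /f expR0; ring.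
have key c : `|c| <= `|x| -> `|df c| <= 2 * `|x| ^+ 2.
  move=> cx; have ch := le_trans cx xh.
  rewrite /df ger0_norm; last by rewrite subr_ge0 expR_ge1Dx.
  have := expR_taylor1 ch; rewrite -[c ^+ 2]real_normK ?num_real//.
  have := normr_ge0 c; have : `|c| ^+ 2 <= `|x| ^+ 2 by rewrite lerXn2r ?nnegrE.
  lra.
rewrite -/(f x); have [x0|x0] := leP 0 x.
  have [c cx] := MVT_segment x0 (fun y _ => fd y) (fc _ _).
  rewrite /= in_itv /= in cx.
  rewrite f0 !subr0 => ->; rewrite normrM exprSr mulrA ler_wpM2r//.
  by apply: key; rewrite !ger0_norm; lra.
have [c cx] := MVT_segment (ltW x0) (fun y _ => fd y) (fc _ _).
rewrite /= in_itv /= in cx.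
rewrite f0 !sub0r => /eqP; rewrite eqr_oppLR => /eqP ->.
rewrite normrN normrM normrN exprSr mulrA ler_wpM2r//.
by apply: key; rewrite !ler0_norm; lra.
Qed.

Variables (I : finType) (p : I -> R).
Hypothesis p_ge0 : forall i, 0 <= p i.
Hypothesis p_sum : \sum_i p i = 1.

Lemma mean_le (f g : I -> R) : (forall i, f i <= g i) ->
  \sum_i p i * f i <= \sum_i p i * g i.
Proof. by move=> fg; apply: ler_sum => i _; rewrite ler_wpM2l. Qed.

Lemma mean_cst (c : R) : \sum_i p i * c = c.
Proof. by rewrite -mulr_suml p_sum mul1r. Qed.

Lemma mean_norm_le (f : I -> R) (c : R) : (forall i, `|f i| <= c) ->
  `|\sum_i p i * f i| <= c.
Proof.
move=> fc; apply: (le_trans (ler_norm_sum _ _ _)).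
rewrite -[leRHS]mean_cst; apply: ler_sum => i _.
by rewrite normrM (ger0_norm (p_ge0 i)) ler_wpM2l.
Qed.

(** Averaging the tangent line of the exponential at the mean [A], whose linear term has mean
    zero. *)
Lemma jensen_expR (a : I -> R) :
  expR (\sum_i p i * a i) <= \sum_i p i * expR (a i).
Proof.
set A := \sum_i _.
have -> : expR A = \sum_i p i * (expR A * (1 + (a i - A))).
  under eq_bigr do rewrite mulrCA.
  rewrite -mulr_sumr; under eq_bigr do rewrite mulrDr mulr1 mulrBr.
  by rewrite big_split/= sumrB p_sum mean_cst subrr addr0 mulr1.
apply: mean_le => i.
have -> : expR (a i) = expR A * expR (a i - A) by rewrite -expRD addrC subrK.
by rewrite ler_wpM2l ?expR_ge0// expR_ge1Dx.
Qed.

Lemma mean_expR_gt0 (a : I -> R) : 0 < \sum_i p i * expR (a i).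
Proof. exact: lt_le_trans (expR_gt0 _) (jensen_expR a). Qed.

Lemma mean_le_ln_mgf (a : I -> R) :
  \sum_i p i * a i <= ln (\sum_i p i * expR (a i)).
Proof.
by rewrite -[leLHS]expRK ler_ln ?posrE ?expR_gt0 ?mean_expR_gt0// jensen_expR.
Qed.

Variables (a : I -> R) (th : R).
Hypothesis a_le : forall i, `|a i| <= th.
Hypothesis th_le : th <= 1 / 4.

Let th0 : 0 <= th.
Proof.
have : (0 < #|I|)%N.
  apply/card_gt0P; apply/existsP; apply: contraT; rewrite negb_exists => /forallP h.
  have := p_sum; rewrite big1 => [/eqP|i _]; first by rewrite eq_sym oner_eq0.
  by have := h i.
by move=> /card_gt0P[i _]; exact: le_trans (normr_ge0 _) (a_le i).
Qed.

Let A1 := \sum_i p i * a i.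
Let A2 := \sum_i p i * a i ^+ 2.

Let A1_le : `|A1| <= th. Proof. exact: mean_norm_le. Qed.

Let a2_le i : a i ^+ 2 <= th ^+ 2.
Proof. by rewrite -real_normK ?num_real// lerXn2r ?nnegrE. Qed.

Let A2_le : 0 <= A2 <= th ^+ 2.
Proof.
rewrite sumr_ge0 ?andTb; last by move=> i _; rewrite mulr_ge0// sqr_ge0.
by rewrite -[leRHS]mean_cst; exact: mean_le.
Qed.

Let Var_ge0 : A1 ^+ 2 <= A2.
Proof.
have : 0 <= \sum_i p i * (a i - A1) ^+ 2.
  by apply: sumr_ge0 => i _; rewrite mulr_ge0// sqr_ge0.
under eq_bigr do rewrite sqrrB !mulrDr.
rewrite !big_split/= mean_cst -/A2.
under eq_bigr do rewrite mulrN mulrnAr mulrA.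
by rewrite sumrN sumrMnl -mulr_suml -/A1; rewrite mulr2n; lra.
Qed.

Lemma ln_mgf_le : ln (\sum_i p i * expR (a i)) <= A1 + 2 * th ^+ 2.
Proof.
have : \sum_i p i * expR (a i) <= 1 + (A1 + 2 * th ^+ 2).
  have -> : 1 + (A1 + 2 * th ^+ 2) = \sum_i p i * (1 + a i + 2 * th ^+ 2).
    under eq_bigr do rewrite !mulrDr mulr1.
    by rewrite !big_split/= mean_cst p_sum -/A1 addrA.
  apply: mean_le => i; apply: le_trans (expR_taylor1 _) _.
    by apply: le_trans (a_le i) _; have := th_le; lra.
  by rewrite lerD2l ler_pM2l//; exact: a2_le.
move=> h; apply: le_trans (le_ln1Dx _).
  by rewrite ler_ln ?posrE ?mean_expR_gt0//; exact: lt_le_trans (mean_expR_gt0 a) h.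
have := A1_le; rewrite ler_norml => /andP[h1 _].
by have := sqr_ge0 th; have := th_le; lra.
Qed.

Let mgf_ge (c : R) : c = 1 \/ c = -1 ->
  1 + c * A1 + A2 / 2 - 2 * th ^+ 3 <= \sum_i p i * expR (c * a i).
Proof.
move=> c1; have c2 : c ^+ 2 = 1 by case: c1 => ->; rewrite ?sqrrN expr1n.
have nc : `|c| = 1 by case: c1 => ->; rewrite ?normrN normr1.
have -> : 1 + c * A1 + A2 / 2 - 2 * th ^+ 3 =
    \sum_i p i * (1 + c * a i + a i ^+ 2 / 2 - 2 * th ^+ 3).
  under eq_bigr do rewrite mulrBr !mulrDr mulr1 mulrCA mulrA.
  rewrite big_split/= sumrN mean_cst; congr (_ - _).
  rewrite !big_split/= p_sum; congr (_ + _ + _).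
    by rewrite /A1 mulr_sumr; apply: eq_bigr => i _; ring.
  by rewrite /A2 mulr_suml; apply: eq_bigr => i _; ring.
apply: mean_le => i.
have cai : `|c * a i| <= th by rewrite normrM nc mul1r.
have ch : `|c * a i| <= 1 / 2 by apply: le_trans cai _; have := th_le; lra.
have := expR_taylor2 ch; rewrite exprMn c2 mul1r.
have : `|c * a i| ^+ 3 <= th ^+ 3 by rewrite lerXn2r ?nnegrE.
by move=> h3; rewrite ler_norml => /andP[h1 _]; lra.
Qed.

(** Up to third order each logarithm is plus or minus the mean plus half the variance; the odd terms
    cancel in the sum. With [a] an increment of the tilt this is the one-axis form of [L' = V/2]. *)
Lemma ln_mgf_sym_ge : A2 - A1 ^+ 2 - 5 * th ^+ 3 <=
  ln (\sum_i p i * expR (a i)) + ln (\sum_i p i * expR (- a i)).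
Proof.
have g1 : 1 + A1 + A2 / 2 - 2 * th ^+ 3 <= \sum_i p i * expR (a i).
  have := mgf_ge (or_introl erefl); rewrite mul1r.
  by under eq_bigr do rewrite mul1r.
have g2 : 1 - A1 + A2 / 2 - 2 * th ^+ 3 <= \sum_i p i * expR (- a i).
  have := mgf_ge (or_intror erefl); rewrite mulN1r.
  by under eq_bigr do rewrite mulN1r.
rewrite -lnM ?posrE ?mean_expR_gt0//.
have th3 : 0 <= th ^+ 3 <= th ^+ 2 / 4.
  by rewrite exprn_ge0//= exprSr ler_wpM2l ?sqr_ge0//; have := th_le; lra.
have th2 : 0 <= th ^+ 2 <= 1 / 16.
  by rewrite sqr_ge0 expr2/=; have := th_le; have := th0; nra.
have := A1_le; rewrite ler_norml => /andP[a1 a1'].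
have [a2 a2'] := andP A2_le; have v0 := Var_ge0.
have [t3 t3'] := andP th3; have [t2 t2'] := andP th2.
set w := A2 - A1 ^+ 2 - 4 * th ^+ 3.
have sA1 := sqr_ge0 A1.
have w1 : -1 < w by rewrite /w; lra.
have wprod : 1 + w <=
    (\sum_i p i * expR (a i)) * (\sum_i p i * expR (- a i)).
  have thl := th_le.
  apply: (@le_trans _ _ ((1 + A1 + A2 / 2 - 2 * th ^+ 3) * (1 - A1 + A2 / 2 - 2 * th ^+ 3))).
    rewrite /w; have := sqr_ge0 (A2 / 2 - 2 * th ^+ 3).
    rewrite !expr2; nra.
  by apply: ler_pM => //; lra.
apply: (@le_trans _ _ (ln (1 + w))); last first.
  rewrite ler_ln ?posrE//; first by lra.
  by apply: lt_le_trans wprod; lra.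
have lnw : w / (1 + w) <= ln (1 + w).
  have w2 : 0 < 1 + w by lra.
  have -> : w / (1 + w) = 1 - (1 + w)^-1 by field; lra.
  exact: ln_ge_1subV.
apply: le_trans lnw.
have wle : - (th ^+ 2) <= w <= th ^+ 2 by rewrite /w; apply/andP; split; lra.
have w2 : w ^+ 2 <= th ^+ 2 * th ^+ 2.
  by rewrite expr2; have [q1 q2] := andP wle; nra.
have w4 : th ^+ 2 * th ^+ 2 <= th ^+ 3 / 4.
  rewrite -exprD (exprSr _ 3) ler_wpM2l//; have := th_le; lra.
rewrite ler_pdivlMr; last lra.
have -> : A2 - A1 ^+ 2 - 5 * th ^+ 3 = w - th ^+ 3 by rewrite /w; ring.
rewrite expr2 in w2; have [q1 q2] := andP wle; nra.
Qed.

(** The derivative of a tilted mean along the tilt is the variance. *)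
Lemma tilted_mean_near :
  `|(\sum_i p i * (a i * expR (a i))) / (\sum_i p i * expR (a i))
     - (A1 + (A2 - A1 ^+ 2))| <= 12 * th ^+ 3.
Proof.
set S := \sum_i p i * expR (a i).
pose rho i := expR (a i) - 1 - a i.
have ah i : `|a i| <= 1 / 2 by apply: le_trans (a_le i) _; have := th_le; lra.
have rho_le i : `|rho i| <= 2 * th ^+ 2.
  rewrite /rho ger0_norm; last by have := expR_ge1Dx (a i); lra.
  have := expR_taylor1 (ah i); have := a2_le i; lra.
pose e1 := \sum_i p i * (a i * rho i).
pose e2 := \sum_i p i * rho i.
have e1_le : `|e1| <= 2 * th ^+ 3.
  apply: mean_norm_le => i; rewrite normrM exprS mulrCA.
  by apply: ler_pM.
have e2_le : `|e2| <= 2 * th ^+ 2 by apply: mean_norm_le.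
have NE : \sum_i p i * (a i * expR (a i)) = A1 + A2 + e1.
  rewrite /A1 /A2 /e1 -!big_split/=; apply: eq_bigr => i _; rewrite /rho; ring.
have SE : S = 1 + A1 + e2.
  rewrite /S /A1 /e2 -{1}p_sum -!big_split/=; apply: eq_bigr => i _; rewrite /rho; ring.
have := A1_le; rewrite ler_norml => /andP[a1 a1'].
have := e2_le; rewrite ler_norml => /andP[b1 b1'].
have := e1_le; rewrite ler_norml => /andP[c1 c1'].
have t2 : th ^+ 2 <= 1 / 16 by rewrite expr2; have := th_le; have := th0; nra.
have Sh : 1 / 2 <= S by rewrite SE; have := th_le; lra.
rewrite NE; set v := A2 - A1 ^+ 2.
have vle : 0 <= v <= th ^+ 2.
  by have := Var_ge0; have := A2_le; have := sqr_ge0 A1; rewrite /v => ? ? ?; apply/andP; lra.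
have -> : (A1 + A2 + e1) / S - (A1 + v) = (e1 - v * A1 - (A1 + v) * e2) / S.
  rewrite SE; rewrite SE in Sh; rewrite /v; field; lra.
rewrite normrM normfV [`|S|]ger0_norm; last lra.
rewrite ler_pdivrMr; last lra.
have [v0 v1] := andP vle.
have n1 : `|v * A1| <= th ^+ 3.
  by rewrite normrM (ger0_norm v0) exprSr; apply: ler_pM.
have n2 : `|(A1 + v) * e2| <= 5 / 2 * th ^+ 3.
  rewrite normrM; apply: (@le_trans _ _ (5 / 4 * th * (2 * th ^+ 2))); last first.
    by rewrite (exprS _ 2); have := exprn_ge0 2 th0; have := th0; lra.
  apply: ler_pM => //; apply: le_trans (ler_normD _ _) _.
  rewrite (ger0_norm v0); have := A1_le.
  have : th ^+ 2 <= th / 4 by rewrite expr2; have := th_le; have := th0; nra.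
  lra.
apply: (@le_trans _ _ (11 / 2 * th ^+ 3)).
  apply: le_trans (ler_normB _ _) _.
  apply: le_trans (lerD (ler_normB _ _) (lexx _)) _; lra.
have t30 : 0 <= th ^+ 3 by rewrite exprn_ge0.
nra.
Qed.

End FiniteExpectation.

(** * The Euclidean inner product on row vectors *)

Section DotProduct.
Variables (R : realType) (n : nat).
Implicit Types u v w : 'rV[R]_n.

Definition dot u v : R := \sum_(i < n) u ord0 i * v ord0 i.

Lemma dotC u v : dot u v = dot v u.
Proof. by apply: eq_bigr => i _; rewrite mulrC. Qed.

Lemma dotDl u v w : dot (u + v) w = dot u w + dot v w.
Proof. by rewrite -big_split; apply: eq_bigr => i _; rewrite mxE mulrDl. Qed.

Lemma dotNl u v : dot (- u) v = - dot u v.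
Proof. by rewrite -sumrN; apply: eq_bigr => i _; rewrite mxE mulNr. Qed.

Lemma dotZl c u v : dot (c *: u) v = c * dot u v.
Proof. by rewrite mulr_sumr; apply: eq_bigr => i _; rewrite mxE mulrA. Qed.

Lemma dotBl u v w : dot (u - v) w = dot u w - dot v w.
Proof. by rewrite dotDl dotNl. Qed.

Lemma dotDr u v w : dot u (v + w) = dot u v + dot u w.
Proof. by rewrite dotC dotDl !(dotC u). Qed.

Lemma dotNr u v : dot u (- v) = - dot u v.
Proof. by rewrite dotC dotNl dotC. Qed.

Lemma dotBr u v w : dot u (v - w) = dot u v - dot u w.
Proof. by rewrite dotDr dotNr. Qed.

Lemma dotZr c u v : dot u (c *: v) = c * dot u v.
Proof. by rewrite dotC dotZl dotC. Qed.

Lemma dot0l v : dot 0 v = 0.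
Proof. by apply: big1 => i _; rewrite mxE mul0r. Qed.

Lemma dot_sumr (I : finType) u (F : I -> 'rV[R]_n) :
  dot u (\sum_i F i) = \sum_i dot u (F i).
Proof.
rewrite /dot exchange_big/=; apply: eq_bigr => j _.
by rewrite summxE mulr_sumr.
Qed.

Definition ebase (i : 'I_n) : 'rV[R]_n := delta_mx ord0 i.

Lemma dot_ebase i u : dot (ebase i) u = u ord0 i.
Proof.
rewrite /dot (bigD1 i)//= !mxE !eqxx mul1r big1 ?addr0// => j ji.
by rewrite !mxE (negPf ji) mul0r.
Qed.

Definition nsq u : R := dot u u.

Lemma nsq_ge0 u : 0 <= nsq u.
Proof. by apply: sumr_ge0 => i _; rewrite -expr2 sqr_ge0. Qed.

Lemma nsqE u : nsq u = \sum_(i < n) u ord0 i ^+ 2.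
Proof. by []. Qed.

Lemma nsqD u v : nsq (u + v) = nsq u + 2 * dot u v + nsq v.
Proof. by rewrite /nsq !dotDl !dotDr (dotC v u); ring. Qed.

Lemma nsqB u v : nsq (u - v) = nsq u - 2 * dot u v + nsq v.
Proof. by rewrite /nsq !dotBl !dotBr (dotC v u); ring. Qed.

Lemma nsqN u : nsq (- u) = nsq u.
Proof. by rewrite /nsq dotNl dotNr opprK. Qed.

Lemma nsq_distC u v : nsq (u - v) = nsq (v - u).
Proof. by rewrite -nsqN opprB. Qed.

Lemma nsq_ebase i : nsq (ebase i) = 1.
Proof. by rewrite /nsq dot_ebase mxE !eqxx. Qed.

Lemma nsqZ c u : nsq (c *: u) = c ^+ 2 * nsq u.
Proof. by rewrite /nsq dotZl dotZr; ring. Qed.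

Lemma coord_sq_le_nsq u i : u ord0 i ^+ 2 <= nsq u.
Proof.
rewrite nsqE (bigD1 i)//= lerDl; apply: sumr_ge0 => j _; exact: sqr_ge0.
Qed.

Lemma dot_young (c : R) u v : 0 < c -> 2 * dot u v <= c * nsq u + nsq v / c.
Proof.
move=> c0; have := nsq_ge0 (c *: u - v); rewrite nsqB nsqZ dotZl => h.
have -> : 2 * dot u v = 2 * (c * dot u v) / c by field; lra.
have -> : c * nsq u + nsq v / c = (c ^+ 2 * nsq u + nsq v) / c by field; lra.
by rewrite ler_pM2r ?invr_gt0//; lra.
Qed.

End DotProduct.
Arguments ebase {R n}.

(** * The simple random walk: linearity, integration by parts and a variance bound *)

Section Walk.
Variables (R : realType) (n : nat).
Hypothesis n_gt0 : (0 < n)%N.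
Implicit Types (f g : 'rV[R]_n -> R) (v w : 'rV[R]_n) (h : R).

(* One step of the simple random walk of step length [h]; [iter k (walk h) f v]
   is the mean of [f] after [k] steps from [v]. *)
Definition walk h f v : R :=
  (\sum_(i < n) (f (v + h *: ebase i) + f (v - h *: ebase i))) / (2 * n%:R).

Let n2_gt0 : 0 < 2 * n%:R :> R.
Proof. by rewrite mulr_gt0// ltr0n. Qed.

Lemma walk_le h f g v : (forall w, f w <= g w) -> walk h f v <= walk h g v.
Proof.
move=> fg; rewrite /walk ler_pM2r ?invr_gt0//.
by apply: ler_sum => i _; exact: lerD.
Qed.

Lemma walk_cst h c v : walk h (fun=> c) v = c.
Proof.
rewrite /walk sumr_const card_ord -mulr_natr; field.
by rewrite pnatr_eq0 -lt0n.
Qed.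

Lemma walk_lin h a b f g v :
  walk h (fun w => a * f w + b * g w) v = a * walk h f v + b * walk h g v.
Proof.
rewrite /walk !mulrA -mulrDl !mulr_sumr -big_split/=; congr (_ / _).
by apply: eq_bigr => i _; ring.
Qed.

Lemma walk_translate h f u v :
  walk h f (v + u) = walk h (fun w => f (w + u)) v.
Proof.
rewrite /walk; congr (_ / _); apply: eq_bigr => i _.
by rewrite !(addrAC v u).
Qed.

Notation W h k := (iter k (walk h)).

Lemma iter_walk_le h k f g v :
  (forall w, f w <= g w) -> W h k f v <= W h k g v.
Proof. by move=> fg; elim: k v => //= k IH v; apply: walk_le. Qed.

Lemma iter_walk_cst h k c v : W h k (fun=> c) v = c.
Proof.
elim: k v => //= k IH v; rewrite -[RHS](walk_cst h c v).
by congr (walk _ _ _); apply/funext => w; rewrite IH.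
Qed.

Lemma iter_walk_lin h k a b f g v :
  W h k (fun w => a * f w + b * g w) v = a * W h k f v + b * W h k g v.
Proof.
elim: k v => //= k IH v; rewrite -walk_lin.
by congr (walk _ _ _); apply/funext => w; rewrite IH.
Qed.

Lemma iter_walkD h k f g v :
  W h k (fun w => f w + g w) v = W h k f v + W h k g v.
Proof.
rewrite -[X in X + _]mul1r -[X in _ + X]mul1r -iter_walk_lin.
by congr (iter _ _ _ _); apply/funext => w; rewrite !mul1r.
Qed.

Lemma iter_walkB h k f g v :
  W h k (fun w => f w - g w) v = W h k f v - W h k g v.
Proof.
rewrite -[X in X - _]mul1r -[X in _ - X]mul1r -mulNr -iter_walk_lin.
by congr (iter _ _ _ _); apply/funext => w; rewrite mul1r mulN1r.
Qed.

Lemma iter_walkZ h k a f v : W h k (fun w => a * f w) v = a * W h k f v.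
Proof.
rewrite -[RHS]addr0 -[X in _ + X](mul0r (W h k f v)) -iter_walk_lin.
by congr (iter _ _ _ _); apply/funext => w; rewrite mul0r addr0.
Qed.

Lemma iter_walk_sum h k (I : finType) (F : I -> 'rV[R]_n -> R) v :
  W h k (fun w => \sum_i F i w) v = \sum_i W h k (F i) v.
Proof.
elim: (index_enum I) => [|i s IH].
  rewrite big_nil -[RHS](iter_walk_cst h k 0 v).
  by congr (iter _ _ _ _); apply/funext => w; rewrite big_nil.
rewrite big_cons -IH -iter_walkD.
by congr (iter _ _ _ _); apply/funext => w; rewrite big_cons.
Qed.

Lemma iter_walk_translate h k f u v :
  W h k f (v + u) = W h k (fun w => f (w + u)) v.
Proof.
elim: k v => //= k IH v; rewrite walk_translate.
by congr (walk _ _ _); apply/funext => w; rewrite IH.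
Qed.

Lemma iter_walk_norm_le h k f (c : R) v : (forall w, `|f w| <= c) -> `|W h k f v| <= c.
Proof.
move=> fc; have fc' w := andP (etrans (esym (ler_norml _ _)) (fc w)).
rewrite ler_norml -{1}(iter_walk_cst h k (- c) v) -{2}(iter_walk_cst h k c v).
by apply/andP; split; apply: iter_walk_le => w; case: (fc' w).
Qed.

Lemma iter_walk_opp h k f v : W h k (fun w => f (- w)) v = W h k f (- v).
Proof.
elim: k v => //= k IH v; rewrite /walk; congr (_ / _); apply: eq_bigr => i _.
by rewrite !IH !opprD opprK addrC.
Qed.

(** Tilting by a multiple of the walk amounts to walking with longer steps, that is up to the time
    [c^2 t]. *)
Lemma iter_walk_scale h k c f v :
  W h k (fun w => f (c *: w)) v = W (c * h) k f (c *: v).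
Proof.
elim: k v => //= k IH v; rewrite /walk; congr (_ / _); apply: eq_bigr => i _.
by rewrite !IH scalerDr scalerBr !scalerA.
Qed.

(** This is why [k * h^2] plays the role of time. *)
Lemma iter_walk_nsq h k v : W h k (@nsq R n) v = nsq v + k%:R * h ^+ 2.
Proof.
have n0 : n%:R != 0 :> R by rewrite pnatr_eq0 -lt0n.
elim: k v => [|k IH] v /=; first by rewrite mul0r addr0.
rewrite /walk; under eq_bigr => i _ do rewrite !IH nsqD nsqB nsqZ nsq_ebase.
rewrite (eq_bigr (fun=> 2 * (nsq v + k.+1%:R * h ^+ 2))); last first.
  by move=> i _; rewrite -natr1; ring.
by rewrite sumr_const card_ord -mulr_natr; field.
Qed.

(* [h^2 / n] times the symmetric difference quotient along the i-th axis. *)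
Definition sdiff h (i : 'I_n) f v : R :=
  h / (2 * n%:R) * (f (v + h *: ebase i) - f (v - h *: ebase i)).

Lemma walk_coord h i f v :
  walk h (fun w => w ord0 i * f w) v = v ord0 i * walk h f v + sdiff h i f v.
Proof.
rewrite /walk mulrA mulr_sumr /sdiff mulrAC -mulrDl; congr (_ / _).
rewrite (bigD1 i)//= [in RHS](bigD1 i)//= !mxE !eqxx /= mulr1.
set A := f _; set B := f _.
rewrite (_ : \sum_(j < n | j != i) _ =
  \sum_(j < n | j != i) v ord0 i * (f (v + h *: ebase j) + f (v - h *: ebase j))).
  by ring.
apply: eq_bigr => j ji; rewrite !mxE eqxx/= (eq_sym i) (negPf ji) mulr0.
by rewrite subr0 addr0 mulrDr.
Qed.

Lemma iter_walk_sdiff h k i f v :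
  W h k (sdiff h i f) v = sdiff h i (W h k f) v.
Proof.
rewrite iter_walkZ iter_walkB -!iter_walk_translate.
by congr (_ * (_ - _)); rewrite -iter_walk_translate.
Qed.

(** An exact integration by parts: the [k + 1] steps are exchangeable, and each contributes the same
    symmetric difference, averaged over the other [k]. *)
Lemma iter_walk_coord h k i f v :
  W h k.+1 (fun w => w ord0 i * f w) v =
  v ord0 i * W h k.+1 f v + k.+1%:R * W h k (sdiff h i f) v.
Proof.
elim: k v => [|k IH] v; first by rewrite /= walk_coord mul1r.
rewrite iterS (_ : W h k.+1 _ = fun w => w ord0 i * W h k.+1 f w + k.+1%:R * W h k (sdiff h i f) w); last first.
  by apply/funext => w; rewrite IH.
have := walk_lin h 1 k.+1%:R (fun w => w ord0 i * W h k.+1 f w) (W h k (sdiff h i f)) v.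
under eq_fun do rewrite mul1r.
move=> ->; rewrite mul1r walk_coord -iter_walk_sdiff.
by rewrite /= -[k.+2%:R]natr1; ring.
Qed.

Lemma walk_sqr_le h f v : walk h f v ^+ 2 <= walk h (fun w => f w ^+ 2) v.
Proof.
set a := walk h f v.
have : walk h (fun=> 0) v <= walk h (fun w => (f w - a) ^+ 2) v.
  by apply: walk_le => w; exact: sqr_ge0.
rewrite walk_cst.
have -> : (fun w => (f w - a) ^+ 2) =
  (fun w => 1 * (1 * f w ^+ 2 + (- 2 * a) * f w) + a ^+ 2 * 1).
  by apply/funext => w; ring.
by rewrite (walk_lin h 1 _ _ (fun=> 1)) walk_lin walk_cst -/a; lra.
Qed.

Lemma walk_variance_le h f v (a : R) :
  walk h (fun w => f w ^+ 2) v - walk h f v ^+ 2 <= walk h (fun w => (f w - a) ^+ 2) v.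
Proof.
have -> : (fun w => (f w - a) ^+ 2) =
  (fun w => 1 * (1 * f w ^+ 2 + (- 2 * a) * f w) + a ^+ 2 * 1).
  by apply/funext => w; ring.
rewrite (walk_lin h 1 _ _ (fun=> 1)) walk_lin walk_cst.
have := sqr_ge0 (walk h f v - a); rewrite sqrrB mulr2n; lra.
Qed.

(** A discrete Poincare inequality, with [G] an approximate gradient of [f]. The variance splits
    into the mean variance of one step and the variance of [walk h f] after the others; averaging
    preserves the assumptions on [f] and [G], so the induction passes to [walk h f]. *)
Lemma iter_walk_variance_le h k (G : 'I_n -> 'rV[R]_n -> R) f (c C : R) v :
  (forall w j, `|f (w + h *: ebase j) - f w - h * G j w| <= c) ->
  (forall w j, `|f (w - h *: ebase j) - f w + h * G j w| <= c) ->
  (forall w, \sum_j G j w ^+ 2 <= C) ->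
  W h k (fun w => f w ^+ 2) v - W h k f v ^+ 2 <=
    k%:R * (2 * h ^+ 2 * C / n%:R + 2 * c ^+ 2).
Proof.
set s := _ + 2 * c ^+ 2.
have n0 : 0 < n%:R :> R by rewrite ltr0n.
elim: k f G v => [|k IH] f G v fG fG' GC; first by rewrite /= subrr mul0r.
have step w : walk h (fun w => f w ^+ 2) w <= walk h f w ^+ 2 + s.
  have := walk_variance_le h f w (f w).
  suff : walk h (fun u => (f u - f w) ^+ 2) w <= s by lra.
  have sq (x y : R) : `|x - y| <= c -> x ^+ 2 <= 2 * y ^+ 2 + 2 * c ^+ 2.
    move=> xy; have : (x - y) ^+ 2 <= c ^+ 2.
      by rewrite -real_normK ?num_real// lerXn2r ?nnegrE// (le_trans _ xy).
    by have := sqr_ge0 (x - y - y); rewrite !expr2; nra.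
  rewrite /walk ler_pdivrMr//.
  apply: (@le_trans _ _ (\sum_(j < n) (4 * h ^+ 2 * G j w ^+ 2 + 4 * c ^+ 2))).
    apply: ler_sum => j _.
    have := sq _ _ (fG w j); have := fG' w j.
    rewrite -[h * G j w]opprK => /sq; rewrite sqrrN exprMn; lra.
  rewrite big_split/= -mulr_sumr sumr_const card_ord -[4 * c ^+ 2 *+ n]mulr_natr /s.
  have -> : (2 * h ^+ 2 * C / n%:R + 2 * c ^+ 2) * (2 * n%:R) =
    4 * h ^+ 2 * C + 4 * c ^+ 2 * n%:R by field; rewrite gt_eqF.
  by rewrite lerD2r; apply: ler_wpM2l (GC w); rewrite mulr_ge0 ?sqr_ge0.
rewrite !iterSr.
have : W h k (walk h (fun w => f w ^+ 2)) v <= W h k (fun w => walk h f w ^+ 2) v + s.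
  by rewrite -[X in _ + X](iter_walk_cst h k s v) -iter_walkD; exact: iter_walk_le.
suff : W h k (fun w => walk h f w ^+ 2) v - W h k (walk h f) v ^+ 2 <= k%:R * s.
  by rewrite -natr1; lra.
(* The bound on the sum of squares survives the averaging of [G] because the square is convex. *)
apply: (IH _ (fun j => walk h (G j))).
- move=> w j; rewrite walk_translate.
  have := @iter_walk_norm_le h 1 (fun u => f (u + h *: ebase j) - f u - h * G j u) c w (fun u => fG u j).
  by rewrite (iter_walkB h 1) (iter_walkB h 1) (iter_walkZ h 1).
- move=> w j; rewrite walk_translate.
  have := @iter_walk_norm_le h 1 (fun u => f (u - h *: ebase j) - f u + h * G j u) c w (fun u => fG' u j).
  by rewrite (iter_walkD h 1) (iter_walkB h 1) (iter_walkZ h 1).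
- move=> w; apply: le_trans (ler_sum _ (fun j _ => walk_sqr_le h (G j) w)) _.
  rewrite -(iter_walk_sum h 1 (fun j u => G j u ^+ 2)).
  by rewrite -[leRHS](walk_cst h C w); exact: walk_le.
Qed.

End Walk.

(** * Exponential tilts of a finite family: free energy, mean and variance along the walk *)

Section Gibbs.
Variables (R : realType) (n : nat) (I : finType) (X : I -> 'rV[R]_n).
Hypothesis n_gt0 : (0 < n)%N.
Hypothesis I_gt0 : (0 < #|I|)%N.
Hypothesis X_le1 : forall i, nsq (X i) <= 1.
Hypothesis X_diam : forall i j, nsq (X i - X j) <= 1.
Implicit Types (u v w e : 'rV[R]_n) (h : R).

Let n0 : 0 < n%:R :> R. Proof. by rewrite ltr0n. Qed.

Definition partf v : R := \sum_i expR (n%:R * dot v (X i)).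
Definition gibbs v i : R := expR (n%:R * dot v (X i)) / partf v.
(** The log-Laplace transform of the uniform measure on the family, per dimension; the factor [n] in
    the exponent keeps all quantities of order one as [n] grows. *)
Definition flam v : R := (ln (partf v) - ln #|I|%:R) / n%:R.
Definition gmean v : 'rV[R]_n := \sum_i gibbs v i *: X i.
Definition gvar v : R := \sum_i gibbs v i * nsq (X i - gmean v).

Lemma partf_gt0 v : 0 < partf v.
Proof.
have [i _] := card_gt0P I_gt0.
rewrite /partf (bigD1 i)//= ltr_pwDl ?expR_gt0//.
by apply: sumr_ge0 => j _; exact: expR_ge0.
Qed.

Lemma gibbs_ge0 v i : 0 <= gibbs v i.
Proof. by rewrite divr_ge0 ?expR_ge0// ltW// partf_gt0. Qed.

Lemma gibbs_sum v : \sum_i gibbs v i = 1.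
Proof. by rewrite -mulr_suml mulfV// gt_eqF// partf_gt0. Qed.

Let Ele := fun v => mean_le (gibbs_ge0 v).
Let Ecst := fun v => mean_cst (gibbs_sum v).

Lemma dot_gmean u v : dot u (gmean v) = \sum_i gibbs v i * dot u (X i).
Proof. by rewrite dot_sumr; apply: eq_bigr => i _; rewrite dotZr. Qed.

Lemma gmean_coord v j : gmean v ord0 j = \sum_i gibbs v i * X i ord0 j.
Proof. by rewrite summxE; apply: eq_bigr => i _; rewrite mxE. Qed.

Definition gmgf v e : R := \sum_i gibbs v i * expR (n%:R * dot e (X i)).

Lemma gmgf_gt0 v e : 0 < gmgf v e.
Proof. exact: mean_expR_gt0 (gibbs_ge0 v) (gibbs_sum v) _. Qed.

Lemma partfD v e : partf (v + e) = partf v * gmgf v e.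
Proof.
rewrite /gmgf mulr_sumr; apply: eq_bigr => i _.
rewrite dotDl mulrDr expRD mulrA /gibbs mulrCA mulfV ?mulr1//.
by rewrite gt_eqF// partf_gt0.
Qed.

Lemma flamD v e : flam (v + e) = flam v + ln (gmgf v e) / n%:R.
Proof.
rewrite /flam partfD lnM ?posrE ?partf_gt0 ?gmgf_gt0//; field.
by rewrite gt_eqF.
Qed.

Lemma gibbsD v e i :
  gibbs (v + e) i = gibbs v i * expR (n%:R * dot e (X i)) / gmgf v e.
Proof.
rewrite /gibbs partfD dotDl mulrDr expRD; field.
by rewrite !gt_eqF ?partf_gt0 ?gmgf_gt0.
Qed.

Lemma flam0 : flam 0 = 0.
Proof.
rewrite /flam /partf; under eq_bigr do rewrite dot0l mulr0 expR0.
by rewrite sumr_const subrr mul0r.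
Qed.

Lemma flam_convex v e : flam v + dot e (gmean v) <= flam (v + e).
Proof.
rewrite flamD lerD2l ler_pdivlMr// dot_gmean mulrC mulr_sumr.
under eq_bigr do rewrite mulrCA.
exact: mean_le_ln_mgf (gibbs_ge0 v) (gibbs_sum v) _.
Qed.

Lemma flam_smooth v e (th : R) : (forall i, `|n%:R * dot e (X i)| <= th) ->
  th <= 1 / 4 -> flam (v + e) <= flam v + dot e (gmean v) + 2 * th ^+ 2 / n%:R.
Proof.
move=> eth th4; rewrite flamD -addrA lerD2l ler_pdivrMr// dot_gmean mulrDl.
rewrite divfK ?gt_eqF// mulr_suml.
under [in leRHS]eq_bigr do rewrite -mulrA (mulrC (dot _ _)).
by apply: (ln_mgf_le (gibbs_ge0 v) (gibbs_sum v) eth th4).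
Qed.

(** The parallel axis identity. *)
Lemma gibbs_nsq v u :
  \sum_i gibbs v i * nsq (X i - u) = gvar v + nsq (gmean v - u).
Proof.
have E w : \sum_i gibbs v i * nsq (X i - w) =
    \sum_i gibbs v i * nsq (X i) - 2 * dot w (gmean v) + nsq w.
  rewrite -[in RHS](Ecst v (nsq w)) dot_gmean mulr_sumr -sumrB -big_split/=.
  by apply: eq_bigr => i _; rewrite nsqB (dotC w); ring.
by rewrite /gvar !E nsqB (dotC u); rewrite /nsq; ring.
Qed.

Lemma gvar_ge0 v : 0 <= gvar v.
Proof. by apply: sumr_ge0 => i _; rewrite mulr_ge0 ?gibbs_ge0 ?nsq_ge0. Qed.

Lemma gvarD_nsq_gmean v : gvar v + nsq (gmean v) <= 1.
Proof.
have := gibbs_nsq v 0; rewrite subr0 => <-.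
rewrite -[leRHS](Ecst v); apply: Ele => i; by rewrite subr0.
Qed.

Lemma gvar_le1 v : gvar v <= 1.
Proof. by have := gvarD_nsq_gmean v; have := nsq_ge0 (gmean v); lra. Qed.

Lemma nsq_gmean_le1 v : nsq (gmean v) <= 1.
Proof. by have := gvarD_nsq_gmean v; have := gvar_ge0 v; lra. Qed.

(** The left side is the mean squared distance of two independent points of the family, one drawn
    from each tilt. *)
Lemma gibbs_pair_diam v w : gvar v + gvar w + nsq (gmean v - gmean w) <= 1.
Proof.
have : \sum_j gibbs w j * (\sum_i gibbs v i * nsq (X i - X j)) <= 1.
  rewrite -[leRHS](Ecst w); apply: Ele => j.
  by rewrite -[leRHS](Ecst v); exact: Ele.
under eq_bigr do rewrite gibbs_nsq nsq_distC mulrDr.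
rewrite big_split/= Ecst gibbs_nsq [nsq (gmean w - _)]nsq_distC.
by rewrite addrA.
Qed.

Lemma nsq_sub_gmean_le1 v i : nsq (X i - gmean v) <= 1.
Proof.
have : \sum_j gibbs v j * nsq (X j - X i) <= 1.
  by rewrite -[leRHS](Ecst v); apply: Ele.
by rewrite gibbs_nsq nsq_distC; have := gvar_ge0 v; lra.
Qed.

Definition coord_var v (j : 'I_n) : R :=
  \sum_i gibbs v i * X i ord0 j ^+ 2 - gmean v ord0 j ^+ 2.

Lemma gvar_coord v : gvar v = \sum_j coord_var v j.
Proof.
have := gibbs_nsq v 0; rewrite subr0 => /eqP; rewrite -subr_eq => /eqP <-.
rewrite nsqE sumrB exchange_big/=; congr (_ - _).
by apply: eq_bigr => i _; rewrite subr0 nsqE mulr_sumr.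
Qed.

Let stepE h j i : n%:R * dot (h *: ebase j) (X i) = n%:R * h * X i ord0 j.
Proof. by rewrite dotZl dot_ebase mulrA. Qed.

Let step_le h j i : 0 <= h -> `|n%:R * h * X i ord0 j| <= n%:R * h.
Proof.
move=> h0; rewrite normrM (ger0_norm (mulr_ge0 (ltW n0) h0)) ler_piMr ?mulr_ge0 ?(ltW n0)//.
rewrite -sqrtr_sqr -[leRHS]sqrtr1 ler_wsqrtr//.
exact: le_trans (coord_sq_le_nsq _ _) (X_le1 i).
Qed.

Let A1E h v j : \sum_i gibbs v i * (n%:R * h * X i ord0 j) = n%:R * h * gmean v ord0 j.
Proof. by rewrite gmean_coord mulr_sumr; apply: eq_bigr => i _; ring. Qed.

Let VarE h v j : \sum_i gibbs v i * (n%:R * h * X i ord0 j) ^+ 2 -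
  (n%:R * h * gmean v ord0 j) ^+ 2 = (n%:R * h) ^+ 2 * coord_var v j.
Proof.
rewrite /coord_var mulrBr exprMn mulr_sumr; congr (_ - _).
by apply: eq_bigr => i _; ring.
Qed.

(** The Hessian of [flam] is [n] times the covariance of the tilted measure; a step of the walk
    averages over [n] axes, so the factors [n] cancel and the trace remains. *)
Lemma walk_flam_ge h v : 0 <= h -> n%:R * h <= 1 / 4 ->
  flam v + h ^+ 2 / 2 * gvar v - 3 * n%:R ^+ 2 * h ^+ 3 <= walk h flam v.
Proof.
move=> h0 nh.
have key j : 2 * flam v + (n%:R * h ^+ 2 * coord_var v j - 5 * n%:R ^+ 2 * h ^+ 3) <=
    flam (v + h *: ebase j) + flam (v - h *: ebase j).
  rewrite !flamD.
  have := ln_mgf_sym_ge (gibbs_ge0 v) (gibbs_sum v) (fun i => step_le j i h0) nh.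
  rewrite A1E VarE.
  have -> : gmgf v (h *: ebase j) = \sum_i gibbs v i * expR (n%:R * h * X i ord0 j).
    by apply: eq_bigr => i _; rewrite stepE.
  have -> : gmgf v (- (h *: ebase j)) = \sum_i gibbs v i * expR (- (n%:R * h * X i ord0 j)).
    by apply: eq_bigr => i _; rewrite dotNl mulrN stepE.
  set A := ln _; set B := ln _ => AB.
  have -> : flam v + A / n%:R + (flam v + B / n%:R) = 2 * flam v + (A + B) / n%:R by ring.
  rewrite lerD2l ler_pdivlMr//; apply: le_trans AB.
  by rewrite le_eqVlt; apply/orP; left; apply/eqP; ring.
rewrite /walk ler_pdivlMr ?mulr_gt0//.
apply: le_trans (ler_sum _ (fun j _ => key j)).
rewrite big_split/= sumr_const card_ord sumrB -mulr_sumr -gvar_coord.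
rewrite sumr_const card_ord -[2 * flam v *+ n]mulr_natr -[_ * h ^+ 3 *+ n]mulr_natr.
have : 0 <= n%:R ^+ 2 * h ^+ 3 * n%:R by rewrite !mulr_ge0 ?exprn_ge0// ltW.
have -> : (flam v + h ^+ 2 / 2 * gvar v - 3 * n%:R ^+ 2 * h ^+ 3) * (2 * n%:R) =
  2 * flam v * n%:R + (n%:R * h ^+ 2 * gvar v) - 6 * (n%:R ^+ 2 * h ^+ 3 * n%:R) by field.
have -> : 5 * n%:R ^+ 2 * h ^+ 3 * n%:R = 5 * (n%:R ^+ 2 * h ^+ 3 * n%:R) by ring.
lra.
Qed.

(** The tilts by [h] and [-h] along an axis move the mean in opposite directions by a multiple of
    the coordinate variance; the divergence is the sum of these. *)
Lemma sdiff_gmean_near h v : 0 < h -> n%:R * h <= 1 / 4 ->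
  `|\sum_j sdiff h j (fun w => gmean w ord0 j) v - h ^+ 2 * gvar v| <=
  12 * n%:R ^+ 2 * h ^+ 3.
Proof.
move=> h0 nh.
have nh0 : 0 < n%:R * h by rewrite mulr_gt0.
have key j : `|sdiff h j (fun w => gmean w ord0 j) v - h ^+ 2 * coord_var v j| <=
    12 * n%:R * h ^+ 3.
  have P := tilted_mean_near (gibbs_ge0 v) (gibbs_sum v) (fun i => step_le j i (ltW h0)) nh.
  have Nle i : `|- (n%:R * h * X i ord0 j)| <= n%:R * h by rewrite normrN step_le// ltW.
  have Q := tilted_mean_near (gibbs_ge0 v) (gibbs_sum v) Nle nh.
  move: P; rewrite A1E VarE.
  have -> : (\sum_i gibbs v i * (n%:R * h * X i ord0 j * expR (n%:R * h * X i ord0 j)))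
     / (\sum_i gibbs v i * expR (n%:R * h * X i ord0 j)) =
     n%:R * h * gmean (v + h *: ebase j) ord0 j.
    rewrite gmean_coord mulr_sumr mulr_suml; apply: eq_bigr => i _.
    rewrite gibbsD stepE; have -> : gmgf v (h *: ebase j) = \sum_i gibbs v i * expR (n%:R * h * X i ord0 j).
      by apply: eq_bigr => i' _; rewrite stepE.
    ring.
  move: Q; have -> : (\sum_i gibbs v i * (- (n%:R * h * X i ord0 j) * expR (- (n%:R * h * X i ord0 j))))
     / (\sum_i gibbs v i * expR (- (n%:R * h * X i ord0 j))) =
     - (n%:R * h * gmean (v - h *: ebase j) ord0 j).
    rewrite gmean_coord mulr_sumr mulr_suml -sumrN; apply: eq_bigr => i _.
    rewrite gibbsD dotNl mulrN stepE.
    have -> : gmgf v (- (h *: ebase j)) = \sum_i gibbs v i * expR (- (n%:R * h * X i ord0 j)).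
      by apply: eq_bigr => i' _; rewrite dotNl mulrN stepE.
    ring.
  under eq_bigr do rewrite mulrN.
  rewrite sumrN A1E sqrrN; under eq_bigr do rewrite sqrrN.
  rewrite VarE /sdiff.
  move: (gmean (v + h *: ebase j) ord0 j) (gmean (v - h *: ebase j) ord0 j).
  move: (gmean v ord0 j) => m mp mm.
  set cv := coord_var _ _.
  rewrite !ler_norml => /andP[q1 q2] /andP[p1 p2].
  have -> : h / (2 * n%:R) * (mp - mm) - h ^+ 2 * cv =
     (n%:R * h * mp - n%:R * h * mm - 2 * (n%:R * h) ^+ 2 * cv) / (2 * n%:R ^+ 2).
    by field; rewrite gt_eqF.
  have d0 : 0 < 2 * n%:R ^+ 2 :> R by rewrite mulr_gt0// exprn_gt0.
  rewrite ler_pdivlMr// ler_pdivrMr//.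
  have -> : - (12 * n%:R * h ^+ 3) * (2 * n%:R ^+ 2) = - (24 * (n%:R * h) ^+ 3) by ring.
  have -> : 12 * n%:R * h ^+ 3 * (2 * n%:R ^+ 2) = 24 * (n%:R * h) ^+ 3 by ring.
  by apply/andP; split; lra.
rewrite gvar_coord mulr_sumr -sumrB.
apply: le_trans (ler_norm_sum _ _ _) _.
apply: le_trans (ler_sum _ (fun j _ => key j)) _.
by rewrite sumr_const card_ord -mulr_natr le_eqVlt; apply/orP; left; apply/eqP; ring.
Qed.

(** The new tilt has density at most [exp (2 th)] against the old one, and the old mean used as
    centre can only increase the second moment. *)
Lemma gvar_step_le v e (th : R) : (forall i, `|n%:R * dot e (X i)| <= th) ->
  th <= 1 / 4 -> gvar (v + e) <= gvar v + 4 * th.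
Proof.
move=> eth th4.
have th0 : 0 <= th.
  by have [i _] := card_gt0P I_gt0; exact: le_trans (normr_ge0 _) (eth i).
have e2 : expR (th + th) <= 1 + 4 * th.
  have := @expR_taylor1 R (th + th).
  by rewrite ger0_norm => [/(_ _)|]; rewrite ?expr2; nra.
have mg : expR (- th) <= gmgf v e.
  rewrite -[leLHS](Ecst v); apply: Ele => i; rewrite ler_expR.
  by have := eth i; rewrite ler_norml => /andP[].
apply: (@le_trans _ _ (\sum_i gibbs (v + e) i * nsq (X i - gmean v))).
  by rewrite gibbs_nsq lerDl nsq_ge0.
apply: (@le_trans _ _ (\sum_i expR (th + th) * (gibbs v i * nsq (X i - gmean v)))).
  apply: ler_sum => i _; rewrite mulrA; apply: ler_wpM2r; first exact: nsq_ge0.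
  rewrite gibbsD ler_pdivrMr ?gmgf_gt0//.
  have -> : expR (th + th) * gibbs v i * gmgf v e = gibbs v i * (expR (th + th) * gmgf v e) by ring.
  apply: ler_wpM2l; first exact: gibbs_ge0.
  apply: (@le_trans _ _ (expR (th + th) * expR (- th))); last first.
    by rewrite ler_wpM2l ?expR_ge0.
  rewrite -expRD addrK ler_expR.
  by have := eth i; rewrite ler_norml => /andP[].
rewrite -mulr_sumr -/(gvar v).
have := gvar_le1 v; have := gvar_ge0 v; nra.
Qed.

Lemma walk_gvar_near h v : 0 <= h -> n%:R * h <= 1 / 4 ->
  `|walk h gvar v - gvar v| <= 4 * (n%:R * h).
Proof.
move=> h0 nh.
have key w (e : 'rV[R]_n) : (forall i, `|n%:R * dot e (X i)| <= n%:R * h) ->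
    - (4 * (n%:R * h)) <= gvar (w + e) - gvar w <= 4 * (n%:R * h).
  move=> eh; have eh' i : `|n%:R * dot (- e) (X i)| <= n%:R * h.
    by rewrite dotNl mulrN normrN.
  have := gvar_step_le w eh nh; have := gvar_step_le (w + e) eh' nh.
  rewrite addrK; move: (gvar (w + e)) (gvar w) => x y.
  by move=> *; apply/andP; split; lra.
have -> : walk h gvar v - gvar v =
   (\sum_(j < n) ((gvar (v + h *: ebase j) - gvar v) + (gvar (v - h *: ebase j) - gvar v))) / (2 * n%:R).
  under eq_bigr do rewrite addrACA.
  rewrite big_split/= sumr_const card_ord -[_ *+ n]mulr_natr mulrDl; congr (_ + _).
  by field; rewrite gt_eqF.
rewrite normrM [`|_^-1|]ger0_norm; last by rewrite invr_ge0 mulr_ge0// ltW.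
rewrite ler_pdivrMr ?mulr_gt0//; apply: le_trans (ler_norm_sum _ _ _) _.
apply: (@le_trans _ _ (\sum_(j < n) 8 * (n%:R * h))); last first.
  by rewrite sumr_const card_ord -[_ *+ n]mulr_natr le_eqVlt; apply/orP; left; apply/eqP; ring.
apply: ler_sum => j _.
apply: le_trans (ler_normD _ _) _.
have -> : 8 * (n%:R * h) = 4 * (n%:R * h) + 4 * (n%:R * h) by ring.
apply: lerD; rewrite ler_norml; apply: key => i; first by rewrite stepE step_le.
by rewrite dotNl mulrN normrN stepE step_le.
Qed.

Notation W h k := (iter k (walk h)).

Definition mflam h k : R := W h k flam 0.
Definition mgvar h k : R := W h k gvar 0.
Definition menergy h k : R := W h k (fun v => dot v (gmean v)) 0.

Lemma mflam_step h k : 0 <= h -> n%:R * h <= 1 / 4 ->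
  mflam h k + h ^+ 2 / 2 * mgvar h k - 3 * n%:R ^+ 2 * h ^+ 3 <= mflam h k.+1.
Proof.
move=> h0 nh; rewrite /mflam /mgvar iterSr.
have := iter_walk_le n_gt0 h k 0 (fun v => walk_flam_ge v h0 nh).
by rewrite iter_walkB// iter_walkD// iter_walkZ// iter_walk_cst.
Qed.

(* Gaussian integration by parts for the walk. *)
Lemma menergy_near h k : 0 < h -> n%:R * h <= 1 / 4 ->
  `|menergy h k - k%:R * h ^+ 2 * mgvar h k| <= k%:R * h ^+ 2 * (16 * n%:R ^+ 2 * h).
Proof.
move=> h0 nh; rewrite /menergy /mgvar.
case: k => [|k]; first by rewrite /= dot0l !mul0r subrr normr0.
rewrite iter_walk_sum//.
have -> : \sum_(i < n) W h k.+1 (fun w => w ord0 i * gmean w ord0 i) 0 =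
   k.+1%:R * W h k (fun w => \sum_j sdiff h j (fun u => gmean u ord0 j) w) 0.
  rewrite iter_walk_sum// mulr_sumr; apply: eq_bigr => i _.
  by rewrite iter_walk_coord// mxE mul0r add0r.
set S := W h k _ 0.
have P1 : `|S - h ^+ 2 * W h k gvar 0| <= 12 * n%:R ^+ 2 * h ^+ 3.
  rewrite -iter_walkZ// -iter_walkB//; apply: iter_walk_norm_le => // w.
  exact: sdiff_gmean_near.
(* Integration by parts over [k + 1] steps leaves a mean over [k] steps; this pays for the missing
   one. *)
have P2 : `|W h k.+1 gvar 0 - W h k gvar 0| <= 4 * (n%:R * h).
  rewrite iterSr -iter_walkB//; apply: iter_walk_norm_le => // w.
  by apply: walk_gvar_near => //; exact: ltW.
have -> : k.+1%:R * S - k.+1%:R * h ^+ 2 * W h k.+1 gvar 0 =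
  k.+1%:R * ((S - h ^+ 2 * W h k gvar 0) - h ^+ 2 * (W h k.+1 gvar 0 - W h k gvar 0)) by ring.
rewrite normrM normr_nat -mulrA ler_wpM2l//.
apply: le_trans (ler_normB _ _) _.
rewrite normrM (ger0_norm (sqr_ge0 h)).
have n1 : 1 <= n%:R :> R by rewrite ler1n.
have h3 : 0 <= h ^+ 3 by rewrite exprn_ge0// ltW.
have hh : h ^+ 2 * `|W h k.+1 gvar 0 - W h k gvar 0| <= 4 * n%:R * h ^+ 3.
  apply: le_trans (ler_wpM2l (sqr_ge0 h) P2) _.
  by rewrite le_eqVlt; apply/orP; left; apply/eqP; ring.
have -> : h ^+ 2 * (16 * n%:R ^+ 2 * h) = 16 * n%:R ^+ 2 * h ^+ 3 by ring.
have : 4 * n%:R * h ^+ 3 <= 4 * n%:R ^+ 2 * h ^+ 3.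
  by rewrite ler_wpM2r// ler_pM2l// expr2 ler_peMr// ltW.
lra.
Qed.

(* The reflection v -> -v makes the diameter bound act on antipodal tilts. *)
Lemma menergy_diam h k : 0 < menergy h k ->
  4 * menergy h k ^+ 2 <= k%:R * h ^+ 2 * (1 - 2 * mgvar h k).
Proof.
set M := menergy h k; set t := k%:R * h ^+ 2; set V := mgvar h k => Mp.
have key (c : R) : 0 < c -> 4 * M <= c * t + (1 - 2 * V) / c.
  move=> c0.
  have E : 4 * M = W h k (fun v => 2 * dot v (gmean v - gmean (- v))) 0.
    rewrite iter_walkZ//; under eq_fun do rewrite dotBr.
    rewrite iter_walkB//.
    have -> : W h k (fun w => dot w (gmean (- w))) 0 = - M.
      rewrite /M /menergy -[in RHS]oppr0 -iter_walk_opp// -mulN1r -iter_walkZ//.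
      by congr (iter _ _ _ _); apply/funext => w; rewrite dotNl mulN1r opprK.
    by rewrite -/(menergy h k) -/M; ring.
  rewrite E.
  have -> : c * t + (1 - 2 * V) / c =
     W h k (fun v => c * nsq v + c^-1 * (1 - (gvar v + gvar (- v)))) 0.
    rewrite iter_walk_lin// iter_walk_nsq// iter_walkB// iter_walk_cst// iter_walkD//.
    rewrite iter_walk_opp// oppr0 /nsq dot0l add0r -/t -/(mgvar h k) -/V; ring.
  apply: iter_walk_le => // v; apply: le_trans (dot_young _ _ c0) _.
  rewrite lerD2l [_ / c]mulrC ler_pM2l ?invr_gt0//.
  by have := gibbs_pair_diam v (- v); lra.
have Mn0 : M != 0 by rewrite gt_eqF.
have t0 : 0 <= t by rewrite mulr_ge0// sqr_ge0.
have [t00|tn0] := eqVneq t 0.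
  exfalso; have V0 : 0 <= V.
    by rewrite -(iter_walk_cst n_gt0 h k 0 0); apply: iter_walk_le => // v; exact: gvar_ge0.
  have := key M^-1; rewrite invr_gt0 => /(_ Mp); rewrite t00 mulr0 add0r invrK; nra.
have tp : 0 < t by rewrite lt0r tn0.
(* With this [c] the two terms of Young's inequality coincide when the claimed bound is attained. *)
have c0 : 0 < 2 * M / t by apply: divr_gt0 => //; rewrite mulr_gt0.
have := key _ c0.
have -> : 2 * M / t * t + (1 - 2 * V) / (2 * M / t) = 2 * M + t * (1 - 2 * V) / (2 * M).
  by field; rewrite tn0 Mn0.
move=> k1; have : 2 * M <= t * (1 - 2 * V) / (2 * M) by lra.
rewrite ler_pdivlMr ?mulr_gt0//.
by rewrite expr2; lra.
Qed.

End Gibbs.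

(** * A compactly supported subsolution of the heat equation, run along the walk *)

Section HeatKernel.
Variable R : realType.

(** Induction on the exponent: the inequality is multiplied by [g + d], whose sign preserves it. *)
Lemma exprD_taylor_ge (m : nat) : exists2 C : R, 0 <= C &
  forall g d : R, 0 <= g <= 1 -> `|d| <= 1 -> 0 <= g + d ->
  g ^+ m.+2 + m.+2%:R * g ^+ m.+1 * d + (m.+2 * m.+1)%:R / 2 * g ^+ m * d ^+ 2
    - C * `|d| ^+ 3 <= (g + d) ^+ m.+2.
Proof.
elim: m => [|m [C C0 IH]].
  by exists 0 => // g d _ _ _; rewrite mul0r subr0 le_eqVlt; apply/orP; left; apply/eqP; field.
exists ((m.+2 * m.+1)%:R / 2 + 2 * C); first by rewrite addr_ge0 ?mulr_ge0.
move=> g d gi d1 gd; have [g0 g1] := andP gi.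
have := ler_wpM2l gd (IH g d gi d1 gd); rewrite -exprS; apply: le_trans.
set D := `|d| ^+ 3; have D0 : 0 <= D by rewrite exprn_ge0.
have d3 : - D <= d ^+ 3 by rewrite /D -normrX lerNnormlW.
have gm : 0 <= g ^+ m <= 1 by rewrite exprn_ge0// exprn_ile1.
set c : R := (m.+2 * m.+1)%:R / 2; have c0 : 0 <= c by rewrite mulr_ge0.
have -> : (m.+3 * m.+2)%:R / 2 = c + m.+2%:R.
  by rewrite /c !natrM -(natr1 m.+2) -(natr1 m.+1); field.
have := ler_norm d => dn.
have gmd : - (c * D) <= c * g ^+ m * d ^+ 3.
  have : c * g ^+ m * - D <= c * g ^+ m * d ^+ 3 by rewrite ler_wpM2l// mulr_ge0//; lra.
  have : c * g ^+ m * D <= c * D by rewrite ler_wpM2r// ler_piMr//; lra.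
  lra.
have gdC : (g + d) * (C * D) <= 2 * C * D by rewrite -mulrA ler_wpM2r ?mulr_ge0//; lra.
have -> : (g + d) * (g ^+ m.+2 + m.+2%:R * g ^+ m.+1 * d + c * g ^+ m * d ^+ 2 - C * D) =
  g ^+ m.+3 + m.+3%:R * g ^+ m.+2 * d + (c + m.+2%:R) * g ^+ m.+1 * d ^+ 2
  + c * g ^+ m * d ^+ 3 - (g + d) * (C * D).
  by rewrite -(natr1 m.+2) !exprS; ring.
lra.
Qed.

(** A truncated power of exponent at least 3 is twice differentiable with Lipschitz second
    derivative, so the expansion survives the truncation: where [g + d < 0] one has [g <= |d|], and
    every positive term is cubic in [d]. *)
Lemma posX_taylor_ge (m : nat) : exists2 C : R, 0 <= C &
  forall g d : R, 0 <= g <= 1 -> `|d| <= 1 ->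
  g ^+ m.+3 + m.+3%:R * g ^+ m.+2 * d + (m.+3 * m.+2)%:R / 2 * g ^+ m.+1 * d ^+ 2
    - C * `|d| ^+ 3 <= Num.max (g + d) 0 ^+ m.+3.
Proof.
have [C C0 HC] := exprD_taylor_ge m.+1.
set c : R := (m.+3 * m.+2)%:R / 2; have c0 : 0 <= c by rewrite mulr_ge0.
exists (C + (1 + c)); first by lra.
move=> g d gi d1; set D := `|d| ^+ 3; have D0 : 0 <= D by rewrite exprn_ge0.
have [gd|gd] := leP 0 (g + d).
  have := HC g d gi d1 gd; rewrite -/c -/D.
  have : 0 <= (1 + c) * D by rewrite mulr_ge0//; lra.
  rewrite mulrDl; lra.
rewrite expr0n/=; have [g0 g1] := andP gi.
have dE : `|d| = - d by rewrite ltr0_norm//; lra.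
have gD : g <= `|d| by rewrite dE; lra.
have gm j : 0 <= g ^+ j <= 1 by rewrite exprn_ge0// exprn_ile1.
have t1 : g ^+ m.+3 <= D.
  rewrite -addn3 exprD; apply: (@le_trans _ _ (1 * g ^+ 3)).
    by rewrite ler_wpM2r ?exprn_ge0//; have := gm m; lra.
  by rewrite mul1r lerXn2r ?nnegrE.
have t2 : m.+3%:R * g ^+ m.+2 * d <= 0.
  have d0 : d <= 0 by lra.
  by rewrite mulr_ge0_le0// mulr_ge0 ?exprn_ge0.
have t3 : c * g ^+ m.+1 * d ^+ 2 <= c * D.
  rewrite -mulrA ler_wpM2l// /D -[d ^+ 2]real_normK ?num_real// (exprS _ 2).
  rewrite ler_wpM2r ?exprn_ge0// exprS; have := gm m; nra.
have : 0 <= C * D by rewrite mulr_ge0.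
move: t1 t2 t3; rewrite !mulrDl mul1r.
move: (g ^+ m.+3) (_ * d) (_ * d ^+ 2) (c * D) (C * D) => *; lra.
Qed.

Lemma exprD_taylor_le (m : nat) : exists2 C : R, 0 <= C &
  forall g x : R, 0 <= g <= 1 -> 0 <= x <= 1 ->
  (g + x) ^+ m.+1 <= g ^+ m.+1 + m.+1%:R * g ^+ m * x + C * x ^+ 2.
Proof.
elim: m => [|m [C C0 IH]].
  by exists 0 => // g x _ _; rewrite !expr1 expr0 mul0r; lra.
exists (m.+1%:R + 2 * C); first by rewrite addr_ge0 ?mulr_ge0.
move=> g x gi xi; have [g0 g1] := andP gi; have [x0 x1] := andP xi.
have gx : 0 <= g + x by lra.
have := ler_wpM2l gx (IH g x gi xi); rewrite -exprS => /le_trans; apply.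
have gm : 0 <= g ^+ m <= 1 by rewrite exprn_ge0// exprn_ile1.
have m0 : 0 <= m.+1%:R * x ^+ 2 by rewrite mulr_ge0// sqr_ge0.
have e1 : m.+1%:R * x ^+ 2 * g ^+ m <= m.+1%:R * x ^+ 2 by rewrite ler_piMr//; lra.
have e2 : (g + x) * (C * x ^+ 2) <= 2 * (C * x ^+ 2).
  by rewrite ler_wpM2r ?mulr_ge0 ?sqr_ge0//; lra.
have -> : (g + x) * (g ^+ m.+1 + m.+1%:R * g ^+ m * x + C * x ^+ 2) =
  g ^+ m.+2 + m.+2%:R * g ^+ m.+1 * x + m.+1%:R * x ^+ 2 * g ^+ m + (g + x) * (C * x ^+ 2).
  by rewrite -(natr1 m.+1) !exprS; ring.
rewrite mulrDl; lra.
Qed.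

Variables (n m a : nat).
Hypothesis n_gt0 : (0 < n)%N.
Let p := m.+3.
Let n0 : 0 < n%:R :> R. Proof. by rewrite ltr0n. Qed.

(* The kernel [Q^-a (1 - |z|^2 / Q)_+^p] is a subsolution of the heat equation
   as [Q] grows at unit speed; this quadratic inequality is what remains of the
   differential inequality once the powers of [1 - |z|^2 / Q] are factored. *)
Hypothesis quad : forall g : R, 0 <= g <= 1 ->
  0 <= (a + p)%:R * g ^+ 2 - 2 * p%:R * g + 2 * (p * p.-1)%:R / n%:R * (1 - g).

Definition bump (Q : R) (z : 'rV[R]_n) : R := Num.max (1 - nsq z / Q) 0 ^+ p.

Lemma bump_ge0 Q z : 0 <= bump Q z.
Proof. by rewrite exprn_ge0// le_max lexx orbT. Qed.

(** A step of the walk advances the heat equation by the time [h^2]. [quad] settles the terms of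
    second order in the relative step [sg], and [C] depends on neither the position, the step nor
    [Q]. *)
Lemma walk_bump_ge : exists2 C : R, 0 <= C & forall (h Q sg : R) z,
  0 < Q -> 0 <= sg -> sg <= 1 / 4 -> sg ^+ 2 = h ^+ 2 / Q ->
  (Q / (Q + h ^+ 2)) ^+ a * bump (Q + h ^+ 2) z <= walk h (bump Q) z + C * sg ^+ 3.
Proof.
have [C1 C10 HC1] := posX_taylor_ge m.
have [C2 C20 HC2] := exprD_taylor_le m.+2.
pose N : R := (a + p)%:R; have N0 : 0 <= N by [].
have NN : 0 <= N ^+ 2 * (1 + p%:R + C2).
  by rewrite mulr_ge0 ?sqr_ge0//; have := ler0n R p; lra.
exists (1 + 27 * C1 + (C2 + N ^+ 2 * (1 + p%:R + C2))).
  by move: NN; lra.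
move=> h Q sg z Q0 sg0 sg4 sgE.
set CC := (X in X * sg ^+ 3).
pose x := h ^+ 2 / Q; pose g := 1 - nsq z / Q.
have x0 : 0 <= x by rewrite /x -sgE sqr_ge0.
have xs : x = sg ^+ 2 by rewrite sgE.
have x1 : x <= 1 / 16 by rewrite xs expr2; nra.
have sg3 : 0 <= sg ^+ 3 by rewrite exprn_ge0.
have x2s : x ^+ 2 <= sg ^+ 3 by rewrite xs -exprM (exprSr _ 3) ler_piMr//; lra.
have Qh : 0 < Q + h ^+ 2 by rewrite ltr_wpDr ?sqr_ge0.
have QE : Q / (Q + h ^+ 2) = (1 + x)^-1.
  rewrite /x; field; rewrite gt_eqF//= gt_eqF//.
have gE : 1 - nsq z / (Q + h ^+ 2) = (g + x) / (1 + x).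
  rewrite /g /x; field; rewrite gt_eqF//= gt_eqF//.
have g1 : g <= 1 by rewrite /g gerBl divr_ge0 ?nsq_ge0// ltW.
have w0 : 0 <= walk h (bump Q) z.
  by rewrite -(walk_cst n_gt0 h 0 z); apply: walk_le => // y; exact: bump_ge0.
(* Outside the support of the old kernel the new one is at most a power of [x], below the error
   term. *)
have [gneg|gpos] := ltP g 0.
  have b1 : bump (Q + h ^+ 2) z <= sg ^+ 3.
    rewrite /bump gE.
    have mx : Num.max ((g + x) / (1 + x)) 0 <= x.
      rewrite ge_max x0 andbT ler_pdivrMr; last by lra.
      nra.
    have mx0 : 0 <= Num.max ((g + x) / (1 + x)) 0 by rewrite le_max lexx orbT.
    apply: le_trans x2s; apply: (@le_trans _ _ (Num.max ((g + x) / (1 + x)) 0 ^+ 2)).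
      by rewrite /p -addn2 addnC exprD ler_piMr ?exprn_ge0// exprn_ile1//; lra.
    by rewrite lerXn2r ?nnegrE.
  have q1 : 0 <= (Q / (Q + h ^+ 2)) ^+ a <= 1.
    rewrite exprn_ge0 ?divr_ge0 ?(ltW Q0) ?(ltW Qh)// exprn_ile1 ?divr_ge0 ?(ltW Q0) ?(ltW Qh)//.
    by rewrite ler_pdivrMr// mul1r lerDl sqr_ge0.
  have b0 := bump_ge0 (Q + h ^+ 2) z.
  have : sg ^+ 3 <= CC * sg ^+ 3.
    by rewrite ler_peMl// /CC; lra.
  nra.
have gi : 0 <= g <= 1 by rewrite gpos.
have gm j : 0 <= g ^+ j <= 1 by rewrite exprn_ge0// exprn_ile1.
pose u := g ^+ p + x * (p%:R * g ^+ m.+2 - N * g ^+ p).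
have UB : (Q / (Q + h ^+ 2)) ^+ a * bump (Q + h ^+ 2) z <=
    u + (C2 + N ^+ 2 * (1 + p%:R + C2)) * sg ^+ 3.
  rewrite QE /bump gE max_l; last by rewrite divr_ge0//; lra.
  rewrite exprMn mulrCA -exprD -/N.
  have gx : (g + x) ^+ p <= g ^+ p + p%:R * g ^+ m.+2 * x + C2 * x ^+ 2.
    by apply: HC2 => //; apply/andP; split; lra.
  have iN : (1 + x)^-1 ^+ (a + p) <= 1 - N * x + N ^+ 2 * x ^+ 2.
    have : 1 + N * x <= (1 + x) ^+ (a + p).
      rewrite /N; elim: (a + p)%N => [|k IH]; first by rewrite mul0r addr0 expr0.
      rewrite exprSr -natr1; have : 0 <= k%:R * x by rewrite mulr_ge0.
      nra.
    have N1 : 0 <= N * x by rewrite mulr_ge0.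
    move=> B; rewrite exprVn; apply: (@le_trans _ _ (1 + N * x)^-1).
      by rewrite lef_pV2 ?posrE ?exprn_gt0//; lra.
    rewrite -[leLHS]mul1r ler_pdivrMr; last lra.
    have -> : (1 - N * x + N ^+ 2 * x ^+ 2) * (1 + N * x) = 1 + (N * x) ^+ 3 by ring.
    by rewrite lerDl exprn_ge0.
  have G0 : 0 <= (g + x) ^+ p by rewrite exprn_ge0//; lra.
  have I0 : 0 <= (1 + x)^-1 ^+ (a + p) by rewrite exprn_ge0// invr_ge0; lra.
  apply: (le_trans (ler_pM G0 I0 gx iN)).
  set A := g ^+ p; set B := p%:R * g ^+ m.+2.
  have A1 : 0 <= A <= 1 by exact: gm.
  have B1 : 0 <= B <= p%:R.
    by rewrite mulr_ge0 ?exprn_ge0//= ler_piMr//; case/andP: (gm m.+2).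
  have -> : (A + B * x + C2 * x ^+ 2) * (1 - N * x + N ^+ 2 * x ^+ 2) =
    u + x ^+ 2 * (C2 - N * (B + C2 * x) + N ^+ 2 * (A + B * x + C2 * x ^+ 2)).
    by rewrite /u -/A -/B; ring.
  rewrite lerD2l mulrC.
  have [a0 a1] := andP A1; have [b0 b1] := andP B1.
  have NB : 0 <= N * (B + C2 * x) by rewrite mulr_ge0// addr_ge0// mulr_ge0.
  have N20 := sqr_ge0 N.
  have x21 : x ^+ 2 <= 1 by rewrite expr2; nra.
  have AB : A + B * x + C2 * x ^+ 2 <= 1 + p%:R + C2.
    by have := sqr_ge0 x; nra.
  have NAB := ler_wpM2l N20 AB.
  apply: (@le_trans _ _ ((C2 + N ^+ 2 * (1 + p%:R + C2)) * x ^+ 2)).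
    by apply: ler_wpM2r; [exact: sqr_ge0|lra].
  apply: ler_wpM2l x2s.
  by rewrite addr_ge0.
suff LB : u - 27 * C1 * sg ^+ 3 <= walk h (bump Q) z.
  by rewrite /CC !mulrDl; move: UB; rewrite !mulrDl; lra.
pose zt i := h * z ord0 i / Q.
pose c2 : R := (m.+3 * m.+2)%:R / 2.
have zt2 i : zt i ^+ 2 <= sg ^+ 2.
  have -> : zt i ^+ 2 = x * (z ord0 i ^+ 2 / Q) by rewrite /zt /x; ring.
  rewrite -xs ler_piMr// ler_pdivrMr// mul1r.
  apply: le_trans (coord_sq_le_nsq z i) _.
  by move: gpos; rewrite /g subr_ge0 ler_pdivrMr// mul1r.
have zt1 i : - sg <= zt i <= sg.
  rewrite -ler_norml -(ler_pXn2r (n := 2)) ?nnegrE//.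
  by rewrite real_normK ?num_real.
(* The terms linear in [zt i] cancel between two opposite steps; both increments of [g] are at most
   [3 * sg], whence the factor 27 in the error. *)
have key i : 2 * g ^+ p - 2 * p%:R * g ^+ m.+2 * x + 8 * c2 * g ^+ m.+1 * zt i ^+ 2
    - 54 * C1 * sg ^+ 3 <= bump Q (z + h *: ebase i) + bump Q (z - h *: ebase i).
  have [e1 e2] := andP (zt1 i).
  have sgx : sg ^+ 2 <= sg by rewrite expr2; nra.
  have sgx0 := sqr_ge0 sg.
  have db d : `|d| <= 3 * sg -> `|d| <= 1 /\ C1 * `|d| ^+ 3 <= 27 * C1 * sg ^+ 3.
    move=> dl; split; first by lra.
    have : `|d| ^+ 3 <= (3 * sg) ^+ 3 by rewrite lerXn2r ?nnegrE// mulr_ge0.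
    rewrite exprMn => q; have := ler_wpM2l C10 q; rewrite -natrX; lra.
  pose d1 := - (2 * zt i + x); pose d2 := - (- (2 * zt i) + x).
  have [d11 d12] : `|d1| <= 1 /\ C1 * `|d1| ^+ 3 <= 27 * C1 * sg ^+ 3.
    by apply: db; rewrite /d1 normrN ler_norml xs; apply/andP; split; lra.
  have [d21 d22] : `|d2| <= 1 /\ C1 * `|d2| ^+ 3 <= 27 * C1 * sg ^+ 3.
    by apply: db; rewrite /d2 normrN ler_norml xs; apply/andP; split; lra.
  have E1 : bump Q (z + h *: ebase i) = Num.max (g + d1) 0 ^+ p.
    rewrite /bump; congr (Num.max _ _ ^+ _).
    rewrite nsqD nsqZ nsq_ebase dotZr dotC dot_ebase /g /d1 /zt /x; ring.
  have E2 : bump Q (z - h *: ebase i) = Num.max (g + d2) 0 ^+ p.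
    rewrite /bump; congr (Num.max _ _ ^+ _).
    rewrite nsqB nsqZ nsq_ebase dotZr dotC dot_ebase /g /d2 /zt /x; ring.
  have := HC1 g d1 gi d11; have := HC1 g d2 gi d21.
  rewrite E1 E2 -/p -/c2.
  have c2p : 0 <= c2 by rewrite mulr_ge0.
  have c20 : 0 <= c2 * g ^+ m.+1 * x ^+ 2.
    by apply: mulr_ge0; [apply: mulr_ge0 => //; exact: exprn_ge0|exact: sqr_ge0].
  have -> : c2 * g ^+ m.+1 * d1 ^+ 2 = 4 * (c2 * g ^+ m.+1 * zt i ^+ 2) +
    4 * (c2 * g ^+ m.+1 * zt i * x) + c2 * g ^+ m.+1 * x ^+ 2 by rewrite /d1; ring.
  have -> : c2 * g ^+ m.+1 * d2 ^+ 2 = 4 * (c2 * g ^+ m.+1 * zt i ^+ 2) -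
    4 * (c2 * g ^+ m.+1 * zt i * x) + c2 * g ^+ m.+1 * x ^+ 2 by rewrite /d2; ring.
  have -> : p%:R * g ^+ m.+2 * d1 = - 2 * (p%:R * g ^+ m.+2 * zt i) - p%:R * g ^+ m.+2 * x.
    by rewrite /d1; ring.
  have -> : p%:R * g ^+ m.+2 * d2 = 2 * (p%:R * g ^+ m.+2 * zt i) - p%:R * g ^+ m.+2 * x.
    by rewrite /d2; ring.
  have -> : 2 * p%:R * g ^+ m.+2 * x = 2 * (p%:R * g ^+ m.+2 * x) by ring.
  have -> : 8 * c2 * g ^+ m.+1 * zt i ^+ 2 = 8 * (c2 * g ^+ m.+1 * zt i ^+ 2) by ring.
  move: c20 d12 d22; rewrite -!(mulrA _ C1).
  move: (Num.max (g + d1) 0 ^+ p) (Num.max (g + d2) 0 ^+ p) (C1 * sg ^+ 3).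
  move: (C1 * `|d1| ^+ 3) (C1 * `|d2| ^+ 3) (c2 * g ^+ m.+1 * x ^+ 2).
  move: (c2 * g ^+ m.+1 * zt i ^+ 2) (c2 * g ^+ m.+1 * zt i * x) (g ^+ p).
  move: (p%:R * g ^+ m.+2 * zt i) (p%:R * g ^+ m.+2 * x).
  by move=> *; lra.
rewrite /walk ler_pdivlMr ?mulr_gt0//.
apply: le_trans (ler_sum _ (fun i _ => key i)).
rewrite sumrB big_split/= !sumr_const card_ord -mulr_sumr.
have -> : \sum_(i < n) zt i ^+ 2 = x * (1 - g).
  rewrite /zt; under eq_bigr do rewrite mulrAC exprMn mulrC.
  rewrite -mulr_suml -nsqE /x /g; field; rewrite gt_eqF//.
rewrite -[(_ - _) *+ n]mulr_natr -[(_ * sg ^+ 3) *+ n]mulr_natr.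
have := ler_wpM2l (mulr_ge0 x0 (proj1 (andP (gm m.+1)))) (quad gi).
rewrite mulr0 /= => q1.
have q2 : 0 <= 2 * n%:R * (x * g ^+ m.+1 * ((a + p)%:R * g ^+ 2 - 2 * p%:R * g + 2 * (p * p.-1)%:R / n%:R * (1 - g))).
  by rewrite mulr_ge0// mulr_ge0// ltW.
rewrite -subr_ge0; apply: (le_trans q2).
rewrite le_eqVlt; apply/orP; left; apply/eqP.
rewrite /u /N /c2 /p /= !exprS; field; rewrite gt_eqF//.
Qed.

(** The indicator of the ball dominates the kernel at [Q0]; each step then raises the parameter by
    [h^2], and the factors [(Qj / Qj.+1)^a] telescope. *)
Lemma iter_walk_bump_ge (Q0 Q e : R) : 0 < Q0 -> Q0 < Q -> 0 < e ->
  exists h k, forall z : 'rV[R]_n,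
  (Q0 / Q) ^+ a * bump Q z - e <= iter k (walk h) (fun y => (nsq y <= Q0)%R%:R) z.
Proof.
move=> Q00 QQ e0; have [C C0 HC] := walk_bump_ge.
have Q1 : 0 < Q by lra.
pose D := Q - Q0; have D0 : 0 < D by rewrite subr_gt0.
(* [k] steps with [h^2 = D / k], where [k] makes both [h^2 / Q0] and the total
   error [k (h / sqrt Q0)^3] small *)
pose B := 16 * (D / Q0) + (C * (D / Q0) / e) ^+ 2 * (D / Q0).
have d0 : 0 < D / Q0 by rewrite divr_gt0.
have B2 : 0 <= (C * (D / Q0) / e) ^+ 2 * (D / Q0).
  by apply: mulr_ge0; [exact: sqr_ge0|exact: ltW].
have B0 : 0 <= B by rewrite /B; lra.
pose k := (Num.truncn B).+1.
have kB : B < k%:R by rewrite truncnS_gt.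
have k0 : 0 < k%:R :> R by rewrite ltr0n.
pose h := Num.sqrt (D / k%:R).
have hE : h ^+ 2 = D / k%:R by rewrite sqr_sqrtr// divr_ge0 ?ltW.
pose sg := h / Num.sqrt Q0.
have sq0 : 0 < Num.sqrt Q0 by rewrite sqrtr_gt0.
have sg0 : 0 <= sg by rewrite divr_ge0 ?sqrtr_ge0.
have sgE : sg ^+ 2 = D / Q0 / k%:R.
  by rewrite /sg exprMn exprVn hE sqr_sqrtr ?ltW//; ring.
exists h, k => z.
pose Qj (j : nat) := Q0 + j%:R * h ^+ 2.
have Qj0 j : Q0 <= Qj j by rewrite lerDl mulr_ge0// sqr_ge0.
have Qjp j : 0 < Qj j by exact: lt_le_trans (Qj0 j).
have sg4 : sg <= 1 / 4.
  have : sg ^+ 2 <= (1 / 4) ^+ 2.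
    rewrite sgE ler_pdivrMr//; move: kB; rewrite /B expr2; lra.
  by rewrite ler_pXn2r ?nnegrE.
have step j y : (Q0 / Qj j) ^+ a * bump (Qj j) y - j%:R * (C * sg ^+ 3) <=
    iter j (walk h) (fun y => (nsq y <= Q0)%R%:R) y.
  elim: j y => [|j IH] y.
    rewrite /Qj !mul0r addr0 subr0 divff ?gt_eqF// expr1n mul1r /= /bump.
    have [yQ|yQ] := leP (nsq y) Q0; last first.
      rewrite max_r ?expr0n// subr_le0 ler_pdivlMr// mul1r; exact: ltW.
    rewrite exprn_ile1// ?le_max ?lexx ?orbT// ge_max ler01 andbT gerBl.
    by rewrite divr_ge0 ?nsq_ge0 ?ltW.
  pose sgj := h / Num.sqrt (Qj j).
  have sqj : 0 < Num.sqrt (Qj j) by rewrite sqrtr_gt0.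
  have sgj0 : 0 <= sgj by rewrite divr_ge0 ?sqrtr_ge0.
  have sgjs : sgj <= sg.
    by rewrite /sgj /sg ler_wpM2l ?sqrtr_ge0// lef_pV2 ?posrE// ler_wsqrtr.
  have sgjE : sgj ^+ 2 = h ^+ 2 / Qj j.
    by rewrite /sgj exprMn exprVn (sqr_sqrtr (ltW (Qjp j))).
  have H := HC h (Qj j) sgj y (Qjp j) sgj0 (le_trans sgjs sg4) sgjE.
  have QS : Qj j + h ^+ 2 = Qj j.+1 by rewrite /Qj -natr1; ring.
  rewrite QS in H.
  pose c := (Q0 / Qj j) ^+ a.
  have c01 : 0 <= c <= 1.
    rewrite exprn_ge0 ?divr_ge0 ?(ltW Q00) ?(ltW (Qjp j))// exprn_ile1//.
      by rewrite divr_ge0 ?(ltW Q00) ?(ltW (Qjp j)).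
    by rewrite ler_pdivrMr// mul1r.
  have cE : (Q0 / Qj j.+1) ^+ a = c * (Qj j / Qj j.+1) ^+ a.
    by rewrite /c -exprMn; congr (_ ^+ _); field; rewrite !gt_eqF.
  have sg33 : sgj ^+ 3 <= sg ^+ 3 by rewrite lerXn2r ?nnegrE.
  have W1 : c * walk h (bump (Qj j)) y - j%:R * (C * sg ^+ 3) <=
      iter j.+1 (walk h) (fun y => (nsq y <= Q0)%R%:R) y.
    have := walk_le n_gt0 h y IH.
    rewrite -/c; have := walk_lin h c (- (j%:R * (C * sg ^+ 3))) (bump (Qj j)) (fun=> 1) y.
    rewrite walk_cst// mulr1 => <-; apply: le_trans.
    by apply: walk_le => // w; rewrite mulr1.
  apply: le_trans W1; rewrite cE -[j.+1%:R]natr1 (mulrDl j%:R) mul1r.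
  have [c0 c1] := andP c01.
  have := ler_wpM2l c0 H; rewrite mulrDr (mulrA c (_ ^+ a)).
  have : c * (C * sgj ^+ 3) <= C * sg ^+ 3.
    apply: (@le_trans _ _ (C * sgj ^+ 3)); last by rewrite ler_wpM2l.
    by rewrite ler_piMl// mulr_ge0// exprn_ge0.
  move: (c * (Qj j / Qj j.+1) ^+ a * bump (Qj j.+1) y) (c * walk h (bump (Qj j)) y).
  by move: (c * (C * sgj ^+ 3)) (C * sg ^+ 3) => *; lra.
have := step k z; have -> : Qj k = Q.
  by rewrite /Qj hE /D; field; rewrite gt_eqF.
apply: le_trans; rewrite lerD2l lerN2.
have -> : k%:R * (C * sg ^+ 3) = C * (D / Q0) * sg.
  by rewrite exprS sgE; field; rewrite !gt_eqF.
have P0 : 0 <= C * (D / Q0) * sg by apply: mulr_ge0 => //; apply: mulr_ge0 => //; exact: ltW.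
rewrite -(ler_pXn2r (n := 2)) ?nnegrE ?(ltW e0)//.
have B1 : (C * (D / Q0) / e) ^+ 2 * (D / Q0) <= k%:R.
  by move: kB; rewrite /B; lra.
rewrite exprMn sgE [X in X <= _](mulrA _ (D / Q0)) ler_pdivrMr//.
have -> : (C * (D / Q0)) ^+ 2 * (D / Q0) = e ^+ 2 * ((C * (D / Q0) / e) ^+ 2 * (D / Q0)).
  by field; rewrite !gt_eqF.
by rewrite ler_pM2l// exprn_gt0.
Qed.

(** Start the walk at [w]. The mean count in the small ball about its endpoint is at most [q],
    whereas a point of the large ball lies in that small ball with probability about
    [(Q0 / Q)^a d^p] or more. This replaces a comparison of volumes. *)
Lemma count_ball_growth (I : finType) (X : I -> 'rV[R]_n) (Q0 Q d q : R) :
  0 < Q0 -> Q0 < Q -> 0 <= d ->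
  (forall w, \sum_i (nsq (X i - w) <= Q0)%R%:R <= q) ->
  forall w, (Q0 / Q) ^+ a * d ^+ p * \sum_i (nsq (X i - w) <= (1 - d) * Q)%R%:R <= q.
Proof.
move=> Q00 QQ d0 Hq w; have Q1 : 0 < Q by lra.
have c0 : 0 <= (Q0 / Q) ^+ a by rewrite exprn_ge0// divr_ge0 ?ltW.
apply/ler_addgt0Pr => e e0.
(* One error per point, of total at most [e]; the walk depends on [e'], the conclusion does not. *)
pose e' := e / (#|I|.+1)%:R.
have e'0 : 0 < e' by rewrite divr_gt0.
have [h [k Hk]] := iter_walk_bump_ge Q00 QQ e'0.
have : \sum_i ((Q0 / Q) ^+ a * bump Q (w - X i) - e') <= q.
  apply: le_trans (ler_sum _ (fun i _ => Hk (w - X i))) _.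
  have -> : \sum_i iter k (walk h) (fun y => (nsq y <= Q0)%R%:R) (w - X i) =
    iter k (walk h) (fun y => \sum_i (nsq (X i - y) <= Q0)%R%:R) w.
    rewrite iter_walk_sum//; apply: eq_bigr => i _; rewrite iter_walk_translate.
    by congr (iter _ _ _ _); apply/funext => y; rewrite nsq_distC.
  rewrite -[leRHS](iter_walk_cst n_gt0 h k q w); exact: iter_walk_le.
rewrite sumrB sumr_const -[e' *+ _]mulr_natr.
have ee : e' * #|I|%:R <= e.
  rewrite /e' mulrAC ler_pdivrMr// ler_pM2l// ler_nat; exact: leqnSn.
suff : (Q0 / Q) ^+ a * d ^+ p * \sum_i (nsq (X i - w) <= (1 - d) * Q)%R%:R <=
    \sum_i (Q0 / Q) ^+ a * bump Q (w - X i).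
  move: (\sum_i (Q0 / Q) ^+ a * _) (_ * \sum_i _) => *; lra.
rewrite mulr_sumr; apply: ler_sum => i _.
rewrite -mulrA ler_wpM2l//; have [le1|_] := leP (nsq (X i - w)); last first.
  by rewrite mulr0 bump_ge0.
rewrite mulr1 /bump lerXn2r ?nnegrE ?le_max ?lexx ?orbT//.
by apply/orP; left; rewrite lerBrDl -lerBrDr ler_pdivrMr// nsq_distC.
Qed.

End HeatKernel.

(** * From counts in small balls to counts in large balls and to Gaussian sums *)

Section BallGrowth.
Variable R : realType.

Definition nball n (I : finType) (X : I -> 'rV[R]_n) (Q : R) (w : 'rV[R]_n) : R :=
  \sum_i (nsq (X i - w) <= Q)%R%:R.

(** For large [n] the exponent [a] of the heat kernel satisfies [a / n] close to [p / (2 (p - 1))],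
    hence close to the exponent 1/2 of a volume comparison once [p] is large. *)
Lemma nball_growth (Q0 Qmax om : R) : 0 < Q0 -> Q0 <= Qmax -> 0 < om ->
  exists n0 : nat, forall n, (n0 <= n)%N -> (0 < n)%N ->
  forall (I : finType) (X : I -> 'rV[R]_n) (q : R),
  (forall w, nball X Q0 w <= q) ->
  forall w Q, Q0 <= Q <= Qmax ->
  nball X Q w <= q * expR (n%:R * (om + ln (Q / Q0) / 2)).
Proof.
move=> Q00 Qm om0.
pose L := ln (Qmax / Q0).
have L0 : 0 <= L by rewrite ln_ge0// ler_pdivlMr// mul1r.
(* [m] bounds the cost of the excess of [a] over [n / 2], and [d] the cost of shrinking the ball by
   [1 - d]; each is at most [n * om / 4]. *)
pose m := Num.truncn (2 * L / om).
pose p := m.+3; pose d : R := Num.min (1 / 2) (om / 8).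
have d0 : 0 < d by rewrite lt_min; apply/andP; split; lra.
have d1 : d <= 1 / 2 by rewrite ge_min lexx.
have d2 : d <= om / 8 by rewrite ge_min lexx orbT.
have mL : L / (2 * m.+2%:R) <= om / 4.
  have : 2 * L / om < m.+1%:R by rewrite truncnS_gt.
  rewrite ltr_pdivrMr// => mL.
  have m2 : 0 < m.+2%:R :> R by [].
  rewrite ler_pdivrMr ?mulr_gt0//.
  have : m.+1%:R <= m.+2%:R :> R by rewrite ler_nat.
  nra.
(* All the costs that do not grow with [n]. *)
pose K := (p%:R ^+ 2 + 1) * (L + 1) + p%:R * - ln d.
pose n0 := (Num.truncn (4 * K / om)).+1.
exists n0 => n nn0 n_gt0 I X q Hq w Q /andP[Q0Q QQm].
have n1 : 1 <= n%:R :> R by rewrite ler1n.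
have Kn : K <= n%:R * om / 4.
  have : 4 * K / om < n%:R.
    by apply: lt_le_trans (_ : n0%:R <= _); [rewrite truncnS_gt|rewrite ler_nat].
  by rewrite ltr_pdivrMr//; lra.
have p2 : 1 <= p.-1%:R :> R by rewrite ler1n.
have pE : p%:R = p.-1%:R + 1 :> R by rewrite natr1.
(* With [A] in place of [a] the discriminant of the quadratic vanishes, so it becomes a square
   divided by [B]. *)
pose A : R := n%:R * p%:R / (2 * p.-1%:R) + p%:R * p.-1%:R / (2 * n%:R).
pose a := (Num.truncn A).+1.
have A0 : 0 <= A by rewrite addr_ge0// divr_ge0// mulr_ge0.
have Aa : A <= a%:R by rewrite ltW// truncnS_gt.
have aA : a%:R <= A + 1.
  by rewrite /a -natr1 lerD2r; have /andP[] := truncn_itv A0.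
have quad (g : R) : 0 <= g <= 1 ->
    0 <= (a + p)%:R * g ^+ 2 - 2 * p%:R * g + 2 * (p * p.-1)%:R / n%:R * (1 - g) :> R.
  move=> _; pose B : R := 2 * (p * p.-1)%:R / n%:R.
  have B0 : 0 < B by rewrite divr_gt0 ?mulr_gt0// ?ltr0n//; lra.
  have AE : A + p%:R = (p%:R + B / 2) ^+ 2 / B.
    rewrite /A /B natrM; field.
    by rewrite pnatr_eq0 -lt0n n_gt0 -[(p.-1)%:R]/(m.+2%:R) -[p%:R]/(m.+3%:R) !pnatr_eq0.
  have : (A + p%:R) * g ^+ 2 <= (a + p)%:R * g ^+ 2.
    by rewrite ler_wpM2r ?sqr_ge0// natrD lerD2r.
  have : 0 <= ((p%:R + B / 2) * g - B) ^+ 2 / B by rewrite divr_ge0 ?sqr_ge0 ?ltW.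
  have -> : ((p%:R + B / 2) * g - B) ^+ 2 / B = (A + p%:R) * g ^+ 2 - 2 * p%:R * g + B * (1 - g).
    by rewrite AE; field; rewrite gt_eqF.
  rewrite -/B; move: ((a + p)%:R * _) ((A + _) * _) => *; lra.
pose Q' := Q / (1 - d).
have d3 : 0 < 1 - d by lra.
have Q0' : 0 < Q by lra.
have Q'0 : Q0 < Q'.
  rewrite /Q' ltr_pdivlMr//; nra.
have := @count_ball_growth R n m a n_gt0 quad I X Q0 Q' d q Q00 Q'0 (ltW d0) Hq w.
have -> : (1 - d) * Q' = Q by rewrite /Q'; field; lra.
rewrite -/(nball X Q w) -/p.
have Q'p : 0 < Q' by lra.
pose c := (Q0 / Q') ^+ a * d ^+ p.
have c0 : 0 < c by rewrite mulr_gt0 ?exprn_gt0// divr_gt0.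
rewrite -/c => cq.
have q0 : 0 <= q.
  by apply: le_trans (Hq w); apply: sumr_ge0 => i _.
have -> : nball X Q w = c * nball X Q w / c by field; rewrite gt_eqF.
rewrite ler_pdivrMr//; apply: (le_trans cq).
rewrite -mulrA ler_peMr//.
have -> : c = expR (a%:R * ln (Q0 / Q') + p%:R * ln d).
  rewrite expRD !expRM_natl !lnK ?posrE// divr_gt0//.
rewrite -expRD -[leLHS]expR0 ler_expR.
have -> : ln (Q0 / Q') = - ln (Q / Q0) + ln (1 - d).
  rewrite /Q' !ln_div ?posrE ?divr_gt0//; ring.
have l1 : - (om / 4) <= ln (1 - d).
  apply: le_trans (ln_ge_1subV d3).
  have -> : 1 - (1 - d)^-1 = - d / (1 - d) by field; lra.
  rewrite ler_pdivlMr//; nra.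
have l2 : 0 <= ln (Q / Q0) <= L.
  rewrite ln_ge0 ?ler_pdivlMr ?mul1r//= ler_ln ?posrE ?divr_gt0 ?(lt_le_trans Q00)//.
  by rewrite ler_pM2r ?invr_gt0.
have l3 : ln (1 - d) <= 0 by rewrite ln_le0//; lra.
have l4 : ln d <= 0 by rewrite ln_le0//; lra.
set l := ln (Q / Q0) in l2 *; have [l20 l21] := andP l2.
have aU : a%:R <= n%:R / 2 + n%:R / (2 * p.-1%:R) + (p%:R ^+ 2 + 1) :> R.
  apply: (le_trans aA); rewrite /A.
  have -> : n%:R * p%:R / (2 * p.-1%:R) = n%:R / 2 + n%:R / (2 * p.-1%:R) :> R.
    by rewrite pE; field; lra.
  have : p%:R * p.-1%:R / (2 * n%:R) <= p%:R ^+ 2 :> R.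
    rewrite ler_pdivrMr; last by lra.
    by rewrite pE expr2; nra.
  lra.
have nn : n%:R / (2 * p.-1%:R) <= n%:R / 2 :> R.
  rewrite ler_wpM2l// lef_pV2 ?posrE; lra.
have a0 : 0 <= a%:R :> R by [].
have e1 : a%:R * l <= n%:R / 2 * l + n%:R * (om / 4) + (p%:R ^+ 2 + 1) * L.
  have : a%:R * l <= (n%:R / 2 + n%:R / (2 * p.-1%:R) + (p%:R ^+ 2 + 1)) * l by rewrite ler_wpM2r.
  have : n%:R / (2 * p.-1%:R) * l <= n%:R * (om / 4).
    apply: (@le_trans _ _ (n%:R * (L / (2 * p.-1%:R)))); last by rewrite ler_wpM2l.
    by rewrite mulrA [leRHS]mulrAC ler_wpM2l// divr_ge0//; lra.
  have : (p%:R ^+ 2 + 1) * l <= (p%:R ^+ 2 + 1) * L.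
    by rewrite ler_wpM2l//; have := sqr_ge0 (p%:R : R); lra.
  rewrite !mulrDl; lra.
have e2 : a%:R * - ln (1 - d) <= n%:R * (om / 4) + (p%:R ^+ 2 + 1).
  have dd : - ln (1 - d) <= 1.
    have := ln_ge_1subV d3; have : (1 - d)^-1 <= 2 by rewrite -[leLHS]mul1r ler_pdivrMr//; lra.
    lra.
  have : a%:R * - ln (1 - d) <= (n%:R + (p%:R ^+ 2 + 1)) * - ln (1 - d) by rewrite ler_wpM2r//; lra.
  have : n%:R * - ln (1 - d) <= n%:R * (om / 4) by rewrite ler_wpM2l//; lra.
  have : (p%:R ^+ 2 + 1) * - ln (1 - d) <= (p%:R ^+ 2 + 1).
    by rewrite ler_piMr//; have := sqr_ge0 (p%:R : R); lra.
  rewrite mulrDl; lra.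
move: Kn e1 e2; rewrite /K !mulrDr !mulrN mulr1.
move: (a%:R * l) (a%:R * ln (1 - d)) (p%:R * ln d) (_ * L) => *.
nra.
Qed.

Lemma geometric_scale (Q0 lam u : R) (N : nat) : 0 < Q0 -> 1 <= lam ->
  Q0 <= u -> u <= Q0 * lam ^+ N ->
  exists2 j : 'I_N.+1, u <= Q0 * lam ^+ j & Q0 * lam ^+ j <= lam * u.
Proof.
move=> Q00 l1 uQ; elim: N => [|N IH] uN.
  by exists ord0 => //; rewrite expr0 mulr1; nra.
have [/IH[j j1 j2]|uN'] := leP u (Q0 * lam ^+ N).
  by exists (widen_ord (leqnSn _) j).
by exists ord_max => //=; rewrite exprS mulrCA ler_wpM2l ?ltW//; lra.
Qed.

(** Sort the points into shells whose squared radii grow by the factor [lam]. By [1 - x <= - ln x]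
    the weight at squared distance [Q] is at most [(kap Q)^(-n/2)], which cancels the growth
    [(Q / Q0)^(n/2)] of the count; the number of shells does not depend on [n]. Below [Q0] the count
    no longer improves, so the weight is frozen there. *)
Lemma gauss_sum_le (Q0 om : R) : 0 < Q0 -> 0 < om ->
  exists n0 : nat, forall n, (n0 <= n)%N -> (0 < n)%N ->
  forall (I : finType) (X : I -> 'rV[R]_n) (q : R),
  (forall w, nball X Q0 w <= q) ->
  forall w (kap : R), 0 < kap -> (forall i, nsq (X i - w) <= 1) ->
  \sum_i expR (n%:R / 2 * (1 - kap * Num.max (nsq (X i - w)) Q0)) <=
  q * expR (n%:R * (om - ln kap / 2 - ln Q0 / 2)).
Proof.
move=> Q00 om0.
pose lam := expR (om / 2); have lam1 : 1 <= lam by rewrite -expR0 ler_expR; lra.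
have lam0 : 0 < lam by lra.
pose N := (Num.truncn (2 / (Q0 * om))).+1.
pose Qm := Q0 * lam ^+ N.
have lamN j : 1 <= lam ^+ j by rewrite exprn_ege1.
have Qm0 : Q0 <= Qm by rewrite /Qm ler_peMr// ltW.
have Qm1 : 1 <= Qm.
  have : 2 / (Q0 * om) < N%:R by rewrite truncnS_gt.
  rewrite ltr_pdivrMr ?mulr_gt0// => h.
  have : 1 + N%:R * (om / 2) <= lam ^+ N by rewrite /lam -expRM_natl expR_ge1Dx.
  rewrite /Qm; nra.
have om4 : 0 < om / 4 by lra.
have [n1 H1] := nball_growth Q00 Qm0 om4.
pose n2 := (Num.truncn (4 * ln (N.+1%:R) / om)).+1.
exists (maxn n1 n2) => n; rewrite geq_max => /andP[nn1 nn2] n_gt0 I X q Hq w kap kap0 X1.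
have n0 : 0 < n%:R :> R by rewrite ltr0n.
have lnN : ln (N.+1%:R) <= n%:R * (om / 4).
  have : 4 * ln (N.+1%:R) / om < n%:R :> R.
    by apply: lt_le_trans (_ : n2%:R <= _); [rewrite truncnS_gt|rewrite ler_nat].
  by rewrite ltr_pdivrMr//; lra.
pose Rj (j : nat) := Q0 * lam ^+ j.
have Rj0 j : 0 < Rj j by rewrite mulr_gt0// exprn_gt0.
pose E (j : nat) := expR (- (n%:R / 2) * ln (kap * Rj j / lam)).
have q0 : 0 <= q by apply: le_trans (Hq w); apply: sumr_ge0.
apply: (@le_trans _ _ (\sum_i \sum_(j < N.+1) (nsq (X i - w) <= Rj j)%R%:R * E j)).
  apply: ler_sum => i _; set u := Num.max _ _.
  have uQ : Q0 <= u by rewrite le_max lexx orbT.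
  have uN : u <= Q0 * lam ^+ N by rewrite ge_max Qm0 andbT (le_trans (X1 i)).
  have [j j1 j2] := geometric_scale Q00 lam1 uQ uN.
  rewrite (bigD1 j)//= -[leLHS]addr0; apply: lerD; last first.
    by apply: sumr_ge0 => k _; rewrite mulr_ge0// expR_ge0.
  have -> : (nsq (X i - w) <= Rj j) = true.
    by apply/idP; apply: le_trans j1; rewrite le_max lexx.
  rewrite mul1r ler_expR mulNr -mulrN ler_wpM2l ?divr_ge0 ?(ltW n0)//.
  have u0 : 0 < u by exact: lt_le_trans uQ.
  have : ln (kap * Rj j / lam) <= ln (kap * u).
    have k1 : 0 < kap * Rj j / lam by apply: divr_gt0 => //; exact: mulr_gt0.
    rewrite ler_ln ?posrE//; last exact: mulr_gt0.
    by rewrite ler_pdivrMr// -mulrA ler_pM2l// (mulrC u).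
  have := ln_le_subr1 (mulr_gt0 kap0 u0); lra.
rewrite exchange_big/=.
apply: (@le_trans _ _ (\sum_(j < N.+1) q * expR (n%:R * (om / 2 - ln kap / 2 - ln Q0 / 2)))).
  apply: ler_sum => j _; rewrite -mulr_suml -/(nball X (Rj j) w).
  have Rjb : Q0 <= Rj j <= Qm.
    rewrite /Rj /Qm ler_peMr ?(ltW Q00)//= ler_pM2l// ler_weXn2l//.
    by rewrite -ltnS.
  have := H1 n nn1 n_gt0 I X q Hq w (Rj j) Rjb.
  move/(ler_wpM2r (expR_ge0 (- (n%:R / 2) * ln (kap * Rj j / lam)))) => /le_trans; apply.
  rewrite -(mulrA q) ler_wpM2l// -expRD ler_expR.
  have kR : 0 < kap * Rj j by exact: mulr_gt0.
  have -> : ln (Rj j / Q0) = ln (Rj j) - ln Q0 by rewrite ln_div ?posrE.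
  have -> : ln (kap * Rj j / lam) = ln kap + ln (Rj j) - om / 2.
    by rewrite ln_div ?posrE// lnM ?posrE// /lam expRK.
  by rewrite le_eqVlt; apply/orP; left; apply/eqP; field.
rewrite sumr_const card_ord -[_ *+ N.+1]mulr_natl.
have -> : N.+1%:R = expR (ln N.+1%:R) :> R by rewrite lnK ?posrE.
rewrite mulrCA ler_wpM2l// -expRD ler_expR.
have : 0 < n%:R * om by rewrite mulr_gt0.
lra.
Qed.

End BallGrowth.

(** * Relative entropy of the tilts and their mass near the mean *)

Lemma sqr_combination_le (R : realType) (z x y : R) : 1 <= z ->
  (z * x - (z + 1) * y) ^+ 2 <= 2 * z ^+ 2 * x ^+ 2 + 8 * z ^+ 2 * y ^+ 2.
Proof.
move=> z1; have : (z + 1) ^+ 2 <= 4 * z ^+ 2 by rewrite !expr2; nra.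
have := sqr_ge0 (z * x + (z + 1) * y); have := sqr_ge0 y.
by rewrite !expr2; nra.
Qed.

Section Entropy.
Variables (R : realType) (n : nat) (I : finType) (X : I -> 'rV[R]_n).
Hypothesis n_gt0 : (0 < n)%N.
Hypothesis I_gt0 : (0 < #|I|)%N.
Hypothesis X_le1 : forall i, nsq (X i) <= 1.
Hypothesis X_diam : forall i j, nsq (X i - X j) <= 1.
Implicit Types (v w : 'rV[R]_n).

Let n0 : 0 < n%:R :> R. Proof. by rewrite ltr0n. Qed.
Let c0 : 0 < #|I|%:R :> R. Proof. by rewrite ltr0n. Qed.

(** The price of truncating the Gaussian weight at [Q0]. *)
Definition near (Q0 : R) v : R := \sum_i gibbs X v i * (nsq (X i - gmean X v) < Q0)%R%:R.

Lemma gibbsE v i : gibbs X v i = expR (n%:R * (dot v (X i) - flam X v)) / #|I|%:R.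
Proof.
have Z0 := partf_gt0 X I_gt0 v.
rewrite mulrBr expRB /gibbs [n%:R * flam X v]mulrC divfK ?gt_eqF//.
rewrite expRB !lnK ?posrE//; field.
by rewrite !gt_eqF.
Qed.

Lemma near_ge0 Q0 v : 0 <= near Q0 v.
Proof. by apply: sumr_ge0 => i _; rewrite mulr_ge0// gibbs_ge0. Qed.

Lemma near_le1 Q0 v : near Q0 v <= 1.
Proof.
rewrite -(gibbs_sum X I_gt0 v); apply: ler_sum => i _.
by rewrite ler_piMr ?gibbs_ge0// lern1 leq_b1.
Qed.

(* Gibbs' variational principle against the Gaussian weight centred at the mean. *)
Lemma entropy_var_ge (Q0 J kap c : R) v : 0 < Q0 -> 0 < kap ->
  \sum_i expR (n%:R / 2 * (1 - kap * Num.max (nsq (X i - gmean X v)) Q0)) <=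
    #|I|%:R * expR (- (n%:R * J)) * expR (n%:R * c) ->
  1 / 2 + J - c <=
  dot v (gmean X v) - flam X v + kap / 2 * (gvar X v + Q0 * near Q0 v).
Proof.
move=> Q00 kap0 H.
pose u i := Num.max (nsq (X i - gmean X v)) Q0.
pose a i := n%:R / 2 * (1 - kap * u i) - n%:R * (dot v (X i) - flam X v).
have J1 := jensen_expR (gibbs_ge0 X I_gt0 v) (gibbs_sum X I_gt0 v) a.
have E1 : \sum_i gibbs X v i * expR (a i) =
    (\sum_i expR (n%:R / 2 * (1 - kap * u i))) / #|I|%:R.
  rewrite mulr_suml; apply: eq_bigr => i _; rewrite gibbsE /a expRB.
  by field; rewrite !gt_eqF// expR_gt0.
have E2 : \sum_i gibbs X v i * a i = n%:R / 2 * (1 - kap * \sum_i gibbs X v i * u i)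
    - n%:R * (dot v (gmean X v) - flam X v).
  have S1 : \sum_i gibbs X v i * (n%:R / 2 + n%:R * flam X v) = n%:R / 2 + n%:R * flam X v.
    exact: mean_cst (gibbs_sum X I_gt0 v) _.
  rewrite dot_gmean.
  transitivity (n%:R / 2 + n%:R * flam X v - n%:R / 2 * kap * (\sum_i gibbs X v i * u i)
     - n%:R * (\sum_i gibbs X v i * dot v (X i))); last by ring.
  rewrite -S1 !mulr_sumr -!sumrB; apply: eq_bigr => i _; rewrite /a; ring.
rewrite E1 E2 in J1.
have : expR (n%:R / 2 * (1 - kap * \sum_i gibbs X v i * u i)
    - n%:R * (dot v (gmean X v) - flam X v)) <= expR (- (n%:R * J) + n%:R * c).
  apply: (le_trans J1); rewrite ler_pdivrMr// expRD.
  by apply: (le_trans H); rewrite le_eqVlt; apply/orP; left; apply/eqP; ring.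
rewrite ler_expR.
have U : \sum_i gibbs X v i * u i <= gvar X v + Q0 * near Q0 v.
  rewrite /gvar /near mulr_sumr -big_split/=; apply: ler_sum => i _.
  rewrite mulrCA -mulrDr ler_wpM2l ?gibbs_ge0// ge_max.
  have := nsq_ge0 (X i - gmean X v); have [q|q] := ltP (nsq (X i - gmean X v)) Q0.
    by rewrite mulr1 => ?; apply/andP; split; lra.
  by rewrite mulr0 addr0 lexx q.
have := ler_wpM2l (ltW kap0) U.
move: (\sum_i _ * u i) (gvar X v + _) (dot v _) (flam X v) => S V d f kS.
have -> : n%:R / 2 * (1 - kap * S) - n%:R * (d - f) = n%:R * ((1 - kap * S) / 2 - (d - f)) by ring.
have -> : - (n%:R * J) + n%:R * c = n%:R * (c - J) by ring.
rewrite ler_pM2l//; lra.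
Qed.

Section Scaled.
Variable d : R.
Hypothesis d_gt0 : 0 < d.

(** The Renyi divergence of order [1 + d] of the tilted measure from the uniform one, divided by
    [n]. *)
Definition tiltrate v : R := (flam X ((1 + d) *: v) - flam X v) / d - flam X v.

(** Split the ball by the density against the uniform measure. The points of density below
    [exp (n (J - e))] are few and carry mass at most [exp (- n e)]; the others are handled by
    Chernoff's bound with exponent [d]. *)
Lemma near_le (Q0 J e : R) v :
  nball X Q0 (gmean X v) <= #|I|%:R * expR (- (n%:R * J)) ->
  near Q0 v <= expR (n%:R * d * (tiltrate v - J + e)) + expR (- (n%:R * e)).
Proof.
move=> H.
pose io i := dot v (X i) - flam X v.
apply: (@le_trans _ _ (\sum_i (gibbs X v i * expR (n%:R * d * (io i - J + e)) +
    (nsq (X i - gmean X v) <= Q0)%R%:R * (expR (n%:R * (J - e)) / #|I|%:R)))).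
  apply: ler_sum => i _.
  have g0 := gibbs_ge0 X I_gt0 v i.
  have [q|q] := ltP (nsq (X i - gmean X v)) Q0; last first.
    rewrite mulr0; apply: addr_ge0; first by rewrite mulr_ge0 ?expR_ge0.
    by apply: mulr_ge0 => //; rewrite divr_ge0 ?expR_ge0.
  rewrite (ltW q) mulr1 mul1r.
  have [iJ|iJ] := leP (J - e) (io i).
    rewrite -[leLHS]addr0; apply: lerD; last by rewrite divr_ge0 ?expR_ge0.
    rewrite ler_peMr// -[leLHS]expR0 ler_expR mulr_ge0 ?mulr_ge0 ?(ltW d_gt0)//; lra.
  rewrite -[leLHS]add0r; apply: lerD; first by rewrite mulr_ge0 ?expR_ge0.
  by rewrite gibbsE ler_pM2r ?invr_gt0// ler_expR ler_pM2l// ltW.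
rewrite big_split/=; apply: lerD.
  have E : gmgf X v (d *: v) = expR (n%:R * (flam X ((1 + d) *: v) - flam X v)).
    rewrite scalerDl scale1r flamD// addrAC subrr add0r mulrC divfK ?gt_eqF//.
    by rewrite lnK// posrE gmgf_gt0.
  rewrite le_eqVlt; apply/orP; left; apply/eqP.
  transitivity (gmgf X v (d *: v) * expR (- (n%:R * d * (flam X v + J - e)))).
    rewrite /gmgf mulr_suml; apply: eq_bigr => i _.
    rewrite -[RHS]mulrA -expRD; congr (_ * expR _); rewrite dotZl /io; ring.
  rewrite E -expRD; congr expR; rewrite /tiltrate; field; by rewrite gt_eqF.
rewrite -mulr_suml -/(nball X Q0 (gmean X v)).
have P : 0 <= expR (n%:R * (J - e)) / #|I|%:R by rewrite divr_ge0 ?expR_ge0.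
apply: (le_trans (ler_wpM2r P H)).
rewrite le_eqVlt; apply/orP; left; apply/eqP.
have -> : - (n%:R * e) = - (n%:R * J) + n%:R * (J - e) by ring.
by rewrite expRD; field; rewrite gt_eqF.
Qed.

End Scaled.

Notation W h k := (iter k (walk h)).

(** The gradient of [flam] is [gmean], of norm at most 1, so the Poincare inequality makes the free
    energy concentrate as [n] grows. *)
Lemma variance_flam_scale (h c : R) k v : 0 < h -> 0 < c -> c <= 2 ->
  n%:R * h <= 1 / 8 -> 128 * n%:R ^+ 3 * h ^+ 2 <= 1 ->
  W h k (fun w => flam X (c *: w) ^+ 2) v - W h k (fun w => flam X (c *: w)) v ^+ 2 <=
  k%:R * h ^+ 2 * (9 / n%:R).
Proof.
move=> h0 cp c2 nh nh3.
have nch : n%:R * (c * h) <= 1 / 4 by nra.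
have nch0 : 0 <= n%:R * (c * h) by rewrite !mulr_ge0// ltW.
pose G (j : 'I_n) w : R := c * gmean X (c *: w) ord0 j.
have Xc i (j : 'I_n) : `|X i ord0 j| <= 1.
  rewrite -sqrtr_sqr -[leRHS]sqrtr1 ler_wsqrtr//.
  exact: le_trans (coord_sq_le_nsq _ _) (X_le1 i).
have key w j (s : R) : s = 1 \/ s = -1 ->
    `|flam X (c *: (w + s * h *: ebase j)) - flam X (c *: w) - s * h * G j w| <= 8 * n%:R * h ^+ 2.
  move=> sP; rewrite scalerDr scalerA.
  have sn : `|s| = 1 by case: sP => ->; rewrite ?normrN normr1.
  have cv := flam_convex X n_gt0 I_gt0 (c *: w) ((c * (s * h)) *: ebase j).
  have th i : `|n%:R * dot ((c * (s * h)) *: ebase j) (X i)| <= n%:R * (c * h).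
    rewrite dotZl dot_ebase !normrM sn mul1r (ger0_norm (ltW n0)) (ger0_norm (ltW cp)) (ger0_norm (ltW h0)).
    rewrite ler_wpM2l ?(ltW n0)// ler_piMr// mulr_ge0 ?ltW//.
  have sm := flam_smooth n_gt0 I_gt0 (c *: w) th nch.
  have dE : dot ((c * (s * h)) *: ebase j) (gmean X (c *: w)) = s * h * G j w.
    by rewrite dotZl dot_ebase /G; ring.
  rewrite dE in cv sm.
  have b : 2 * (n%:R * (c * h)) ^+ 2 / n%:R <= 8 * n%:R * h ^+ 2.
    have -> : 2 * (n%:R * (c * h)) ^+ 2 / n%:R = 2 * c ^+ 2 * (n%:R * h ^+ 2).
      by field; rewrite gt_eqF.
    have : c ^+ 2 <= 4 by rewrite expr2; nra.
    have : 0 <= n%:R * h ^+ 2 by rewrite mulr_ge0 ?sqr_ge0 ?ltW.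
    by rewrite -[8 * _ * _]mulrA; nra.
  rewrite ger0_norm; last by move: cv; move: (flam _ _) (flam _ _) => ? ?; lra.
  move: sm; move: (flam _ _) (flam _ _) => ? ?; lra.
have H := @iter_walk_variance_le R n n_gt0 h k G (fun w => flam X (c *: w)) (8 * n%:R * h ^+ 2) 4 v.
apply: le_trans (H _ _ _) _.
- by move=> w j; have := key w j 1 (or_introl erefl); rewrite !mul1r.
- by move=> w j; have := key w j (-1) (or_intror erefl); rewrite !mulN1r !mulNr opprK scaleNr.
- move=> w; rewrite /G; under eq_bigr do rewrite exprMn.
  rewrite -mulr_sumr -nsqE.
  have := nsq_gmean_le1 I_gt0 X_le1 (c *: w); have := nsq_ge0 (gmean X (c *: w)).
  have : c ^+ 2 <= 4 by rewrite expr2; nra.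
  by have := sqr_ge0 c; move: (c ^+ 2) (nsq _) => C N; nra.
rewrite -[leRHS]mulrA ler_wpM2l//.
have -> : 2 * h ^+ 2 * 4 / n%:R + 2 * (8 * n%:R * h ^+ 2) ^+ 2 =
  h ^+ 2 * ((8 + (128 * n%:R ^+ 3 * h ^+ 2)) / n%:R) by field; rewrite gt_eqF.
rewrite ler_wpM2l ?sqr_ge0// ler_pM2r ?invr_gt0//; lra.
Qed.

Lemma iter_walk_centered (h : R) k (f : 'rV[R]_n -> R) v :
  W h k (fun w => (f w - W h k f v) ^+ 2) v = W h k (fun w => f w ^+ 2) v - W h k f v ^+ 2.
Proof.
set m := W h k f v.
have -> : (fun w => (f w - m) ^+ 2) = (fun w => 1 * (1 * f w ^+ 2 + (- 2 * m) * f w) + m ^+ 2 * 1).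
  by apply/funext => w; ring.
rewrite (iter_walk_lin h k 1 _ _ (fun=> 1)) iter_walk_lin iter_walk_cst// -/m; ring.
Qed.

Lemma variance_tiltrate (d h : R) k : 0 < d -> d <= 1 -> 0 < h ->
  n%:R * h <= 1 / 8 -> 128 * n%:R ^+ 3 * h ^+ 2 <= 1 ->
  W h k (fun w => (tiltrate d w - W h k (tiltrate d) 0) ^+ 2) 0 <=
  90 * (k%:R * h ^+ 2) / (d ^+ 2 * n%:R).
Proof.
move=> d0 d1 h0 nh nh3.
pose f w := flam X ((1 + d) *: w); pose g w := flam X (1 *: w).
have Vf : W h k (fun w => (f w - W h k f 0) ^+ 2) 0 <= k%:R * h ^+ 2 * (9 / n%:R).
  by rewrite iter_walk_centered; apply: variance_flam_scale => //; lra.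
have Vg : W h k (fun w => (g w - W h k g 0) ^+ 2) 0 <= k%:R * h ^+ 2 * (9 / n%:R).
  by rewrite iter_walk_centered; apply: variance_flam_scale => //; lra.
have TE : tiltrate d = (fun w => d^-1 * f w + - (d^-1 + 1) * g w).
  by apply/funext => w; rewrite /tiltrate /f /g scale1r; ring.
have mE : W h k (tiltrate d) 0 = d^-1 * W h k f 0 + - (d^-1 + 1) * W h k g 0.
  by rewrite TE iter_walk_lin.
have i1 : 1 <= d^-1 by rewrite invf_ge1.
apply: (@le_trans _ _ (W h k (fun w => 2 * d ^- 2 * (f w - W h k f 0) ^+ 2 +
    8 * d ^- 2 * (g w - W h k g 0) ^+ 2) 0)).
  apply: iter_walk_le => // w; rewrite mE TE.
  set x := f w - _; set y := g w - _.
  have -> : d^-1 * f w + - (d^-1 + 1) * g w - (d^-1 * W h k f 0 + - (d^-1 + 1) * W h k g 0)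
    = d^-1 * x - (d^-1 + 1) * y by rewrite /x /y; ring.
  rewrite -exprVn; move: (d^-1) i1 => z z1.
  exact: sqr_combination_le.
rewrite iter_walk_lin.
have i2 : 0 <= d ^- 2 by rewrite invr_ge0 sqr_ge0.
have := ler_wpM2l i2 Vf; have := ler_wpM2l i2 Vg.
move: (W h k _ 0) (W h k _ 0) => A B.
have -> : 90 * (k%:R * h ^+ 2) / (d ^+ 2 * n%:R) = 10 * (d ^- 2 * (k%:R * h ^+ 2 * (9 / n%:R))).
  by field; rewrite !gt_eqF.
move: (d ^- 2 * (k%:R * _ * _)) => C; rewrite -!mulrA => ? ?; lra.
Qed.

(** Chebyshev's inequality: either [tiltrate] is at most [J - 2 * e] and both exponentials of
    [near_le] are small, or it deviates from its mean by at least [e] and the trivial bound 1 is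
    charged to the variance. *)
Lemma mean_near_le (Q0 J e d h : R) k :
  (forall w, nball X Q0 w <= #|I|%:R * expR (- (n%:R * J))) ->
  0 < d -> d <= 1 -> 0 < h -> 0 < e ->
  n%:R * h <= 1 / 8 -> 128 * n%:R ^+ 3 * h ^+ 2 <= 1 ->
  W h k (tiltrate d) 0 <= J - 3 * e ->
  W h k (near Q0) 0 <= 90 * (k%:R * h ^+ 2) / (d ^+ 2 * n%:R) / e ^+ 2 + 2 * expR (- (n%:R * (d * e))).
Proof.
move=> H d0 d1 h0 e0 nh nh3 mu.
set m := W h k (tiltrate d) 0 in mu.
have e2 : 0 < e ^+ 2 by rewrite exprn_gt0.
apply: (@le_trans _ _ (W h k (fun w => (e ^+ 2)^-1 * (tiltrate d w - m) ^+ 2 +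
    2 * expR (- (n%:R * (d * e))) * 1) 0)); last first.
  rewrite iter_walk_lin iter_walk_cst// mulr1 lerD2r mulrC ler_wpM2r ?invr_ge0 ?(ltW e2)//.
  exact: variance_tiltrate.
apply: iter_walk_le => // w.
have E0 := expR_ge0 (- (n%:R * (d * e))).
have [le2|gt2] := leP (tiltrate d w) (J - 2 * e).
  apply: (le_trans (near_le d0 e (H (gmean X w)))).
  have ex1 : expR (n%:R * d * (tiltrate d w - J + e)) <= expR (- (n%:R * (d * e))).
    rewrite ler_expR mulrA -mulrN ler_wpM2l//; first by rewrite mulr_ge0 ?ltW.
    by move: (tiltrate d w) le2 => ? ?; lra.
  have ex2 : expR (- (n%:R * e)) <= expR (- (n%:R * (d * e))).
    by rewrite ler_expR lerN2 ler_wpM2l ?(ltW n0)// ler_piMl// ltW.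
  have : 0 <= (e ^+ 2)^-1 * (tiltrate d w - m) ^+ 2 by rewrite mulr_ge0 ?sqr_ge0// invr_ge0 ltW.
  move: ex1 ex2; move: (expR _) (expR _) (expR _) (_ * _ ^+ 2) => *; lra.
apply: (le_trans (near_le1 Q0 w)).
have : 1 <= (e ^+ 2)^-1 * (tiltrate d w - m) ^+ 2.
  rewrite mulrC ler_pdivlMr// mul1r lerXn2r ?nnegrE ?(ltW e0)//;
    by move: (tiltrate d w) gt2 => ? ?; lra.
move: (_ * _ ^+ 2) => *; lra.
Qed.

(** The mean of [dot v (gmean ((1 + d) v))] along the walk of step [h], written with longer steps so
    that the facts about [menergy] apply. *)
Definition menergy_tilt (d h : R) k : R := menergy X ((1 + d) * h) k / (1 + d).

(** By convexity the difference quotient in [tiltrate] is at most the derivative of the free energy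
    at the far end [(1 + d) w]. *)
Lemma mean_tiltrate_le (d h : R) k : 0 < d ->
  W h k (tiltrate d) 0 <= menergy_tilt d h k - mflam X h k.
Proof.
move=> d0.
have -> : menergy_tilt d h k = W h k (fun w => dot w (gmean X ((1 + d) *: w))) 0.
  rewrite /menergy_tilt /menergy.
  have := iter_walk_scale h k (1 + d) (fun v => dot v (gmean X v)) 0; rewrite scaler0 => <-.
  under eq_fun do rewrite dotZl.
  rewrite iter_walkZ; field; lra.
rewrite /mflam -iter_walkB; apply: iter_walk_le => // w.
rewrite /tiltrate lerD2r ler_pdivrMr//.
have := flam_convex X n_gt0 I_gt0 ((1 + d) *: w) (- (d *: w)).
have -> : (1 + d) *: w - d *: w = w by rewrite -scalerBl addrK scale1r.
rewrite dotNl dotZl; move: (flam _ _) (flam _ _) (dot _ _) => *; lra.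
Qed.

End Entropy.

(** * The comparison sphere *)

Section Reference.
Variables (R : realType) (s2 : R).
Hypothesis s2_gt0 : 0 < s2.

(* The free energy of the uniform measure on the sphere of squared radius [s2],
   parametrised by the root [y] of [y (1 + y) = s2 t]. *)
Definition yref (t : R) : R := (Num.sqrt (1 + 4 * s2 * t) - 1) / 2.
Definition Lref (t : R) : R := yref t - ln (1 + yref t) / 2.

Lemma yrefE (t : R) : 0 <= t -> yref t * (1 + yref t) = s2 * t.
Proof.
move=> t0; have s0 := mulr_ge0 (ltW s2_gt0) t0.
have : Num.sqrt (1 + 4 * s2 * t) ^+ 2 = 1 + 4 * s2 * t by rewrite sqr_sqrtr//; lra.
rewrite /yref; move: (Num.sqrt _) => z; rewrite expr2 => h; nra.
Qed.

Lemma yref_ge0 (t : R) : 0 <= t -> 0 <= yref t.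
Proof.
move=> t0; have s0 := mulr_ge0 (ltW s2_gt0) t0.
rewrite /yref divr_ge0// subr_ge0 -[leLHS]sqrtr1 ler_wsqrtr//; lra.
Qed.

Lemma yref_le (t t' : R) : t <= t' -> yref t <= yref t'.
Proof.
move=> tt; rewrite /yref ler_pM2r// lerB// ler_wsqrtr// lerD2l ler_wpM2l//.
by rewrite mulr_ge0// ltW.
Qed.

Lemma yref_uniq (t y : R) : 0 <= y -> y * (1 + y) = s2 * t -> yref t = y.
Proof.
move=> y0 yE; rewrite /yref.
have -> : 1 + 4 * s2 * t = (1 + 2 * y) ^+ 2 by rewrite -mulrA -yE; ring.
by rewrite sqrtr_sqr ger0_norm; [field|lra].
Qed.

Lemma Lref0 : Lref 0 = 0.
Proof. by rewrite /Lref (yref_uniq (y := 0)) ?addr0 ?ln1 ?mul0r ?subrr// mulr0. Qed.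

Lemma Lref_ge0 (t : R) : 0 <= t -> 0 <= Lref t.
Proof.
move=> t0; have y0 := yref_ge0 t0; rewrite /Lref.
have : ln (1 + yref t) <= yref t by apply: le_ln1Dx; lra.
lra.
Qed.

(** The sphere has variance [s2 / (1 + yref t)], which is twice the slope of [Lref] and decreases;
    so an Euler step overestimates. *)
Lemma Lref_step (t x : R) : 0 <= t -> 0 <= x ->
  Lref (t + x) <= Lref t + x / 2 * (s2 / (1 + yref t)).
Proof.
move=> t0 x0; have tx : 0 <= t + x by lra.
have e1 := yrefE t0; have e2 := yrefE tx.
have y0 := yref_ge0 t0; have yy : yref t <= yref (t + x) by apply: yref_le; lra.
rewrite /Lref; move: (yref t) (yref (t + x)) e1 e2 y0 yy => y z e1 e2 y0 yz.
have y1 : 0 < 1 + y by lra.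
have z1 : 0 < 1 + z by lra.
have lg : 1 - (1 + y) / (1 + z) <= ln (1 + z) - ln (1 + y).
  rewrite -ln_div ?posrE//; have := ln_ge_1subV (divr_gt0 z1 y1).
  by rewrite invf_div.
have xs : x * s2 = (z - y) * (1 + y + z) by nra.
have -> : x / 2 * (s2 / (1 + y)) = (z - y) * (1 + y + z) / (2 * (1 + y)).
  by rewrite -xs; field; lra.
have -> : (z - y) * (1 + y + z) / (2 * (1 + y)) = (z - y) / 2 + (z - y) * z / (2 * (1 + y)).
  by field; lra.
have e3 : 1 - (1 + y) / (1 + z) = (z - y) / (1 + z) by field; lra.
rewrite e3 in lg.
have : (z - y) - (z - y) / (1 + z) / 2 = (z - y) / 2 + (z - y) * z / (2 * (1 + z)).
  by field; lra.
have : (z - y) * z / (2 * (1 + z)) <= (z - y) * z / (2 * (1 + y)).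
  rewrite ler_wpM2l ?mulr_ge0//; try lra.
  by rewrite lef_pV2 ?posrE//; lra.
lra.
Qed.

Variable r2 : R.
Hypothesis r2_gt0 : 0 < r2.
Hypothesis rs : r2 < s2.
Let y1 := s2 / r2 - 1.
(** The time at which the variance of the sphere has dropped to [r2], that is
    [1 + yref = s2 / r2]. *)
Definition t1ref : R := (s2 / r2 - 1) / r2.
(** [exp (- n Jref)] is [(r/s)^n]; [Jref] is also the relative entropy [ln (1 + yref) / 2] of the
    sphere at [t1ref]. *)
Definition Jref : R := ln (s2 / r2) / 2.

Let y1_gt0 : 0 < y1.
Proof. by rewrite subr_gt0 ltr_pdivlMr// mul1r. Qed.

Lemma yref_t1 : yref t1ref = s2 / r2 - 1.
Proof.
apply: yref_uniq; first exact: ltW.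
by rewrite /t1ref; field; rewrite gt_eqF.
Qed.

Lemma t1ref_gt0 : 0 < t1ref. Proof. exact: divr_gt0. Qed.

Lemma Jref_gt0 : 0 < Jref.
Proof. by rewrite divr_gt0// ln_gt0// ltr_pdivlMr// mul1r. Qed.

(** Equality holds at [t1ref], where [Jref + Lref = y1]; before it, a tangent bound for the
    logarithm suffices. The lemma says that an energy as large as [Jref + Lref] would break the
    diameter bound when [4 * s2 - 2 * r2 > 1]. *)
Lemma Lref_quad (t : R) : 0 <= t -> t <= t1ref ->
  (4 * s2 - 2 * r2) * t <= 4 * (Jref + Lref t) ^+ 2 + 2 * (Jref + Lref t).
Proof.
move=> t0 tt; have e := yrefE t0; have y0 := yref_ge0 t0.
have := yref_le tt; rewrite yref_t1 /Lref /Jref -/y1.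
move: (yref t) e y0 => y e y0 yy1.
have y11 : 0 < 1 + y1 by have := y1_gt0; lra.
have sE : s2 / r2 = 1 + y1 by rewrite /y1; ring.
have s2E : s2 = (1 + y1) * r2 by rewrite -sE; field; rewrite gt_eqF.
have y2 : 0 < 1 + y by lra.
have lg : 1 - (1 + y) / (1 + y1) <= ln (1 + y1) - ln (1 + y).
  rewrite -ln_div ?posrE//; have := ln_ge_1subV (divr_gt0 y11 y2).
  by rewrite invf_div.
rewrite sE; set Y := ln (1 + y1) / 2 + _.
have Yge : y + (y1 - y) / (2 * (1 + y1)) <= Y.
  have -> : (y1 - y) / (2 * (1 + y1)) = (1 - (1 + y) / (1 + y1)) / 2 by field; lra.
  rewrite /Y; lra.
pose D := (y1 - y) / (2 * (1 + y1)).
have D0 : 0 <= D by rewrite divr_ge0//; lra.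
have Dsq : y ^+ 2 + 2 * y * D <= Y ^+ 2.
  rewrite -/D in Yge; have := sqr_ge0 D; rewrite !expr2; nra.
have tr : t * r2 = y * (1 + y) / (1 + y1) by rewrite e s2E; field; lra.
have e1 : y ^+ 2 + 2 * y * D = t * r2 * y1.
  by rewrite tr /D; field; lra.
have e2 : t * r2 <= Y.
  rewrite tr; apply: le_trans Yge; rewrite -/D.
  suff : y * (1 + y) / (1 + y1) <= y by lra.
  by rewrite ler_pdivrMr//; nra.
have -> : (4 * s2 - 2 * r2) * t = 4 * (t * r2 * y1) + 2 * (t * r2) by rewrite s2E; ring.
rewrite -e1; lra.
Qed.

End Reference.

(** * The discrete Gronwall argument *)

Section SequenceContradiction.
(** The means are abstracted to sequences: [L] free energy, [V] variance, [M] energy, [N] mass near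
    the mean, [X] energy of the enlarged tilt. [z] bounds the discretisation errors, [om] those of
    the entropy inequality, and [d] is the slack in [4 * s2 - 2 * r2 > 1]. *)
Variables (R : realType) (r2 s2 d e om z h : R) (K : nat) (L V M N X : nat -> R).
Hypotheses (r2_gt0 : 0 < r2) (rs : r2 < s2).
Let s2_gt0 : 0 < s2. Proof. exact: lt_trans rs. Qed.
Notation t1 := (t1ref s2 r2).
Notation J := (Jref s2 r2).
Let G := expR (s2 * t1).
Hypotheses (d_gt0 : 0 < d) (d_lt1 : d < 1) (e_gt0 : 0 < e) (om_gt0 : 0 < om).
Hypothesis d_gam : 1 + d <= (1 - d) ^+ 2 * (4 * s2 - 2 * r2).
Hypothesis eJ : 3 * e + 2 * om * G <= d * J.
Hypothesis omt : 4 * om * G <= d * t1 * r2.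
Hypotheses (z_ge0 : 0 <= z) (zd : z < d) (zr : z <= d * r2 / 2) (zt : z * t1 <= om / 4).
Hypotheses (h_gt0 : 0 < h) (Kh : K%:R * h ^+ 2 = t1).
Hypothesis H0 : L 0%N = 0.
Hypothesis H1 : forall k, (k < K)%N -> L k + h ^+ 2 / 2 * V k - z * h ^+ 2 <= L k.+1.
Hypothesis H2 : forall k, `|M k - k%:R * h ^+ 2 * V k| <= k%:R * h ^+ 2 * z.
Hypothesis H3 : 0 < M K -> 4 * M K ^+ 2 <= K%:R * h ^+ 2 * (1 - 2 * V K).
Hypothesis H4 : forall k (kap : R), 0 < kap -> kap * r2 <= 1 ->
  1 / 2 + ln (kap * s2) / 2 - om / 4 <= M k - L k + kap / 2 * V k + N k / 2.
Hypothesis H5 : forall k, (k <= K)%N -> X k - L k <= J - 3 * e -> N k <= om.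
Hypothesis H6 : forall k, 0 < X k ->
  4 * X k ^+ 2 + 2 * X k / (1 + d) <= k%:R * h ^+ 2 * (1 + z).

Let h2 : 0 < h ^+ 2. Proof. exact: exprn_gt0. Qed.
Let tk (k : nat) := k%:R * h ^+ 2.
Let tk0 k : 0 <= tk k. Proof. by rewrite mulr_ge0// ltW. Qed.
Let tkK k : (k <= K)%N -> tk k <= t1.
Proof. by move=> kK; rewrite -Kh ler_wpM2r ?ler_nat// ltW. Qed.
Let J0 : 0 < J. Proof. exact: Jref_gt0. Qed.
Let t10 : 0 < t1. Proof. exact: t1ref_gt0. Qed.
Let G1 : 1 <= G.
Proof. by rewrite -[leLHS]expR0 ler_expR mulr_ge0// ltW. Qed.

(** The Gronwall majorant: initial error and accumulated step errors, amplified at each step. *)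
Let deficit k := (om + z * tk k) * (1 + h ^+ 2 * s2) ^+ k.

Let deficit_le k : (k <= K)%N -> deficit k <= 2 * om * G.
Proof.
move=> kK; have a1 : om + z * tk k <= 2 * om.
  by have := ler_wpM2l z_ge0 (tkK kK); have := om_gt0; have := zt; lra.
have b0 : 0 <= 1 + h ^+ 2 * s2 by have := mulr_gt0 h2 s2_gt0; lra.
apply: ler_pM => //; last 1 first.
- apply: (@le_trans _ _ (expR (h ^+ 2 * s2) ^+ k)).
    by rewrite lerXn2r ?nnegrE ?expR_ge0// expR_ge1Dx.
  rewrite -expRM_natl ler_expR mulrA mulrC ler_wpM2l ?(ltW s2_gt0)//; exact: tkK.
- by rewrite addr_ge0 ?mulr_ge0// ltW.
- by rewrite exprn_ge0.
Qed.

(** The entropy inequality with [kap] the inverse of the sphere's variance, where the sphere attains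
    it. It needs [N k <= om]: otherwise [X k] would be at least [(1 - d)] times [J + Lref], against
    [H6] and [Lref_quad]. Here the lower bound on [L] known so far is used. *)
Let gap k : (k <= K)%N -> - deficit k <= L k - Lref s2 (tk k) - om ->
  (tk k + (1 + yref s2 (tk k)) / s2 / 2) * (V k - s2 / (1 + yref s2 (tk k))) >=
  L k - Lref s2 (tk k) - om.
Proof.
move=> kK IH.
have Lr0 := Lref_ge0 s2_gt0 (tk0 k).
have N_le : N k <= om.
  apply: H5 => //; rewrite leNgt; apply/negP => Xgt.
  set Y := J + Lref s2 (tk k).
  have Y0 : 0 < Y by rewrite /Y; have := J0; lra.
  have XY : (1 - d) * Y <= X k.
    have : d * J <= d * Y by rewrite ler_wpM2l ?(ltW d_gt0)// /Y; lra.
    have := deficit_le kK; have := eJ; have := om_gt0; rewrite /Y in Xgt *; lra.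
  have d1 : 0 < 1 - d by have := d_lt1; lra.
  have X0 : 0 < X k by apply: lt_le_trans XY; rewrite mulr_gt0.
  have q6 := H6 X0; rewrite -/(tk k) in q6.
  have q1 : (1 - d) ^+ 2 * (4 * Y ^+ 2) <= 4 * X k ^+ 2.
    rewrite mulrCA -exprMn ler_pM2l// lerXn2r ?nnegrE// ltW// mulr_gt0//.
  have q2 : (1 - d) ^+ 2 * (2 * Y) <= 2 * X k / (1 + d).
    rewrite ler_pdivlMr; last by have := d_gt0; lra.
    have : (1 - d) * (1 + d) <= 1 by have := sqr_ge0 d; rewrite expr2; lra.
    move/(ler_wpM2r (mulr_ge0 (ltW d1) (ltW Y0))); rewrite mul1r expr2; lra.
  have q3 := ler_wpM2l (sqr_ge0 (1 - d)) (Lref_quad s2_gt0 r2_gt0 rs (tk0 k) (tkK kK)).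
  rewrite -/Y mulrDr in q3.
  have q4 := ler_wpM2r (tk0 k) d_gam.
  have q5 : 0 < (1 - d) ^+ 2 * (2 * Y) by rewrite mulr_gt0 ?exprn_gt0// mulr_gt0.
  have q7 : 0 <= (1 - d) ^+ 2 * (4 * Y ^+ 2) by rewrite mulr_ge0 ?sqr_ge0// mulr_ge0// sqr_ge0.
  rewrite mulrA in q3.
  have tpos : 0 < tk k.
    rewrite lt0r tk0 andbT; apply/eqP => t0; rewrite t0 mul0r in q6; lra.
  have := zd; nra.
have y0 := yref_ge0 s2_gt0 (tk0 k).
have yE := yrefE s2_gt0 (tk0 k).
have yle := yref_le s2_gt0 (tkK kK).
rewrite (yref_t1 r2_gt0 rs) in yle.
move: (H2 k); rewrite ler_norml -/(tk k) => /andP[_ m2].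
have tz : tk k * z <= om / 4.
  by apply: le_trans zt; rewrite mulrC ler_wpM2l// tkK.
rewrite /Lref; move: (yref s2 (tk k)) y0 yE yle => y y0 yE yle.
have s20 := s2_gt0.
have k0 : 0 < (1 + y) / s2 by rewrite divr_gt0//; lra.
have kr : (1 + y) / s2 * r2 <= 1.
  rewrite mulrAC ler_pdivrMr// mul1r.
  have : 1 + y <= s2 / r2 by lra.
  by rewrite ler_pdivlMr.
have := H4 k k0 kr.
have -> : (1 + y) / s2 * s2 = 1 + y by field; lra.
have yt : tk k * (s2 / (1 + y)) = y.
  by rewrite mulrA (mulrC _ s2) -yE; field; lra.
have -> : (tk k + (1 + y) / s2 / 2) * (V k - s2 / (1 + y)) =
   tk k * V k + (1 + y) / s2 / 2 * V k - tk k * (s2 / (1 + y)) - 1 / 2 by field; lra.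
rewrite yt; lra.
Qed.

(** If [F >= 0], then [gap] puts the variance above that of the sphere; if [F < 0], it falls below
    by at most [2 * s2 * |F|], because [c >= 1 / (2 * s2)]. *)
Let lower k : (k <= K)%N -> - deficit k <= L k - Lref s2 (tk k) - om.
Proof.
elim: k => [|k IH] kK.
  rewrite H0 /deficit /tk mul0r Lref0 mulr0 addr0 expr0 mulr1 subrr sub0r lexx//.
have {}IH := IH (ltnW kK).
have gk := gap (ltnW kK) IH.
have st := H1 kK.
have tS : tk k.+1 = tk k + h ^+ 2 by rewrite /tk -natr1 mulrDl mul1r.
have rstep := Lref_step s2_gt0 (tk0 k) (ltW h2); rewrite -tS in rstep.
have y0 := yref_ge0 s2_gt0 (tk0 k).
set Vs := s2 / (1 + yref s2 (tk k)) in gk rstep.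
set F := L k - Lref s2 (tk k) - om in IH gk.
have F' : F + h ^+ 2 / 2 * (V k - Vs) - z * h ^+ 2 <= L k.+1 - Lref s2 (tk k.+1) - om.
  rewrite /F; lra.
apply: le_trans F'.
have b0 : 1 <= 1 + h ^+ 2 * s2 by have := mulr_gt0 h2 s2_gt0; lra.
have bk : 1 <= (1 + h ^+ 2 * s2) ^+ k.+1 by rewrite exprn_ege1.
set B := _ ^+ k.+1 in bk.
have defS : deficit k.+1 = deficit k * (1 + h ^+ 2 * s2) + z * h ^+ 2 * B.
  have BE : B = (1 + h ^+ 2 * s2) ^+ k * (1 + h ^+ 2 * s2) by rewrite /B exprSr.
  by rewrite /deficit tS -/B BE; ring.
have zh : 0 <= z * h ^+ 2 by rewrite mulr_ge0// ltW.
have zB : z * h ^+ 2 <= z * h ^+ 2 * B by rewrite ler_peMr.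
have d0 : 0 <= deficit k.
  apply: mulr_ge0; last by apply: exprn_ge0; lra.
  by apply: addr_ge0; [exact: ltW|exact: mulr_ge0].
have dd : deficit k <= deficit k * (1 + h ^+ 2 * s2) by rewrite ler_peMr.
set c := tk k + _ in gk.
have kp : 1 / (2 * s2) <= c.
  rewrite /c; have : 1 / (2 * s2) <= (1 + yref s2 (tk k)) / s2 / 2.
    have -> : (1 + yref s2 (tk k)) / s2 / 2 = (1 + yref s2 (tk k)) / (2 * s2).
      by field; rewrite gt_eqF.
    rewrite ler_pM2r ?invr_gt0 ?mulr_gt0//; lra.
  by have := tk0 k; lra.
have c0 : 0 < c by apply: lt_le_trans kp; rewrite divr_gt0// mulr_gt0.
have [F0|F0] := leP 0 F.
  have V0 : 0 <= V k - Vs by rewrite -(pmulr_rge0 _ c0); exact: le_trans gk.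
  have : 0 <= h ^+ 2 / 2 * (V k - Vs) by rewrite mulr_ge0// divr_ge0// ltW.
  lra.
have V0 : 2 * s2 * F <= V k - Vs.
  have cs : 1 <= c * (2 * s2).
    by move: kp; rewrite ler_pdivrMr// mulr_gt0.
  rewrite -(ler_pM2l c0); apply: le_trans gk.
  have -> : c * (2 * s2 * F) = c * (2 * s2) * F by ring.
  by rewrite -[leRHS]mul1r ler_wnM2r// ltW.
have : h ^+ 2 / 2 * (2 * s2 * F) <= h ^+ 2 / 2 * (V k - Vs).
  by rewrite ler_wpM2l// divr_ge0// ltW.
have -> : h ^+ 2 / 2 * (2 * s2 * F) = (1 + h ^+ 2 * s2) * F - F by field.
have : (1 + h ^+ 2 * s2) * - deficit k <= (1 + h ^+ 2 * s2) * F.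
  by rewrite ler_wpM2l//; lra.
rewrite defS; lra.
Qed.

Lemma sequence_contradiction : False.
Proof.
have lo := lower (leqnn K); have gk := gap (leqnn K) lo.
have de := deficit_le (leqnn K).
have tE : tk K = t1 by rewrite /tk Kh.
have yE : yref s2 (tk K) = s2 / r2 - 1 by rewrite tE yref_t1.
have yE1 : 1 + (s2 / r2 - 1) = s2 / r2 by ring.
rewrite yE yE1 tE in gk; rewrite tE in lo.
have Vr : s2 / (s2 / r2) = r2 by rewrite invf_div mulrCA mulfV ?mulr1// gt_eqF.
rewrite Vr in gk; set c := t1 + _ in gk.
have ct : t1 <= c by rewrite lerDl !divr_ge0// ltW.
have rt : 0 < t1 * r2 by rewrite mulr_gt0.
have VK : (1 - d / 2) * r2 <= V K.
  rewrite leNgt; apply/negP => VK.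
  have : c * (V K - r2) <= t1 * (V K - r2).
    rewrite ler_wnM2r//; have : 0 < d * r2 by rewrite mulr_gt0.
    by move: VK; lra.
  have : t1 * (V K) < t1 * ((1 - d / 2) * r2) by rewrite ltr_pM2l.
  have := omt; lra.
have := H2 K; rewrite -/(tk K) tE ler_norml => /andP[m1 _].
have MK : t1 * ((1 - d) * r2) <= M K.
  have : t1 * ((1 - d / 2) * r2) <= t1 * V K by rewrite ler_wpM2l// ltW.
  have : t1 * z <= t1 * (d * r2 / 2) by rewrite ler_wpM2l// ltW.
  lra.
have d1 : 0 < 1 - d by have := d_lt1; lra.
have tdr : 0 < t1 * ((1 - d) * r2) by apply: mulr_gt0 => //; exact: mulr_gt0.
have M0 : 0 < M K by exact: lt_le_trans MK.
have := H3 M0; rewrite -/(tk K) tE => h3.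
have q1 : (t1 * ((1 - d) * r2)) ^+ 2 <= M K ^+ 2.
  by rewrite lerXn2r ?nnegrE ?(ltW M0) ?(ltW tdr).
have q2 : (1 - d) ^+ 2 * r2 <= V K.
  apply: le_trans VK; rewrite ler_pM2r// expr2; have := d_lt1; have := d_gt0; nra.
have t1E : t1 * r2 = s2 / r2 - 1 by rewrite /t1ref divfK// gt_eqF.
have sE : t1 * r2 * r2 = s2 - r2 by rewrite t1E; field; rewrite gt_eqF.
have q3 : 4 * (t1 * ((1 - d) * r2)) ^+ 2 = t1 * ((1 - d) ^+ 2 * (4 * (s2 - r2))).
  by rewrite -sE; ring.
have q4 : t1 * ((1 - d) ^+ 2 * (4 * (s2 - r2)) + 2 * ((1 - d) ^+ 2 * r2)) <= t1 * 1.
  rewrite mulrDr -q3 mulr1.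
  have : t1 * (2 * ((1 - d) ^+ 2 * r2)) <= t1 * (2 * V K) by rewrite ler_wpM2l ?ler_pM2l// ltW.
  lra.
rewrite ler_pM2l// in q4.
have := d_gam; have := d_gt0; lra.
Qed.

End SequenceContradiction.

(** * Existence of a ball containing a large fraction of a finite family *)

Section DenseBall.
Variable R : realType.

Section FixedFamily.
Variables (n : nat) (I : finType) (X : I -> 'rV[R]_n).
Hypothesis n_gt0 : (0 < n)%N.
Hypothesis I_gt0 : (0 < #|I|)%N.
Hypothesis X1 : forall i, nsq (X i) <= 1.
Hypothesis XD : forall i j, nsq (X i - X j) <= 1.
Let n0 : 0 < n%:R :> R. Proof. by rewrite ltr0n. Qed.

(** The diameter bound at the time [(1 + d)^2 t], with the variance eliminated by integration by
    parts. *)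
Lemma menergy_tilt_quad (d h z : R) k : 0 < d -> d <= 1 -> 0 < h ->
  n%:R * h <= 1 / 8 -> h * (64 * n%:R ^+ 2) <= z ->
  0 < menergy_tilt X d h k ->
  4 * menergy_tilt X d h k ^+ 2 + 2 * menergy_tilt X d h k / (1 + d) <=
  k%:R * h ^+ 2 * (1 + z).
Proof.
move=> d0 d1 h0 nh hz X0.
have d10 : 0 < 1 + d by lra.
set X' := menergy_tilt X d h k in X0 *; pose h' := (1 + d) * h.
have ME : menergy X h' k = (1 + d) * X' by rewrite /X' /menergy_tilt -/h'; field; lra.
have M0 : 0 < menergy X h' k by rewrite ME mulr_gt0.
have h'0 : 0 < h' by rewrite mulr_gt0.
have h'2 : h' <= 2 * h by apply: ler_wpM2r; [exact: ltW|lra].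
have nh' : n%:R * h' <= 1 / 4 by have := ler_wpM2l (ltW n0) h'2; lra.
have P1 := menergy_diam n_gt0 I_gt0 XD M0.
have := menergy_near n_gt0 I_gt0 X1 k h'0 nh'.
rewrite ler_norml => /andP[_ P2].
set t' := k%:R * h' ^+ 2 in P1 P2.
have t'E : t' = (1 + d) ^+ 2 * (k%:R * h ^+ 2) by rewrite /t' /h'; ring.
have t'0 : 0 <= t' by rewrite /t' mulr_ge0 ?sqr_ge0.
have zz : 32 * n%:R ^+ 2 * h' <= z.
  have : n%:R ^+ 2 * h' <= n%:R ^+ 2 * (2 * h) by apply: ler_wpM2l => //; exact: sqr_ge0.
  lra.
have P3 : t' * (32 * n%:R ^+ 2 * h') <= t' * z by rewrite ler_wpM2l.
have P4 : 4 * menergy X h' k ^+ 2 + 2 * menergy X h' k <= t' * (1 + z).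
  by move: (menergy X h' k) (mgvar X h' k) P1 P2 => *; lra.
rewrite ME t'E in P4.
have -> : 4 * X' ^+ 2 + 2 * X' / (1 + d) =
  (4 * ((1 + d) * X') ^+ 2 + 2 * ((1 + d) * X')) / (1 + d) ^+ 2 by field; lra.
by rewrite ler_pdivrMr ?exprn_gt0//; apply: (le_trans P4); rewrite -mulrA mulrC.
Qed.

Lemma mean_near_small (r2 J d e om t1 h : R) k :
  (forall w, nball X r2 w <= #|I|%:R * expR (- (n%:R * J))) ->
  0 < d -> d <= 1 -> 0 < h -> 0 < e -> 0 < om -> 0 < t1 ->
  n%:R * h <= 1 / 8 -> 128 * n%:R ^+ 3 * h ^+ 2 <= 1 -> k%:R * h ^+ 2 <= t1 ->
  180 * t1 / (d ^+ 2 * e ^+ 2 * om) <= n%:R -> 4 / (d * e * om) <= n%:R ->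
  menergy_tilt X d h k - mflam X h k <= J - 3 * e ->
  iter k (walk h) (near X r2) 0 <= om.
Proof.
move=> Hb d0 d1 h0 e0 om0 t10 nh nh3 tk B1 B2 Xk.
have mu : iter k (walk h) (tiltrate X d) 0 <= J - 3 * e.
  by apply: le_trans Xk; exact: mean_tiltrate_le.
apply: le_trans (mean_near_le n_gt0 I_gt0 X1 Hb d0 d1 h0 e0 nh nh3 mu) _.
have de2 : 0 < d ^+ 2 * e ^+ 2 * om by rewrite !mulr_gt0 ?exprn_gt0.
have deo : 0 < d * e * om by rewrite !mulr_gt0.
have b1 : 90 * (k%:R * h ^+ 2) / (d ^+ 2 * n%:R) / e ^+ 2 <= om / 2.
  have -> : 90 * (k%:R * h ^+ 2) / (d ^+ 2 * n%:R) / e ^+ 2 =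
     90 * (k%:R * h ^+ 2) / (d ^+ 2 * e ^+ 2 * n%:R) by field; rewrite !gt_eqF.
  rewrite ler_pdivrMr; last by rewrite !mulr_gt0 ?exprn_gt0.
  move: B1; rewrite ler_pdivrMr// => B1.
  have -> : om / 2 * (d ^+ 2 * e ^+ 2 * n%:R) = n%:R * (d ^+ 2 * e ^+ 2 * om) / 2 by ring.
  lra.
have b2 : 2 * expR (- (n%:R * (d * e))) <= om / 2.
  have nde : 0 < n%:R * (d * e) by rewrite !mulr_gt0.
  have : expR (- (n%:R * (d * e))) <= (n%:R * (d * e))^-1.
    rewrite expRN lef_pV2 ?posrE ?expR_gt0//.
    by apply: le_trans (expR_ge1Dx _); lra.
  have : (n%:R * (d * e))^-1 <= om / 4.
    rewrite -[leLHS]mul1r ler_pdivrMr//; move: B2; rewrite ler_pdivrMr//.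
    have -> : om / 4 * (n%:R * (d * e)) = n%:R * (d * e * om) / 4 by ring.
    lra.
  move: (expR _) (_^-1) => *; lra.
move: (90 * _ / _ / _) (expR _) b1 b2 => *; lra.
Qed.

Lemma mean_entropy_var_ge (r2 s2 om kap h : R) k : 0 < r2 -> 0 < s2 -> 0 < kap ->
  kap * r2 <= 1 ->
  (forall w, (forall i, nsq (X i - w) <= 1) ->
    \sum_i expR (n%:R / 2 * (1 - kap * Num.max (nsq (X i - w)) r2)) <=
    #|I|%:R * expR (- (n%:R * Jref s2 r2)) * expR (n%:R * (om - ln kap / 2 - ln r2 / 2))) ->
  1 / 2 + ln (kap * s2) / 2 - om <=
  menergy X h k - mflam X h k + kap / 2 * mgvar X h k + iter k (walk h) (near X r2) 0 / 2.
Proof.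
move=> r0 s0 kap0 kr Hgauss.
have pw v : 1 / 2 + ln (kap * s2) / 2 - om <=
    dot v (gmean X v) - flam X v + (kap / 2 * gvar X v + 1 / 2 * near X r2 v).
  have Hs := Hgauss (gmean X v) (nsq_sub_gmean_le1 I_gt0 XD v).
  have := entropy_var_ge n_gt0 I_gt0 r0 kap0 Hs.
  have -> : 1 / 2 + Jref s2 r2 - (om - ln kap / 2 - ln r2 / 2) = 1 / 2 + ln (kap * s2) / 2 - om.
    by rewrite /Jref ln_div ?posrE// lnM ?posrE//; field.
  move/le_trans; apply; rewrite lerD2l mulrDr lerD2l.
  have -> : kap / 2 * (r2 * near X r2 v) = kap * r2 * (1 / 2 * near X r2 v) by ring.
  by rewrite ler_piMl// mulr_ge0 ?near_ge0.
rewrite -(iter_walk_cst n_gt0 h k (1 / 2 + ln (kap * s2) / 2 - om) 0).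
apply: le_trans (iter_walk_le n_gt0 h k 0 pw) _.
rewrite iter_walkD iter_walkB iter_walk_lin -/(menergy X h k) -/(mflam X h k) -/(mgvar X h k).
move: (menergy X h k) (mflam X h k) (mgvar X h k) (iter k _ _ _) => *; lra.
Qed.

End FixedFamily.

(** The number of steps determines [h], so that the walk ends exactly at the time [t]. *)
Lemma fine_step (n : nat) (t z : R) : (0 < n)%N -> 0 < t -> 0 < z ->
  exists (h : R) (K : nat), [/\ 0 < h, K%:R * h ^+ 2 = t, h * (64 * n%:R ^+ 2) <= z,
    n%:R * h <= 1 / 8 & 128 * n%:R ^+ 3 * h ^+ 2 <= 1].
Proof.
move=> n_gt0 t10 z0; have n0 : 0 < n%:R :> R by rewrite ltr0n.
pose hm := Num.min (1 / (128 * n%:R ^+ 3)) (z / (64 * n%:R ^+ 2)).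
have n3 : 0 < 128 * n%:R ^+ 3 :> R by rewrite mulr_gt0// exprn_gt0.
have n2 : 0 < 64 * n%:R ^+ 2 :> R by rewrite mulr_gt0// exprn_gt0.
have hm0 : 0 < hm by rewrite lt_min !divr_gt0.
pose K := (Num.truncn (t / hm ^+ 2)).+1.
have K0 : 0 < K%:R :> R by rewrite ltr0n.
pose h := Num.sqrt (t / K%:R).
have h0 : 0 < h by rewrite sqrtr_gt0 divr_gt0.
have hE : h ^+ 2 = t / K%:R by rewrite sqr_sqrtr// divr_ge0 ?ltW.
have Kh : K%:R * h ^+ 2 = t by rewrite hE mulrCA mulfV ?mulr1// gt_eqF.
have hhm : h <= hm.
  rewrite -(ler_pXn2r (n := 2)) ?nnegrE ?(ltW h0) ?(ltW hm0)//.
  rewrite hE ler_pdivrMr// mulrC -ler_pdivrMr ?exprn_gt0//.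
  by apply: ltW; rewrite truncnS_gt.
have h3 : h * (128 * n%:R ^+ 3) <= 1.
  by rewrite -ler_pdivlMr//; apply: le_trans hhm _; rewrite ge_min lexx.
have hz : h * (64 * n%:R ^+ 2) <= z.
  by rewrite -ler_pdivlMr//; apply: le_trans hhm _; rewrite ge_min lexx orbT.
have n_1 : 1 <= n%:R :> R by rewrite ler1n.
have nn : n%:R <= n%:R ^+ 3 :> R by rewrite -[leLHS]expr1 ler_weXn2l.
have nh : n%:R * h <= 1 / 8.
  have := ler_wpM2l (ltW h0) nn; lra.
have h1 : h <= 1 by have := ler_wpM2r (ltW h0) n_1; lra.
have nh3 : 128 * n%:R ^+ 3 * h ^+ 2 <= 1.
  apply: le_trans h3; rewrite [leRHS]mulrC ler_pM2l// expr2 ler_piMr//.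
  exact: ltW.
by exists h, K.
Qed.

(** [d] comes from the slack [gam], then [e], [om] and [z] from [d]; all depend only on [r2] and
    [s2], as does the threshold for [n]. Only the walk's step and length depend on [n]. *)
Lemma dense_ball (r2 s2 : R) : 0 < r2 -> r2 < s2 -> 1 + 2 * r2 < 4 * s2 ->
  exists n0 : nat, forall n, (n0 <= n)%N -> (0 < n)%N ->
  forall (I : finType) (X : I -> 'rV[R]_n), (0 < #|I|)%N ->
  (forall i, nsq (X i) <= 1) -> (forall i j, nsq (X i - X j) <= 1) ->
  exists w, #|I|%:R * expR (- (n%:R * Jref s2 r2)) <= nball X r2 w.
Proof.
move=> r0 rs sr.
have s0 : 0 < s2 by exact: lt_trans rs.
pose gam := 4 * s2 - 2 * r2 - 1; have gam0 : 0 < gam by rewrite /gam; lra.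
pose d := gam / (4 * (1 + gam)).
have d0 : 0 < d by rewrite divr_gt0// mulr_gt0//; lra.
have dE : d * (1 + gam) = gam / 4 by rewrite /d; field; lra.
have d4 : d <= 1 / 4 by rewrite /d ler_pdivrMr ?mulr_gt0//; lra.
have dg : d <= gam / 4 by rewrite -dE ler_peMr ?ltW//; lra.
have d_gam : 1 + d <= (1 - d) ^+ 2 * (4 * s2 - 2 * r2).
  have -> : 4 * s2 - 2 * r2 = 1 + gam by rewrite /gam; ring.
  have : (1 - 2 * d) * (1 + gam) <= (1 - d) ^+ 2 * (1 + gam).
    rewrite ler_wpM2r//; first by lra.
    by have := sqr_ge0 d; rewrite !expr2; lra.
  rewrite mulrBl -mulrA dE; lra.
clearbody d.
pose t1 := t1ref s2 r2; pose J := Jref s2 r2.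
have t10 : 0 < t1 by exact: t1ref_gt0.
have J0 : 0 < J by exact: Jref_gt0.
pose G := expR (s2 * t1); have G0 : 0 < G by exact: expR_gt0.
pose e := d * J / 6; have e0 : 0 < e by rewrite divr_gt0// mulr_gt0.
have eE : 3 * e = d * J / 2 by rewrite /e; field.
clearbody e.
pose om := Num.min (d * J / 4 / G) (d * t1 * r2 / 4 / G).
have dJ : 0 < d * J by exact: mulr_gt0.
have dtr : 0 < d * t1 * r2 by apply: mulr_gt0 => //; exact: mulr_gt0.
have om0 : 0 < om by rewrite lt_min; apply/andP; split; rewrite divr_gt0// divr_gt0.
have om1 : om * G <= d * J / 4 by rewrite -ler_pdivlMr// ge_min lexx.
have om2 : om * G <= d * t1 * r2 / 4 by rewrite -ler_pdivlMr// ge_min lexx orbT.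
clearbody om; have om4 : 0 < om / 4 by lra.
have [n1 Hgauss] := gauss_sum_le r0 om4.
pose B := 180 * t1 / (d ^+ 2 * e ^+ 2 * om) + 4 / (d * e * om).
exists (maxn n1 (Num.truncn B).+1) => n; rewrite geq_max => /andP[nn1 nB] n_gt0.
move=> I X I_gt0 X1 XD.
have n0 : 0 < n%:R :> R by rewrite ltr0n.
have nBr : B <= n%:R.
  apply: ltW; apply: lt_le_trans (_ : (Num.truncn B).+1%:R <= _).
    by rewrite truncnS_gt.
  by rewrite ler_nat.
apply: contrapT => Hno.
have Hb w : nball X r2 w <= #|I|%:R * expR (- (n%:R * J)).
  apply: ltW; rewrite ltNge; apply/negP => Hw; apply: Hno; exists w; exact: Hw.
pose z := Num.min (d / 2) (Num.min (d * r2 / 2) (om / 4 / t1)).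
have z0 : 0 < z.
  have dr : 0 < d * r2 by exact: mulr_gt0.
  have ot : 0 < om / 4 / t1 by exact: divr_gt0.
  by rewrite !lt_min ot andbT; apply/andP; split; lra.
have z1 : z <= d / 2 by rewrite ge_min lexx.
have z2 : z <= d * r2 / 2 by rewrite !ge_min lexx orbT.
have z3 : z * t1 <= om / 4 by rewrite -ler_pdivlMr// !ge_min lexx !orbT.
clearbody z.
have [h [K [h0 Kh hz nh nh3]]] := fine_step n_gt0 t10 z0.
have nh4 : n%:R * h <= 1 / 4 by clear - nh; lra.
have n2h : 0 <= n%:R ^+ 2 * h by rewrite mulr_ge0 ?exprn_ge0 ?ltW.
have de2 : 0 < d ^+ 2 * e ^+ 2 * om by rewrite !mulr_gt0 ?exprn_gt0.
have deo : 0 < d * e * om by rewrite !mulr_gt0.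
have B1 : 180 * t1 / (d ^+ 2 * e ^+ 2 * om) <= n%:R.
  by apply: le_trans nBr; rewrite /B lerDl divr_ge0// ltW.
have B2 : 4 / (d * e * om) <= n%:R.
  apply: le_trans nBr; rewrite /B lerDr; apply: divr_ge0; last exact: ltW.
  by apply: mulr_ge0 => //; exact: ltW.
have d1 : d <= 1 by clear - d4; lra.
apply: (@sequence_contradiction R r2 s2 d e om z h K (mflam X h) (mgvar X h)
  (menergy X h) (fun k => iter k (walk h) (near X r2) 0) (menergy_tilt X d h)) => //.
- by clear - d4; lra.
- by rewrite -/t1 -/G -/J -mulrA; clear - eE om1; lra.
- by rewrite -/t1 -/G -mulrA; clear - om2; lra.
- exact: ltW.
- by clear - z1 d0; lra.
- by rewrite /mflam /= flam0.
- move=> k _; have := mflam_step n_gt0 I_gt0 X1 k (ltW h0) nh4.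
  have : 3 * n%:R ^+ 2 * h ^+ 3 <= z * h ^+ 2.
    have -> : 3 * n%:R ^+ 2 * h ^+ 3 = (3 * (n%:R ^+ 2 * h)) * h ^+ 2 by ring.
    by rewrite ler_wpM2r ?sqr_ge0//; clear - hz n2h; lra.
  move: (mflam X h k) (mflam X h k.+1) (mgvar X h k) => L L' V; clear; lra.
- move=> k; apply: le_trans (menergy_near n_gt0 I_gt0 X1 k h0 nh4) _.
  apply: ler_wpM2l; first by rewrite mulr_ge0// sqr_ge0.
  by clear - hz n2h; lra.
- by move=> M0; exact: menergy_diam.
- move=> k kap kap0 kr; apply: mean_entropy_var_ge => // w Xw.
  exact: Hgauss.
- move=> k kK Xk.
  have tk : k%:R * h ^+ 2 <= t1 by rewrite -Kh ler_wpM2r ?sqr_ge0// ler_nat.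
  exact: (mean_near_small n_gt0 I_gt0 X1 Hb d0 d1 h0 e0 om0 t10 nh nh3 tk B1 B2 Xk).
- by move=> k; apply: menergy_tilt_quad.
Qed.

End DenseBall.

(** * From dense balls to coverings and to the bound on [chi] *)

Section Covering.
Variable R : realType.

(** Each centre is chosen for the points still uncovered, of which at most the fraction [1 - th]
    then remains. *)
Lemma greedy_cover (I : finType) (T : Type) (w0 : T) (B : T -> pred I) (th : R) : th <= 1 ->
  (forall A : {set I}, A != finset.set0 ->
    exists w, th * #|A|%:R <= #|[set i in A | B w i]%SET|%:R) ->
  forall k, exists2 s : seq T, size s = k &
    #|[set i | ~~ has (B^~ i) s]%SET|%:R <= (1 - th) ^+ k * #|I|%:R.
Proof.
move=> th1 HB; elim=> [|k [s sk IH]].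
  by exists [::] => //; rewrite expr0 mul1r ler_nat max_card.
set A := [set i | ~~ has (B^~ i) s]%SET in IH.
have [A0|A0] := eqVneq A finset.set0.
  (* Nothing is left to cover; [w0] pads the list to length [k + 1]. *)
  exists (w0 :: s); first by rewrite /= sk.
  apply: (@le_trans _ _ #|A|%:R).
    rewrite ler_nat subset_leq_card//; apply/fintype.subsetP => i.
    by rewrite !inE /= negb_or => /andP[].
  by rewrite A0 cards0 mulr_ge0// exprn_ge0// subr_ge0.
have [w Hw] := HB A A0; exists (w :: s); first by rewrite /= sk.
have := cardsID [set i | B w i]%SET A.
have -> : (A :&: [set i | B w i] = [set i in A | B w i])%SET.
  by apply/setP => i; rewrite !inE.
have -> : (A :\: [set i | B w i] = [set i | ~~ has (B^~ i) (w :: s)])%SET.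
  by apply/setP => i; rewrite !inE /= negb_or.
move=> cE; have {}cE : #|A|%:R = #|[set i in A | B w i]%SET|%:R +
    #|[set i | ~~ has (B^~ i) (w :: s)]%SET|%:R :> R by rewrite -natrD cE.
rewrite exprS -mulrA; apply: (@le_trans _ _ ((1 - th) * #|A|%:R)).
  by rewrite mulrBl mul1r; lra.
by rewrite ler_wpM2l// subr_ge0.
Qed.

(** One point of [F] for each grid cell of side [1 / M]. Cells that miss [F] get the default [x0],
    so every index gives a point of [F], possibly repeated. *)
Lemma grid_net (n M : nat) (F : set 'rV[R]_n) (x0 : 'rV[R]_n) : (0 < M)%N -> F x0 ->
  (forall x y, F x -> F y -> nsq (x - y) <= 1) ->
  exists2 rep : {ffun 'I_n -> 'I_(M.*2.+1)} -> 'rV[R]_n, forall a, F (rep a) &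
    forall x, F x -> exists a, nsq (x - rep a) <= n%:R / M%:R ^+ 2.
Proof.
move=> M_gt0 Fx0 F1; have M0 : 0 < M%:R :> R by rewrite ltr0n.
pose t (x : 'rV[R]_n) (i : 'I_n) := (x ord0 i - x0 ord0 i + 1) * M%:R.
have t0 x i : F x -> 0 <= t x i <= M.*2%:R.
  move=> Fx; have := le_trans (coord_sq_le_nsq (x - x0) i) (F1 _ _ Fx Fx0).
  rewrite !mxE; set u := _ - _ => u1.
  have : `|u| <= 1.
    by rewrite -sqrtr_sqr -[leRHS]sqrtr1 ler_wsqrtr.
  rewrite ler_norml => /andP[h1 h2]; rewrite /t -/u -muln2 natrM mulrC.
  by rewrite mulr_ge0 ?ler_pM2l//; lra.
pose c x := [ffun i => inord (Num.truncn (t x i)) : 'I_(M.*2.+1)].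
exists (fun a => xget x0 [set x | F x /\ c x = a]).
  by move=> a; case: xgetP => [x _ []|].
move=> x Fx; exists (c x).
case: xgetP => [y _ [Fy cxy]|/(_ x)[]//].
have cE z i : F z -> c z i = Num.truncn (t z i) :> nat.
  move=> Fz; have /andP[z0 z1] := t0 z i Fz.
  rewrite ffunE inordK// ltnS truncn_le_nat (le_lt_trans z1)//.
  by rewrite ltr_nat.
have co i : (x - y) ord0 i ^+ 2 <= (M%:R ^+ 2)^-1.
  have e : Num.truncn (t x i) = Num.truncn (t y i) by rewrite -!cE// cxy.
  have /andP[x1 _] := t0 x i Fx; have /andP[y1 _] := t0 y i Fy.
  have /andP[] := truncn_itv x1; have /andP[] := truncn_itv y1.
  rewrite e -natr1 => h1 h2 h3 h4.
  have E : (x - y) ord0 i = (t x i - t y i) / M%:R.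
    by rewrite !mxE /t; field; rewrite gt_eqF.
  rewrite E exprMn exprVn ler_piMl ?invr_ge0 ?sqr_ge0//.
  rewrite expr2; nra.
rewrite nsqE; apply: le_trans (ler_sum _ (fun i _ => co i)) _.
by rewrite sumr_const card_ord -[X in X <= _]mulr_natl.
Qed.

Lemma nsqD_young (n : nat) (c : R) (u v : 'rV[R]_n) : 0 < c ->
  nsq (u + v) <= (1 + c) * nsq u + (1 + c^-1) * nsq v.
Proof. by move=> c0; rewrite nsqD; have := dot_young u v c0; lra. Qed.

Lemma edistE (n : nat) (x y : 'rV[R]_n) : edist x y = Num.sqrt (nsq (x - y)).
Proof.
by rewrite /edist nsqE; congr Num.sqrt; apply: eq_bigr => i _; rewrite !mxE.
Qed.

Lemma diam_le1_nsq (n : nat) (F : set 'rV[R]_n) : diam F = 1%E ->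
  forall x y, F x -> F y -> nsq (x - y) <= 1.
Proof.
move=> dF x y Fx Fy.
have : edist x y <= 1.
  by rewrite -lee_fin -dF; apply: ereal_sup_ubound; exists (x, y).
by rewrite edistE -[X in _ <= X]sqrtr1 ler_psqrt ?nnegrE ?nsq_ge0.
Qed.

Lemma partitionable_of_balls (n k : nat) (b rho2 : R) : 0 < b -> 4 * rho2 < b ^+ 2 ->
  (forall F : set 'rV[R]_n, F !=set0 -> (forall x y, F x -> F y -> nsq (x - y) <= 1) ->
    exists2 s : seq 'rV[R]_n, size s = k &
      forall x, F x -> exists2 w, w \in s & nsq (x - w) <= rho2) ->
  partitionable n b k.
Proof.
move=> b0 rb H F dF.
have [F0|Fn0] := pselect (F !=set0); last first.
  exfalso; move: dF; rewrite /diam (_ : F = set0) ?set0X ?image_set0 ?ereal_sup0//.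
  by apply/seteqP; split => // x Fx; apply: Fn0; exists x.
have [s sk Hs] := H F F0 (diam_le1_nsq dF).
exists (fun j => F `&` [set x | nsq (x - nth 0 s j) <= rho2]).
  apply/seteqP; split => [x Fx|x [j _ []]//].
  have [w ws wx] := Hs x Fx.
  have ik : (index w s < k)%N by rewrite -sk index_mem.
  by exists (Ordinal ik) => //; split => //=; rewrite nth_index.
move=> j.
have [rho0|rho0] := leP 0 rho2; last first.
  rewrite (_ : _ `&` _ = set0) /diam ?set0X ?image_set0 ?ereal_sup0 ?ltNyr//.
  apply/seteqP; split => // x [_ /=] le1.
  by have := nsq_ge0 (x - nth 0 s j); lra.
apply: (@le_lt_trans _ _ (Num.sqrt (4 * rho2))%:E).
  apply: ge_ereal_sup => _ [[x y] /= [[Fx xw] [Fy yw]] <-].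
  rewrite lee_fin edistE ler_wsqrtr//.
  have -> : x - y = (x - nth 0 s j) + (nth 0 s j - y) by rewrite addrA subrK.
  have := @nsqD_young n 1 (x - nth 0 s j) (nth 0 s j - y) ltr01.
  rewrite invr1 (nsq_distC (nth 0 s j)); lra.
rewrite lte_fin -[X in _ < X](ger0_norm (ltW b0)) -sqrtr_sqr ltr_sqrt//.
by rewrite exprn_gt0.
Qed.

Lemma sum_enum_val (T : finType) (A : {set T}) (P : pred T) :
  \sum_(i < #|A|) (P (enum_val i))%:R = #|[set a in A | P a]%SET|%:R :> R.
Proof.
rewrite -(big_enum_val (fun a => (P a)%:R)) /= -sum1_card natr_sum /=.
rewrite [RHS](eq_bigl (fun a => (a \in A) && P a)) => [|a]; last by rewrite inE.
by rewrite [RHS]big_mkcondr/=; apply: eq_bigr => a _; case: (P a).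
Qed.

(** Every subfamily of the net inherits the diameter bound, so the greedy choice never stalls; after
    [k] rounds fewer than [(1 - th)^k (2 M + 1)^n < 1] points remain. The parameter [c] of Young's
    inequality trades radius for the error of the net. *)
Lemma ball_cover (r2 s2 : R) : 0 < r2 -> r2 < s2 -> 1 + 2 * r2 < 4 * s2 ->
  exists n0 : nat, forall n, (n0 <= n)%N -> (0 < n)%N ->
  forall (M k : nat) (c : R), (0 < M)%N -> 0 < c ->
  expR (n%:R * Jref s2 r2) * (n%:R * ln (M.*2.+1)%:R) < k%:R ->
  forall F : set 'rV[R]_n, F !=set0 -> (forall x y, F x -> F y -> nsq (x - y) <= 1) ->
    exists2 s : seq 'rV[R]_n, size s = k &
      forall x, F x -> exists2 w, w \in s &
        nsq (x - w) <= (1 + c) * r2 + (1 + c^-1) * (n%:R / M%:R ^+ 2).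
Proof.
move=> r0 rs sr; have [n0 Hn] := dense_ball r0 rs sr.
exists n0 => n nn0 n_gt0 M k c M0 c0 kbig F [x0 Fx0] F1.
have [rep Frep net] := grid_net M0 Fx0 F1.
pose th := expR (- (n%:R * Jref s2 r2)).
have J0 := Jref_gt0 r0 rs.
have th1 : th <= 1 by rewrite -[leRHS]expR0 ler_expR oppr_le0 mulr_ge0// ltW.
pose B (w : 'rV[R]_n) : pred {ffun 'I_n -> 'I_(M.*2.+1)} :=
  fun a => nsq (rep a - x0 - w) <= r2.
have HB (A : {set {ffun 'I_n -> 'I_(M.*2.+1)}}) : A != finset.set0 ->
    exists w, th * #|A|%:R <= #|[set a in A | B w a]%SET|%:R.
  rewrite -card_gt0 => A0.
  pose X (i : 'I_#|A|) := rep (enum_val i) - x0.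
  have cI : (0 < #|'I_#|A| |)%N by rewrite card_ord.
  have X1 i : nsq (X i) <= 1 by exact: F1.
  have XD i j : nsq (X i - X j) <= 1.
    by rewrite /X opprB addrA subrK; exact: F1.
  have [w Hw] := Hn n nn0 n_gt0 _ X cI X1 XD.
  exists w; rewrite card_ord in Hw; rewrite mulrC; apply: (le_trans Hw).
  by rewrite /nball /X (sum_enum_val A (B w)).
have [s sk Hs] := greedy_cover 0 th1 HB k.
exists [seq x0 + w | w <- s]; first by rewrite size_map.
have unc : #|[set a | ~~ has (B^~ a) s]%SET| = 0%N.
  apply/eqP; rewrite -leqn0 -ltnS -(ltr_nat R).
  apply: (le_lt_trans Hs).
  rewrite card_ffun !card_ord natrX.
  have th0 : 0 <= 1 - th by lra.
  have thk : (1 - th) ^+ k <= expR (k%:R * - th).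
    by rewrite expRM_natl lerXn2r ?nnegrE ?expR_ge0// expR_ge1Dx.
  apply: (le_lt_trans (ler_wpM2r _ thk)); first by rewrite exprn_ge0.
  have -> : (M.*2.+1)%:R ^+ n = expR (n%:R * ln (M.*2.+1)%:R) :> R.
    by rewrite expRM_natl lnK ?posrE.
  rewrite -expRD expR_lt1 mulrN addrC subr_lt0 -ltr_pdivrMr ?expR_gt0//.
  by rewrite /th expRN invrK mulrC.
move=> x Fx; have [a xa] := net x Fx.
have : has (B^~ a) s.
  apply: contraT => na; have : a \in [set a | ~~ has (B^~ a) s]%SET by rewrite inE.
  by rewrite (finset.cards0_eq unc) inE.
move=> /hasP[w ws Bw]; exists (x0 + w); first by apply/mapP; exists w.
have -> : x - (x0 + w) = (rep a - x0 - w) + (x - rep a).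
  by rewrite opprD; apply/rowP => i; rewrite !mxE; ring.
apply: le_trans (nsqD_young _ _ c0) _.
apply: lerD; first by rewrite ler_wpM2l//; lra.
by rewrite ler_wpM2l// addr_ge0// invr_ge0 ltW.
Qed.

Lemma poly_le_exp (m : nat) (l : R) : 0 < l -> exists n0 : nat, forall n, (n0 <= n)%N ->
  (0 < n)%N -> n%:R * (m%:R * n%:R + 1) + 1 <= expR (n%:R * l).
Proof.
move=> l0; pose B := 6 * (m%:R + 2) / l ^+ 3.
exists (Num.truncn B).+1 => n nB n_gt0.
have n1 : 1 <= n%:R :> R by rewrite ler1n.
have nB' : B <= n%:R.
  apply: ltW; apply: lt_le_trans (_ : (Num.truncn B).+1%:R <= _); last by rewrite ler_nat.
  by rewrite truncnS_gt.
have nl : 0 <= n%:R * l by rewrite mulr_ge0// ltW.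
have := @expR_ge1Dxn R (n%:R * l) 2 nl; apply: le_trans.
rewrite addrC lerD2l (_ : 3`!%:R = 6 :> R)// ler_pdivlMr//.
move: nB'; rewrite /B ler_pdivrMr ?exprn_gt0// => nB'.
have n2 : 0 <= n%:R ^+ 2 :> R by rewrite sqr_ge0.
have := ler_wpM2l n2 nB'.
have -> : n%:R ^+ 2 * (n%:R * l ^+ 3) = (n%:R * l) ^+ 3 by ring.
apply: le_trans.
have -> : n%:R ^+ 2 * (6 * (m%:R + 2)) = n%:R * (m%:R * n%:R + 2 * n%:R) * 6 :> R by ring.
rewrite ler_wpM2r// ler_wpM2l//; lra.
Qed.

Lemma chi_le (b e : R) : 0 < b -> b <= 1 -> 0 < e ->
  exists n0 : nat, forall n, (n0 <= n)%N ->
  (chi n b)%:R <= (Num.sqrt (1 / b ^+ 2 + 1 / 2) + e) ^+ n.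
Proof.
move=> b0 b1 e0.
pose be := b ^+ 2 / 4; pose c := Num.sqrt (1 / b ^+ 2 + 1 / 2).
have b20 : 0 < b ^+ 2 by exact: exprn_gt0.
have b21 : b ^+ 2 <= 1 by rewrite expr2; nra.
have be0 : 0 < be by rewrite /be; lra.
have be1 : be <= 1 / 4 by rewrite /be; lra.
have cE : c ^+ 2 = 1 / (4 * be) + 1 / 2.
  rewrite sqr_sqrtr; first by rewrite /be; field; rewrite gt_eqF.
  by rewrite addr_ge0// divr_ge0// ltW.
have c0 : 0 <= c by exact: sqrtr_ge0.
pose eta := (c + e / 2) ^+ 2 - c ^+ 2.
have eta0 : 0 < eta by rewrite /eta !expr2; nra.
pose zt := Num.min (1 / 2) (be * eta / 3).
have zt0 : 0 < zt by rewrite lt_min; apply/andP; split; rewrite ?divr_gt0// mulr_gt0.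
have zt1 : zt <= 1 / 2 by rewrite ge_min lexx.
have zt2 : 3 * zt <= be * eta.
  by have : zt <= be * eta / 3; [rewrite ge_min lexx orbT|lra].
clearbody zt.
(* As [zt] tends to 0, [s2 / r2] tends to [(1/4 + be/2) / be = 1/b^2 + 1/2]. *)
pose r2 := (1 - zt) * be; pose s2 := (1 + 2 * r2) / 4 + zt.
have r20 : 0 < r2 by rewrite mulr_gt0//; lra.
have r2b : r2 <= be by rewrite /r2 ler_piMl ?(ltW be0)//; lra.
have rs : r2 < s2 by rewrite /s2; lra.
have sr : 1 + 2 * r2 < 4 * s2 by rewrite /s2; lra.
have ce0 : 0 < c + e / 2 by lra.
have s2c : s2 / r2 <= (c + e / 2) ^+ 2.
  rewrite ler_pdivrMr//.
  have -> : (c + e / 2) ^+ 2 = 1 / (4 * be) + 1 / 2 + eta by rewrite /eta -cE; ring.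
  have -> : (1 / (4 * be) + 1 / 2 + eta) * r2 = (1 - zt) / 4 + r2 / 2 + eta * r2.
    by rewrite /r2; field; rewrite gt_eqF.
  have : be * eta / 2 <= eta * r2.
    have : 0 < be * eta by exact: mulr_gt0.
    by rewrite /r2; nra.
  rewrite /s2; lra.
have Jc : Jref s2 r2 <= ln (c + e / 2).
  rewrite /Jref ler_pdivrMr// mulr_natr -lnXn// ler_ln ?posrE ?exprn_gt0//.
  by rewrite divr_gt0//; exact: lt_trans rs.
(* Since [(1 + zt) * r2 = be - zt^2 * be], the room for the error of the net is [zt^2 * be]. *)
pose B := 2 * (1 + zt^-1) / (zt ^+ 2 * be).
pose m0 := (Num.truncn B).+1.
have Bm : B < m0%:R by rewrite truncnS_gt.
have m01 : 1 <= m0%:R :> R by rewrite ler1n.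
have zb : 0 < zt ^+ 2 * be by rewrite mulr_gt0 ?exprn_gt0.
have iz : 0 < zt^-1 by rewrite invr_gt0.
pose rho2 := (1 + zt) * r2 + (1 + zt^-1) * (m0%:R ^+ 2)^-1.
have m02 : 0 < m0%:R ^+ 2 :> R by apply: exprn_gt0; lra.
have rhob : 4 * rho2 < b ^+ 2.
  have -> : b ^+ 2 = 4 * be by rewrite /be; field.
  rewrite ltr_pM2l//.
  have h1 : (1 + zt^-1) * (m0%:R ^+ 2)^-1 <= zt ^+ 2 * be / 2.
    rewrite ler_pdivrMr//; move: Bm; rewrite /B ltr_pdivrMr// => Bm.
    have : m0%:R * (zt ^+ 2 * be) <= m0%:R ^+ 2 * (zt ^+ 2 * be).
      by rewrite ler_wpM2r ?(ltW zb)// expr2 ler_peMl//; lra.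
    lra.
  have -> : rho2 = be - zt ^+ 2 * be + (1 + zt^-1) * (m0%:R ^+ 2)^-1.
    by rewrite /rho2 /r2; ring.
  lra.
have [n1 Hn1] := ball_cover r20 rs sr.
pose l := ln ((c + e) / (c + e / 2)).
have l0 : 0 < l by rewrite ln_gt0// ltr_pdivlMr// mul1r; lra.
have [n2 Hn2] := poly_le_exp m0.*2 l0.
exists (maxn 1 (maxn n1 n2)) => n; rewrite !geq_max => /and3P[n_gt0 nn1 nn2].
have n0 : 1 <= n%:R :> R by rewrite ler1n.
(* Then [n / M^2 <= 1 / m0^2], and the size of the net enters only through [n * ln (2 M + 1)], which
   is polynomial in [n] and absorbed by passing from [c + e / 2] to [c + e]. *)
pose M := (n * m0)%N.
have M_gt0 : (0 < M)%N by rewrite muln_gt0 n_gt0.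
pose E := expR (n%:R * Jref s2 r2).
have E1 : 1 <= E.
  by rewrite -[leLHS]expR0 ler_expR mulr_ge0// ltW//; exact: Jref_gt0.
pose A := E * (n%:R * ln (M.*2.+1)%:R).
have lnM0 : 0 <= ln (M.*2.+1)%:R :> R by rewrite ln_ge0// ler1n.
have A0 : 0 <= A by apply: mulr_ge0; [lra|exact: mulr_ge0].
pose k := (Num.truncn A).+1.
have Ak : A < k%:R by rewrite truncnS_gt.
have kA : k%:R <= A + 1.
  by rewrite /k -natr1 lerD2r; have /andP[] := truncn_itv A0.
have part : partitionable n b k.
  apply: (partitionable_of_balls b0 rhob) => F F0 F1.
  have [s sk Hs] := Hn1 n nn1 n_gt0 M k zt M_gt0 zt0 Ak F F0 F1.
  exists s => // x Fx; have [w ws wx] := Hs x Fx; exists w => //.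
  apply: (le_trans wx); rewrite /rho2 lerD2l ler_wpM2l//; first by lra.
  rewrite /M natrM exprMn ler_pdivrMr; last by rewrite mulr_gt0// exprn_gt0//; lra.
  rewrite mulrCA mulVf ?mulr1 ?gt_eqF// expr2 ler_peMl//; lra.
have chik : (chi n b)%:R <= k%:R :> R by rewrite ler_nat; exact: (chiP n b0).2.
apply: (le_trans chik); apply: (le_trans kA).
have lnM : ln (M.*2.+1)%:R <= (m0.*2)%:R * n%:R + 1 :> R.
  have : ln (M.*2.+1)%:R <= (M.*2.+1)%:R - 1 :> R by apply: ln_le_subr1; rewrite ltr0n.
  move/le_trans; apply; rewrite -natrM -natr1 addrK.
  by rewrite -doubleMl mulnC -/M; lra.
have Ec : E <= (c + e / 2) ^+ n.
  rewrite /E -[X in X ^+ n]lnK ?posrE// -expRM_natl ler_expR ler_wpM2l//; lra.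
have -> : (c + e) ^+ n = (c + e / 2) ^+ n * expR (n%:R * l).
  rewrite expRM_natl /l lnK ?posrE ?divr_gt0//; last by lra.
  by rewrite -exprMn mulrCA mulfV ?mulr1// gt_eqF.
apply: (@le_trans _ _ (E * (n%:R * ((m0.*2)%:R * n%:R + 1) + 1))).
  rewrite /A mulrDr mulr1; apply: lerD => //.
  apply: ler_wpM2l; first by lra.
  exact: ler_wpM2l.
apply: ler_pM => //; first by lra.
exact: Hn2.
Qed.

End Covering.

Theorem theorem1 (R : realType) (b : R) (b_gt0 : 0 < b) (b_le1 : b <= 1) :
  exists eps : nat -> R,
    eps n @[n --> \oo] --> 0 /\
    forall n : nat,
      (chi n b)%:R <= (Num.sqrt (1 / b ^+ 2 + 1 / 2) + eps n) ^+ n.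
Proof.
set c := Num.sqrt _.
have c1 : 1 <= c.
  rewrite -[leLHS]sqrtr1 ler_wsqrtr//.
  have b20 : 0 < b ^+ 2 by exact: exprn_gt0.
  have : 1 <= 1 / b ^+ 2 by rewrite ler_pdivlMr// mul1r expr2; nra.
  lra.
(* The [n]-th root of [chi n b] for positive [n], except that it is 1 if [chi n b] is 0, because
   [ln 0 = 0]; this is harmless as [c >= 1]. *)
pose root n := expR (ln (chi n b)%:R / n%:R) : R.
exists (fun n => Num.max 0 (root n - c)); split.
  apply/cvgrPdist_le => e e0.
  have [n0 Hn] := chi_le b_gt0 b_le1 e0.
  near=> n.
  have n1 : (0 < n)%N by near: n; exists 1%N.
  have nr : 0 < n%:R :> R by rewrite ltr0n.
  have nn0 : (n0 <= n)%N by near: n; exists n0.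
  rewrite sub0r normrN ger0_norm ?le_max ?lexx//.
  rewrite ge_max (ltW e0)/= lerBlDl -[leRHS]lnK ?posrE; last by lra.
  rewrite ler_expR ler_pdivrMr// mulr_natr -lnXn; last by lra.
  have [->|chi0] := posnP (chi n b).
    by rewrite ln0// ln_ge0// exprn_ege1//; lra.
  by rewrite ler_ln ?posrE ?ltr0n ?Hn// exprn_gt0//; lra.
move=> n; have [->|n_gt0] := posnP n.
  (* No set of diameter 1 exists in dimension 0, so zero parts suffice vacuously. *)
  rewrite expr0 (_ : chi 0 b = 0%N)//; apply/eqP; rewrite -leqn0.
  apply: (chiP 0 b_gt0).2 => F dF; exfalso.
  have [x Fx] : F !=set0.
    apply/set0P/eqP => F0; move: dF.
    by rewrite /diam F0 set0X image_set0 ereal_sup0.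
  have : (diam F <= 0)%E.
    apply: ge_ereal_sup => _ [[y z] /= _ <-].
    by rewrite /edist big_ord0 sqrtr0.
  by rewrite dF lee_fin ler10.
have nr : 0 < n%:R :> R by rewrite ltr0n.
apply: (@le_trans _ _ (root n ^+ n)); last first.
  rewrite lerXn2r ?nnegrE ?expR_ge0//.
    by rewrite addr_ge0 ?le_max ?lexx//; lra.
  by rewrite -lerBlDl le_max lexx orbT.
rewrite /root -expRM_natl mulrCA mulfV ?mulr1 ?gt_eqF//.
have [->|chi0] := posnP (chi n b); first exact: expR_ge0.
by rewrite lnK// posrE ltr0n.
Unshelve. all: by end_near.
Qed.
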